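(* Let $H$ be a finite-dimensional pointed Hopf algebra over a field $k$ such that $H_{\mathrm{ab}}=k[\bar G]$ is a group algebra, with $\bar G=G(H_{\mathrm{ab}})$. Let $n=\dim H$ and $\ell=\mathrm{card}\,G(H)$. Define integers $d,r$ as follows: if $\bar G$ is trivial, $d=r=0$; otherwise write the primary decomposition $\bar G\cong \mathbb{Z}/p_1^{e_1}\times\cdots\times\mathbb{Z}/p_r^{e_r}$ ($r\ge1$, $p_i$ primes, $e_i\ge1$) and set $d=p_1^{e_1}+\cdots+p_r^{e_r}$. Then there exist elements $u_1,\dots,u_n\in S(t_H)$ such that each of $u_1,\dots,u_\ell$ is a monomial of degree $\le d-r+1$ in the variables $t_g$ ($g\in G(H)$), each of $u_{\ell+1},\dots,u_n$ is a product of at most two elements of the form $t_x$ ($x\in H$), $u_1,\dots,u_\ell$ are invertible in $\mathrm{Frac}\,S(t_H)$, and $$\mathcal{B}_H=k[u_1^{\pm1},\dots,u_\ell^{\pm1},u_{\ell+1},\dots,u_n],$$ the subalgebra of $\mathrm{Frac}\,S(t_H)$ generated by $u_1^{\pm1},\dots,u_\ell^{\pm1},u_{\ell+1},\dots,u_n$.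
   Context: A Hopf algebra is pointed if every simple subcoalgebra is one-dimensional; $G(\cdot)$ denotes group-like elements; $H_{\mathrm{ab}}$ is the largest commutative Hopf algebra quotient of $H$. Sweedler notation $\Delta(x)=x_1\otimes x_2$. Let $t_H=\{t_x: x\in H\}$ be a copy of the vector space $H$ ($x\mapsto t_x$ linear isomorphism), $S(t_H)$ its symmetric algebra, and $x\mapsto t^{-1}_x$ the unique linear map from $H$ to $\mathrm{Frac}\,S(t_H)$ with $t_{x_1}t^{-1}_{x_2}=t^{-1}_{x_1}t_{x_2}=\varepsilon(x)1$. The generic base algebra $\mathcal{B}_H$ is the subalgebra of $\mathrm{Frac}\,S(t_H)$ generated by all $\sigma(x,y)=t_{x_1}t_{y_1}t^{-1}_{x_2y_2}$ and $\sigma^{-1}(x,y)=t_{x_1y_1}t^{-1}_{x_2}t^{-1}_{y_2}$, $x,y\in H$. *)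

(* Defs.v *)
From HB Require Import structures.
From mathcomp Require Import all_boot all_order all_algebra all_fingroup all_solvable.
From mathcomp Require Import fraction.
From mathcomp Require Import mpoly.
Set Implicit Arguments. Unset Strict Implicit. Unset Printing Implicit Defensive.
Import GRing.Theory.
Local Open Scope ring_scope.

(* A finite-dimensional Hopf algebra H over a field k of dimension n is     *)
(* given by structure constants w.r.t. a basis e_0,...,e_{n-1}; elements of *)
(* H are row vectors 'rV[k]_n, elements of H (x) H are n x n matrices       *)
(* (entry (j,l) = coefficient of e_j (x) e_l).                              *)

Record HopfData (k : fieldType) (n : nat) := HopfData_ {
  mulc    : 'I_n -> 'I_n -> 'rV[k]_n;
  unitc   : 'rV[k]_n;
  comulc  : 'I_n -> 'M[k]_n;
  counitc : 'I_n -> k;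
  antic   : 'I_n -> 'rV[k]_n
}.

Section Hopf.
Variables (k : fieldType) (n : nat) (H : HopfData k n).

Definition ebas (i : 'I_n) : 'rV[k]_n := delta_mx 0 i.

Definition hmul (x y : 'rV[k]_n) : 'rV[k]_n :=
  \sum_i \sum_j (x 0 i * y 0 j) *: mulc H i j.
Definition hcomul (x : 'rV[k]_n) : 'M[k]_n := \sum_i x 0 i *: comulc H i.
Definition hcounit (x : 'rV[k]_n) : k := \sum_i x 0 i * counitc H i.
Definition hanti (x : 'rV[k]_n) : 'rV[k]_n := \sum_i x 0 i *: antic H i.
Definition tmul (A B : 'M[k]_n) : 'M[k]_n :=
  \sum_p \sum_q \sum_r \sum_s (A p q * B r s) *:
     ((mulc H p r)^T *m (mulc H q s)).

Definition is_hopf : Prop :=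
      (forall x y z, hmul (hmul x y) z = hmul x (hmul y z)) /\
      (forall x, hmul (unitc H) x = x /\ hmul x (unitc H) = x) /\
      (* coassociativity: coefficient of e_a (x) e_b (x) e_l *)
      (forall i a b l, \sum_j comulc H i j l * comulc H j a b
                        = \sum_m comulc H i a m * comulc H m b l) /\
      (forall i j, \sum_l comulc H i l j * counitc H l = (i == j)%:R
                /\ \sum_l comulc H i j l * counitc H l = (i == j)%:R) /\
      (forall i j, hcomul (mulc H i j) = tmul (comulc H i) (comulc H j)
                /\ hcounit (mulc H i j) = counitc H i * counitc H j) /\
      (hcomul (unitc H) = (unitc H)^T *m unitc H /\ hcounit (unitc H) = 1) /\
      (forall i, \sum_j \sum_l comulc H i j l *: hmul (antic H j) (ebas l)
                    = counitc H i *: unitc H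
              /\ \sum_j \sum_l comulc H i j l *: hmul (ebas j) (antic H l)
                    = counitc H i *: unitc H).

Definition grouplike (g : 'rV[k]_n) : Prop :=
  g != 0 /\ hcomul g = g^T *m g.

(* subcoalgebras, represented by a matrix whose rows span the subspace *)
Definition subcoalg (A : 'M[k]_n) : Prop :=
  forall x : 'rV[k]_n, (x <= A)%MS ->
    exists N : 'M[k]_n, hcomul x = A^T *m N *m A.

Definition simple_subcoalg (A : 'M[k]_n) : Prop :=
  subcoalg A /\ A != 0 /\
  forall B : 'M[k]_n, (B <= A)%MS -> subcoalg B -> B = 0 \/ (A <= B)%MS.

Definition pointed : Prop :=
  forall A : 'M[k]_n, simple_subcoalg A -> \rank A = 1%N.

Definition hcomm (b c : 'I_n) : 'rV[k]_n := mulc H b c - mulc H c b.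
Definition in_comm_ideal (x : 'rV[k]_n) : Prop :=
  exists coef : 'I_n -> 'I_n -> 'I_n -> 'I_n -> k,
    x = \sum_a \sum_b \sum_c \sum_d
          coef a b c d *: hmul (hmul (ebas a) (hcomm b c)) (ebas d).

(* pi : H -> k[Gamma] (given on the basis: pib i g = coefficient of g in  *)
(* pi(e_i)) is a surjective bialgebra map whose kernel is the commutator  *)
(* ideal, i.e. it identifies H_ab with the group algebra k[Gamma].        *)
Definition hpi (gT : finGroupType) (pib : 'I_n -> gT -> k)
  (x : 'rV[k]_n) (g : gT) : k := \sum_i x 0 i * pib i g.

Definition Hab_group_algebra (gT : finGroupType) (pib : 'I_n -> gT -> k) : Prop :=
      (forall i j g, hpi pib (mulc H i j) g
                       = \sum_h pib i h * pib j (h^-1 * g)%g) /\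
      (forall g, hpi pib (unitc H) g = (g == 1%g)%:R) /\
      (* coalgebra map: (pi (x) pi) Delta = Delta pi, eps = eps pi *)
      (forall i g1 g2, \sum_j \sum_l comulc H i j l * pib j g1 * pib l g2
                         = if g1 == g2 then pib i g1 else 0) /\
      (forall i, counitc H i = \sum_g pib i g) /\
      (forall f : gT -> k, exists x, forall g, hpi pib x g = f g) /\
      (forall x, (forall g, hpi pib x g = 0) <-> in_comm_ideal x).

(* S(t_H) = k[X_0..X_{n-1}], t_{e_i} = X_i, and its fraction field.         *)
Definition FracS := {fraction {mpoly k[n]}}.
Definition toF (p : {mpoly k[n]}) : FracS := @FracField.tofrac _ p.

Definition tvar (x : 'rV[k]_n) : FracS := toF (\sum_i x 0 i *: 'X_i).

Definition tinvv (tinv : 'I_n -> FracS) (x : 'rV[k]_n) : FracS :=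
  \sum_i toF ((x 0 i)%:MP) * tinv i.

(* t^{-1} is the convolution inverse of t *)
Definition is_tinv (tinv : 'I_n -> FracS) : Prop :=
  forall i,
    \sum_j \sum_l toF ((comulc H i j l)%:MP) * (tvar (ebas j) * tinv l)
      = toF ((counitc H i)%:MP)
 /\ \sum_j \sum_l toF ((comulc H i j l)%:MP) * (tinv j * tvar (ebas l))
      = toF ((counitc H i)%:MP).

(* sigma(e_i,e_j) and sigma^{-1}(e_i,e_j) (sigma is bilinear) *)
Definition sigma (tinv : 'I_n -> FracS) (i j : 'I_n) : FracS :=
  \sum_a \sum_b \sum_p \sum_q
     toF ((comulc H i a b * comulc H j p q)%:MP) *
     (tvar (ebas a) * tvar (ebas p) * tinvv tinv (mulc H b q)).
Definition sigmainv (tinv : 'I_n -> FracS) (i j : 'I_n) : FracS :=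
  \sum_a \sum_b \sum_p \sum_q
     toF ((comulc H i a b * comulc H j p q)%:MP) *
     (tvar (mulc H a p) * tinv b * tinv q).

End Hopf.

Inductive gen_alg (k : fieldType) (n : nat) (S : FracS k n -> Prop)
   : FracS k n -> Prop :=
| gen_base z : S z -> gen_alg S z
| gen_const c : gen_alg S (toF (c%:MP))
| gen_add z w : gen_alg S z -> gen_alg S w -> gen_alg S (z + w)
| gen_mul z w : gen_alg S z -> gen_alg S w -> gen_alg S (z * w).

Definition base_alg (k : fieldType) (n : nat) (H : HopfData k n)
  (tinv : 'I_n -> FracS k n) : FracS k n -> Prop :=
  gen_alg (fun z => exists i j, z = sigma H tinv i j \/ z = sigmainv H tinv i j).

Definition prime_power (m : nat) : Prop :=
  exists p e, prime p /\ (0 < e)%N /\ m = (p ^ e)%N.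

(* Main.v *)
(* Let F be the algebra generated by the t_x and t^-1_x. The projection pi of H onto
   k[Gamma] grades F by Gamma, t_x having degree g when x_1 (x) pi(x_2) = x (x) g, and
   the point is that B_H is the component of degree 1. Given this, the generators are
   explicit: as H is pointed, grouplikes of every degree exist, and a basis of H made
   of G(H) and of homogeneous elements x is brought to degree 1 by multiplying t_x
   with one t_h, and t_g with a monomial in the t_h for h lifting the cyclic
   generators of Gamma.
   That B_H lies in degree 1 is checked on t^-1, along a chain of right coideals with
   one-dimensional quotients. For the converse, F is the B_H-span of the t_x. For a
   B_H-linear form p : F -> B_H, the map x |-> p(u t^-1_(x_1)) t_(x_2) kills the
   commutator ideal of H, since x |-> t^-1_(x_1) (x) t_(x_2) is multiplicative into
   F (x) F over B_H; this gives p(1) t_x = p(t_x) for t_x of degree 1. A form with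
   p(1) != 0 exists by linear algebra over the fraction field, so the conductor of the
   degree 1 part in B_H is nonzero. It is stable under the translations
   t_x |-> y_(x_1) t_(x_2), hence generates the unit ideal of F, and the determinant
   trick shows that it contains 1. *)

Require Import Defs.
From HB Require Import structures.
From mathcomp Require Import all_boot all_order all_algebra all_fingroup all_solvable.
From mathcomp Require Import fraction.
From mathcomp Require Import mpoly.
From mathcomp Require Import ring.
From Stdlib Require Import FunctionalExtensionality Classical ClassicalEpsilon.
Set Implicit Arguments. Unset Strict Implicit. Unset Printing Implicit Defensive.
Import GRing.Theory.
Local Open Scope ring_scope.

(** A grading is just a multiplicative family of subspaces ([is_graded]), so constant families
    count, and the one chain argument [graded_tinv] places t^-1 in three different algebras: the
    B-span of the t_x, a localization of S(t_H), and the algebra built from the proposed generators.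
    Forms with values in B stand in for a tensor product over B, at the price of the factor p(1);
    the second half of the proof removes it. A nonzero polynomial f of the conductor has a translate
    with coefficients in the conductor, and substituting Y_x |-> Y_(x_1) t^-1_(x_2) in it gives back
    f(Y), whose coefficients are scalars of k: hence the unit ideal. The determinant trick applies
    because F is spanned over B by the n elements t_x. Translation acts on polynomials only, so
    fractions are cleared by a power of a polynomial s: a product of t_g with g grouplike, a unit of
    B, and sent by translation to s(t) s(Y). The bound d - r + 1 adds to t_g itself an exponent of
    at most #[x] - 1 for each cyclic generator x. *)

Section Convolution.
Variables (R : comNzRingType) (I : finType) (cc : I -> I -> I -> R).

(** The product of linear maps dual to the comultiplication with structure constants [cc]. The index
    type is arbitrary, so that the same lemmas serve [H] and, with pairs as indices, [H (x) H]. *)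
Definition conv (f g : I -> R) : I -> R :=
  fun i => \sum_j \sum_l cc i j l * (f j * g l).

Lemma conv_suml (J : Type) (r : seq J) (P : pred J) (F : J -> I -> R) g i :
  conv (fun j => \sum_(x <- r | P x) F x j) g i =
  \sum_(x <- r | P x) conv (F x) g i.
Proof.
rewrite /conv [RHS]exchange_big; apply: eq_bigr => j _ /=.
rewrite [RHS]exchange_big; apply: eq_bigr => l _ /=.
by rewrite mulr_suml mulr_sumr.
Qed.

Lemma conv_sumr (J : Type) (r : seq J) (P : pred J) (F : J -> I -> R) g i :
  conv g (fun j => \sum_(x <- r | P x) F x j) i =
  \sum_(x <- r | P x) conv g (F x) i.
Proof.
rewrite /conv [RHS]exchange_big; apply: eq_bigr => j _ /=.
rewrite [RHS]exchange_big; apply: eq_bigr => l _ /=.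
by rewrite !mulr_sumr.
Qed.

Lemma conv_scalel a f g : conv (fun i => a * f i) g = fun i => a * conv f g i.
Proof.
apply: functional_extensionality => i; rewrite /conv mulr_sumr.
by apply: eq_bigr => j _; rewrite mulr_sumr; apply: eq_bigr => l _; ring.
Qed.

Lemma conv_scaler a f g : conv f (fun i => a * g i) = fun i => a * conv f g i.
Proof.
apply: functional_extensionality => i; rewrite /conv mulr_sumr.
by apply: eq_bigr => j _; rewrite mulr_sumr; apply: eq_bigr => l _; ring.
Qed.

Lemma convA : (forall i a b l, \sum_j cc i j l * cc j a b
                             = \sum_m cc i a m * cc m b l) ->
  forall f g h, conv f (conv g h) = conv (conv f g) h.
Proof.
move=> coassoc f g h; apply: functional_extensionality => i; rewrite /conv.
transitivity (\sum_a \sum_b \sum_l (\sum_m cc i a m * cc m b l) * (f a * g b * h l)).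
  apply: eq_bigr => a _.
  under eq_bigr => j _ do rewrite !mulr_sumr.
  rewrite exchange_big; apply: eq_bigr => b _ /=.
  under eq_bigr => j _ do rewrite !mulr_sumr.
  rewrite exchange_big; apply: eq_bigr => l _ /=.
  by rewrite mulr_suml; apply: eq_bigr => m _; ring.
under eq_bigr => a _ do under eq_bigr => b _ do under eq_bigr => l _ do
  rewrite -coassoc.
transitivity (\sum_j \sum_l \sum_a \sum_b cc i j l * (cc j a b * (f a * g b) * h l)).
  under [RHS]eq_bigr => j _ do rewrite exchange_big.
  rewrite [RHS]exchange_big; apply: eq_bigr => a _ /=.
  under [RHS]eq_bigr => j _ do under eq_bigr => l _ do rewrite -mulr_sumr.
  under [RHS]eq_bigr => j _ do under eq_bigr => l _ do rewrite mulr_sumr.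
  under [RHS]eq_bigr => j _ do rewrite exchange_big.
  rewrite [RHS]exchange_big; apply: eq_bigr => b _ /=.
  rewrite [RHS]exchange_big; apply: eq_bigr => l _ /=.
  by rewrite mulr_suml; apply: eq_bigr => j _; ring.
apply: eq_bigr => j _; apply: eq_bigr => l _; rewrite mulr_suml mulr_sumr.
by apply: eq_bigr => a _; rewrite mulr_suml mulr_sumr.
Qed.

Lemma convlE (e : I -> R) f : (forall i j, \sum_l cc i l j * e l = (i == j)%:R) ->
  conv e f = f.
Proof.
move=> He; apply: functional_extensionality => i; rewrite /conv exchange_big /=.
rewrite (bigD1 i) //= [X in _ + X]big1 ?addr0 => [|l ne_li].
  under eq_bigr => j _ do rewrite mulrA.
  by rewrite -mulr_suml He eqxx mul1r.
under eq_bigr => j _ do rewrite mulrA.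
by rewrite -mulr_suml He eq_sym (negPf ne_li) mul0r.
Qed.

Lemma convrE (e : I -> R) f : (forall i j, \sum_l cc i j l * e l = (i == j)%:R) ->
  conv f e = f.
Proof.
move=> He; apply: functional_extensionality => i; rewrite /conv.
rewrite (bigD1 i) //= [X in _ + X]big1 ?addr0 => [|j ne_ji].
  under eq_bigr => l _ do rewrite (mulrC (f i)) mulrA.
  by rewrite -mulr_suml He eqxx mul1r.
under eq_bigr => l _ do rewrite (mulrC (f j)) mulrA.
by rewrite -mulr_suml He eq_sym (negPf ne_ji) mul0r.
Qed.

End Convolution.

(** * Convolution on [H] and [H (x) H] with values in a commutative ring under [k] *)

Section HopfConvolution.
Variables (k : fieldType) (n : nat) (H : HopfData k n).
Hypothesis hopfH : is_hopf H.
Variables (R : comNzRingType) (io : {rmorphism k -> R}).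

(** Linear maps [H -> R] are kept as their values on the basis, bilinear ones as functions on pairs.
    [cHH] is the coproduct of [H (x) H], for which bilinear maps convolve; [mus f] is [f]
    precomposed with the multiplication of [H]. *)
Definition cH (i j l : 'I_n) : R := io (comulc H i j l).
Definition cHH (x y z : 'I_n * 'I_n) : R :=
  io (comulc H x.1 y.1 z.1 * comulc H x.2 y.2 z.2).
Definition eH (i : 'I_n) : R := io (counitc H i).
Definition tens (f g : 'I_n -> R) (x : 'I_n * 'I_n) : R := f x.1 * g x.2.
Definition mus (f : 'I_n -> R) (x : 'I_n * 'I_n) : R :=
  \sum_m io (mulc H x.1 x.2 0 m) * f m.
Definition ev (f : 'I_n -> R) (x : 'rV[k]_n) : R := \sum_i io (x 0 i) * f i.

Local Notation "f ** g" := (conv cH f g) (at level 40, left associativity).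
Local Notation "f *** g" := (conv cHH f g) (at level 40, left associativity).

Lemma cH_coassoc i a b l :
  \sum_j cH i j l * cH j a b = \sum_m cH i a m * cH m b l.
Proof.
have [_ [_ [Ha _]]] := hopfH; have := congr1 io (Ha i a b l).
by rewrite !rmorph_sum /=; under eq_bigr => j _ do rewrite rmorphM;
  under [in RHS]eq_bigr => j _ do rewrite rmorphM.
Qed.

Lemma cHA f g h : f ** (g ** h) = (f ** g) ** h.
Proof. exact: convA cH_coassoc _ _ _. Qed.

Lemma cH_counitl i j : \sum_l cH i l j * eH l = (i == j)%:R.
Proof.
have [_ [_ [_ [He _]]]] := hopfH; have [/(congr1 io) He1 _] := He i j.
move: He1; rewrite rmorph_sum rmorph_nat /= => <-.
by apply: eq_bigr => l _; rewrite rmorphM.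
Qed.

Lemma cH_counitr i j : \sum_l cH i j l * eH l = (i == j)%:R.
Proof.
have [_ [_ [_ [He _]]]] := hopfH; have [_ /(congr1 io) He1] := He i j.
move: He1; rewrite rmorph_sum rmorph_nat /= => <-.
by apply: eq_bigr => l _; rewrite rmorphM.
Qed.

Lemma cH1f f : eH ** f = f. Proof. exact: convlE cH_counitl. Qed.
Lemma cHf1 f : f ** eH = f. Proof. exact: convrE cH_counitr. Qed.

Lemma cHHA f g h : f *** (g *** h) = (f *** g) *** h.
Proof.
apply: convA => -[i i'] [a a'] [b b'] [l l']; rewrite /cHH /=.
rewrite -(pair_bigA _ (fun j j' => io (comulc H i j l * comulc H i' j' l')
          * io (comulc H j a b * comulc H j' a' b'))) /=.
rewrite -(pair_bigA _ (fun j j' => io (comulc H i a j * comulc H i' a' j')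
          * io (comulc H j b l * comulc H j' b' l'))) /=.
transitivity ((\sum_j cH i j l * cH j a b) * (\sum_j cH i' j l' * cH j a' b')).
  rewrite mulr_suml; apply: eq_bigr => j _; rewrite mulr_sumr.
  by apply: eq_bigr => j' _; rewrite !rmorphM /cH; ring.
rewrite !cH_coassoc mulr_suml; apply: eq_bigr => j _; rewrite mulr_sumr.
by apply: eq_bigr => j' _; rewrite !rmorphM /cH; ring.
Qed.

Lemma tens_conv f g f' g' : tens f g *** tens f' g' = tens (f ** f') (g ** g').
Proof.
apply: functional_extensionality => -[i i']; rewrite /conv /tens /cHH /=.
rewrite -(pair_bigA _ (fun j j' => \sum_(l : 'I_n * 'I_n)
  io (comulc H i j l.1 * comulc H i' j' l.2) * (f j * g j' * (f' l.1 * g' l.2)))) /=.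
rewrite mulr_suml; apply: eq_bigr => j _; rewrite mulr_sumr.
apply: eq_bigr => j' _.
rewrite -(pair_bigA _ (fun l l' => io (comulc H i j l * comulc H i' j' l')
          * (f j * g j' * (f' l * g' l')))) /=.
rewrite mulr_suml; apply: eq_bigr => l _; rewrite mulr_sumr.
by apply: eq_bigr => l' _; rewrite rmorphM /cH; ring.
Qed.

Lemma evD f x y : ev f (x + y) = ev f x + ev f y.
Proof.
by rewrite /ev -big_split; apply: eq_bigr => i _; rewrite mxE rmorphD mulrDl.
Qed.

Lemma evZ f a x : ev f (a *: x) = io a * ev f x.
Proof.
by rewrite /ev mulr_sumr; apply: eq_bigr => i _; rewrite mxE rmorphM mulrA.
Qed.

Lemma ev0 f : ev f 0 = 0.
Proof. by rewrite /ev big1 // => i _; rewrite mxE rmorph0 mul0r. Qed.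

Lemma ev_sum f (J : Type) (r : seq J) (P : pred J) (F : J -> 'rV[k]_n) :
  ev f (\sum_(j <- r | P j) F j) = \sum_(j <- r | P j) ev f (F j).
Proof. by apply: (big_morph (ev f)); [apply: evD|apply: ev0]. Qed.

Lemma ev_ebas f i : ev f (ebas k i) = f i.
Proof.
rewrite /ev (bigD1 i) //= big1 => [|j ne]; rewrite /ebas mxE ?eqxx.
  by rewrite rmorph1 mul1r addr0.
by rewrite (negPf ne) rmorph0 mul0r.
Qed.

Lemma ev_mulc f i j : ev f (mulc H i j) = mus f (i, j).
Proof. by []. Qed.

Lemma ev_hmul f x y :
  ev f (hmul H x y) = \sum_i \sum_j io (x 0 i * y 0 j) * mus f (i, j).
Proof.
rewrite /hmul ev_sum; apply: eq_bigr => i _; rewrite ev_sum.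
by apply: eq_bigr => j _; rewrite evZ.
Qed.

Lemma ev_conv f g x :
  ev (f ** g) x = \sum_j \sum_l io (hcomul H x j l) * (f j * g l).
Proof.
rewrite /ev /conv; under eq_bigr => i _ do rewrite mulr_sumr.
rewrite exchange_big; apply: eq_bigr => j _ /=.
under eq_bigr => i _ do rewrite mulr_sumr.
rewrite exchange_big; apply: eq_bigr => l _ /=.
rewrite /hcomul summxE rmorph_sum mulr_suml; apply: eq_bigr => i _.
by rewrite mxE rmorphM /cH; ring.
Qed.

Lemma ev_rows f g (A : 'M[k]_n) :
  \sum_j \sum_l io (A j l) * (f j * g l) = \sum_l ev f (row l A^T) * g l.
Proof.
rewrite exchange_big; apply: eq_bigr => l _ /=; rewrite /ev mulr_suml.
by apply: eq_bigr => j _; rewrite !mxE mulrA.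
Qed.

Lemma ev_outer f g (x y : 'rV[k]_n) :
  \sum_j \sum_l io ((x^T *m y) j l) * (f j * g l) = ev f x * ev g y.
Proof.
rewrite /ev mulr_suml; apply: eq_bigr => j _; rewrite mulr_sumr.
apply: eq_bigr => l _; rewrite mxE big_ord_recl big_ord0 addr0 mxE rmorphM.
by ring.
Qed.

Lemma ev_conv_grouplike f g x : grouplike H x -> ev (f ** g) x = ev f x * ev g x.
Proof. by case=> _ Hx; rewrite ev_conv Hx ev_outer. Qed.

(** Multiplication [H (x) H -> H] is a coalgebra map, so composing with it respects convolution. *)
Lemma mus_conv f g : mus (f ** g) = mus f *** mus g.
Proof.
have [_ [_ [_ [_ [Hm _]]]]] := hopfH.
apply: functional_extensionality => -[i i'].
transitivity (ev (f ** g) (mulc H i i')); first by [].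
rewrite ev_conv (proj1 (Hm i i')) /tmul /conv /cHH /=.
transitivity (\sum_p \sum_q \sum_r \sum_s
   io (comulc H i p q * comulc H i' r s) *
   (mus f (p, r) * mus g (q, s))); last first.
  rewrite -(pair_bigA _ (fun j j' => \sum_(l : 'I_n * 'I_n)
    io (comulc H i j l.1 * comulc H i' j' l.2) * (mus f (j, j') * mus g l))) /=.
  apply: eq_bigr => p _; rewrite exchange_big; apply: eq_bigr => r _ /=.
  by rewrite [RHS](eq_bigr (fun l => io (comulc H i p l.1 * comulc H i' r l.2)
    * (mus f (p, r) * mus g (l.1, l.2)))) => [|[] //]; rewrite pair_bigA.
transitivity (\sum_p \sum_q \sum_r \sum_s \sum_j \sum_l
   io ((comulc H i p q * comulc H i' r s) *
     ((mulc H p r)^T *m mulc H q s) j l) * (f j * g l)).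
  under eq_bigr => j _ do under eq_bigr => l _ do
    rewrite summxE rmorph_sum mulr_suml.
  under eq_bigr => j _ do rewrite exchange_big.
  rewrite exchange_big; apply: eq_bigr => p _ /=.
  under eq_bigr => j _ do under eq_bigr => l _ do
    rewrite summxE rmorph_sum mulr_suml.
  under eq_bigr => j _ do rewrite exchange_big.
  rewrite exchange_big; apply: eq_bigr => q _ /=.
  under eq_bigr => j _ do under eq_bigr => l _ do
    rewrite summxE rmorph_sum mulr_suml.
  under eq_bigr => j _ do rewrite exchange_big.
  rewrite exchange_big; apply: eq_bigr => r _ /=.
  under eq_bigr => j _ do under eq_bigr => l _ do
    rewrite summxE rmorph_sum mulr_suml.
  under eq_bigr => j _ do rewrite exchange_big.
  rewrite exchange_big; apply: eq_bigr => s _ /=.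
  by apply: eq_bigr => j _; apply: eq_bigr => l _; rewrite mxE.
do 4![apply: eq_bigr => ? _].
rewrite -!ev_mulc -ev_outer mulr_sumr; apply: eq_bigr => j _.
by rewrite mulr_sumr; apply: eq_bigr => l _; rewrite rmorphM -mulrA.
Qed.

Lemma mus_eH : mus eH = tens eH eH.
Proof.
have [_ [_ [_ [_ [Hm _]]]]] := hopfH.
apply: functional_extensionality => -[i i'].
rewrite /tens /eH -rmorphM /= -(proj2 (Hm i i')) /hcounit rmorph_sum.
by apply: eq_bigr => j _; rewrite rmorphM.
Qed.

Lemma cHH1f f : tens eH eH *** f = f.
Proof.
apply: convlE => -[i i'] [j j']; rewrite /cHH /tens /=.
rewrite -(pair_bigA _ (fun l l' => io (comulc H i l j * comulc H i' l' j')
          * (eH l * eH l'))) /=.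
transitivity ((\sum_l cH i l j * eH l) * (\sum_l cH i' l j' * eH l)).
  rewrite mulr_suml; apply: eq_bigr => l _; rewrite mulr_sumr.
  by apply: eq_bigr => l' _; rewrite rmorphM /cH; ring.
by rewrite !cH_counitl -natrM mulnb xpair_eqE.
Qed.

Lemma cHHf1 f : f *** tens eH eH = f.
Proof.
apply: convrE => -[i i'] [j j']; rewrite /cHH /tens /=.
rewrite -(pair_bigA _ (fun l l' => io (comulc H i j l * comulc H i' j' l')
          * (eH l * eH l'))) /=.
transitivity ((\sum_l cH i j l * eH l) * (\sum_l cH i' j' l * eH l)).
  rewrite mulr_suml; apply: eq_bigr => l _; rewrite mulr_sumr.
  by apply: eq_bigr => l' _; rewrite rmorphM /cH; ring.
by rewrite !cH_counitr -natrM mulnb xpair_eqE.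
Qed.

End HopfConvolution.

(** * Naturality of convolution in the target ring *)

Section ChangeOfRing.
Variables (k : fieldType) (n : nat) (H : HopfData k n).
Variables (R R' : comNzRingType) (io : {rmorphism k -> R}).
Variables (io' : {rmorphism k -> R'}) (phi : {rmorphism R -> R'}).
Hypothesis phi_io : forall a, phi (io a) = io' a.

Lemma conv_rmorph (f g : 'I_n -> R) i :
  phi (conv (cH H io) f g i) = conv (cH H io') (phi \o f) (phi \o g) i.
Proof.
rewrite /conv rmorph_sum; apply: eq_bigr => j _; rewrite rmorph_sum.
by apply: eq_bigr => l _; rewrite !rmorphM /cH phi_io.
Qed.

Lemma conv2_rmorph (f g : 'I_n * 'I_n -> R) i :
  phi (conv (cHH H io) f g i) = conv (cHH H io') (phi \o f) (phi \o g) i.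
Proof.
rewrite /conv rmorph_sum; apply: eq_bigr => j _; rewrite rmorph_sum.
by apply: eq_bigr => l _; rewrite !rmorphM /cHH phi_io.
Qed.

Lemma mus_rmorph (f : 'I_n -> R) i : phi (mus H io f i) = mus H io' (phi \o f) i.
Proof.
by rewrite /mus rmorph_sum; apply: eq_bigr => j _; rewrite rmorphM phi_io.
Qed.

Lemma tens_rmorph (f g : 'I_n -> R) i :
  phi (tens f g i) = tens (phi \o f) (phi \o g) i.
Proof. by rewrite /tens rmorphM. Qed.

Lemma ev_rmorph (f : 'I_n -> R) x : phi (ev io f x) = ev io' (phi \o f) x.
Proof.
by rewrite /ev rmorph_sum; apply: eq_bigr => j _; rewrite rmorphM phi_io.
Qed.

End ChangeOfRing.

(** * Right coideals and grouplikes of a pointed coalgebra *)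

Section PointedCoalgebra.
Variables (k : fieldType) (n : nat) (H : HopfData k n).
Hypothesis hopfH : is_hopf H.

(* [x *m Rhit a] is [x_1 e_a^*(x_2)] and [x *m Lhit phi] is [phi(x_1) x_2]. *)
Definition Rhit (a : 'I_n) : 'M[k]_n := \matrix_(i, j) comulc H i j a.
Definition Lhit (phi : 'cV[k]_n) : 'M[k]_n :=
  \matrix_(i, l) \sum_j phi j 0 * comulc H i j l.
Definition counit_col : 'cV[k]_n := \col_i counitc H i.

Lemma hcomul_Rhit (x : 'rV[k]_n) a : row a (hcomul H x)^T = x *m Rhit a.
Proof.
apply/rowP=> j; rewrite !mxE summxE; apply: eq_bigr => i _.
by rewrite !mxE.
Qed.

Lemma hcomul_Lhit (x : 'rV[k]_n) a : row a (hcomul H x) = x *m Lhit (delta_mx a 0).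
Proof.
apply/rowP=> l; rewrite !mxE summxE; apply: eq_bigr => i _.
rewrite !mxE (bigD1 a) //= big1 => [|j ne]; first by rewrite mxE !eqxx mul1r addr0.
by rewrite mxE (negPf ne) mul0r.
Qed.

(** Coassociativity: the hits from the two sides commute, so every [Lhit phi] is an endomorphism of
    the right comodule [H]. *)
Lemma Lhit_Rhit phi a : Lhit phi *m Rhit a = Rhit a *m Lhit phi.
Proof.
have [_ [_ [Ha _]]] := hopfH.
apply/matrixP=> i l; rewrite !mxE.
transitivity (\sum_j phi j 0 * \sum_m comulc H i j m * comulc H m l a).
  under eq_bigr => m _ do rewrite !mxE mulr_suml.
  rewrite exchange_big; apply: eq_bigr => j _ /=.
  by rewrite mulr_sumr; apply: eq_bigr => m _; rewrite mulrA.
under eq_bigr => j _ do rewrite -Ha mulr_sumr.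
rewrite exchange_big; apply: eq_bigr => m _ /=.
rewrite !mxE mulr_sumr; apply: eq_bigr => j _; ring.
Qed.

(** Coassociativity again. If [phi] vanishes on a right coideal, so does [Rhit a *m phi]; hence the
    sum of the images of [W] under all such [Lhit phi] is stable under left hits too. *)
Lemma Lhit_comp phi a : Lhit phi *m Lhit (delta_mx a 0) = Lhit (Rhit a *m phi).
Proof.
have [_ [_ [Ha _]]] := hopfH.
apply/matrixP=> i l; rewrite !mxE.
transitivity (\sum_j phi j 0 * \sum_m comulc H i j m * comulc H m a l).
  under eq_bigr => m _.
    rewrite !mxE [X in _ * X](bigD1 a) //= [X in _ + X]big1 => [|j ne].
      by rewrite !mxE !eqxx mul1r addr0 mulr_suml; over.
    by rewrite mxE (negPf ne) mul0r.
  rewrite exchange_big; apply: eq_bigr => j _ /=.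
  by rewrite mulr_sumr; apply: eq_bigr => m _; rewrite mulrA.
under eq_bigr => j _ do rewrite -Ha mulr_sumr.
rewrite exchange_big; apply: eq_bigr => m _ /=.
rewrite !mxE mulr_suml; apply: eq_bigr => j _; rewrite !mxE; ring.
Qed.

Lemma Lhit_counit : Lhit counit_col = 1%:M.
Proof.
have [_ [_ [_ [He _]]]] := hopfH.
apply/matrixP=> i l; rewrite !mxE -(proj1 (He i l)).
by apply: eq_bigr => j _; rewrite mxE mulrC.
Qed.

Lemma Lhit_mul_counit phi : Lhit phi *m counit_col = phi.
Proof.
have [_ [_ [_ [He _]]]] := hopfH.
apply/matrixP=> i j0; rewrite (ord1 j0) !mxE.
transitivity (\sum_j phi j 0 * \sum_m comulc H i j m * counitc H m).
  under eq_bigr => m _ do rewrite !mxE mulr_suml.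
  rewrite exchange_big; apply: eq_bigr => j _ /=.
  by rewrite mulr_sumr; apply: eq_bigr => m _; rewrite mulrA.
under eq_bigr => j _ do rewrite (proj2 (He i j)).
rewrite (bigD1 i) //= big1 => [|j ne]; first by rewrite eqxx mulr1 addr0.
by rewrite eq_sym (negPf ne) mulr0.
Qed.

Definition rcoideal (Z : 'M[k]_n) : Prop := forall a, (Z *m Rhit a <= Z)%MS.

(** Stability on both sides puts [Delta(x)] in [C (x) H] and in [H (x) C], whose intersection is
    [C (x) C]; pseudo-inverses produce the matrix [N]. *)
Lemma subcoalg_of_hit (C : 'M[k]_n) : rcoideal C ->
  (forall a, (C *m Lhit (delta_mx a 0) <= C)%MS) -> subcoalg H C.
Proof.
move=> CR CL x xC; set A := hcomul H x.
have A1 : (A <= C)%MS.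
  by apply/row_subP=> a; rewrite hcomul_Lhit; apply: submx_trans (CL a);
     apply: submxMr.
have A2 : (A^T <= C)%MS.
  by apply/row_subP=> a; rewrite hcomul_Rhit; apply: submx_trans (CR a);
     apply: submxMr.
exists ((pinvmx C)^T *m A *m pinvmx C).
rewrite !mulmxA -trmx_mul -[in LHS](mulmxKpV A1) -[in LHS](trmxK A).
by rewrite -[in LHS](mulmxKpV A2) !trmx_mul !trmxK !mulmxA.
Qed.

Lemma simple_subcoalg_exists (C : 'M[k]_n) : subcoalg H C -> C != 0 ->
  exists D, (D <= C)%MS /\ simple_subcoalg H D.
Proof.
move: {2}(\rank C).+1 (ltnSn (\rank C)) => r; elim: r C => // r IH C ltr sC nz.
case: (classic (simple_subcoalg H C)) => [sim|nsim]; first by exists C.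
have [D [DC sD nzD ltD]] : exists D, [/\ (D <= C)%MS, subcoalg H D, D != 0
                                       & ~~ (C <= D)%MS].
  apply: NNPP => no; apply: nsim; split=> //; split=> // D DC sD.
  have [->|nzD] := eqVneq D 0; first by left.
  right; apply/negPn/negP => nCD; apply: no; by exists D.
have /IH [//|//|E [ED simE]] : (\rank D < r)%N.
  rewrite -ltnS (leq_trans _ ltr) // ltnS.
  by rewrite (ltn_leqif (mxrank_leqif_sup DC)).
by exists E; split=> //; apply: submx_trans DC.
Qed.

Lemma Rhit_grouplike g a : grouplike H g -> g *m Rhit a = g 0 a *: g.
Proof.
case=> _ gg; rewrite -hcomul_Rhit gg; apply/rowP=> j.
by rewrite !mxE big_ord_recl big_ord0 addr0 mxE mulrC.
Qed.

Lemma mul_Lhit (x : 'rV[k]_n) phi : x *m Lhit phi = phi^T *m hcomul H x.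
Proof.
apply/rowP=> l; rewrite !mxE.
under eq_bigr => i _ do rewrite mxE mulr_sumr.
rewrite exchange_big; apply: eq_bigr => j _ /=.
rewrite !mxE summxE mulr_sumr; apply: eq_bigr => i _; rewrite mxE; ring.
Qed.

Lemma hcomulZ a x : hcomul H (a *: x) = a *: hcomul H x.
Proof.
rewrite /hcomul scaler_sumr; apply: eq_bigr => i _.
by rewrite mxE scalerA.
Qed.

(** A simple subcoalgebra is a line spanned by some [d] with [Delta(d) = a d (x) d]. The counit
    forces [a != 0], and then [a *: d] is grouplike. *)
Lemma grouplike_in_subcoalg (C : 'M[k]_n) : pointed H -> subcoalg H C -> C != 0 ->
  exists g, (g <= C)%MS /\ grouplike H g.
Proof.
move=> ptH sC nzC; have [D [DC simD]] := simple_subcoalg_exists sC nzC.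
have rD := ptH _ simD; have [sD [nzD _]] := simD.
have /rowV0Pn [d dD nzd] := nzD.
have Dd : (D <= d)%MS.
  by rewrite -(mxrank_leqif_sup dD) rD rank_rV nzd.
have [N dN] := sD d dD; have [y Dy] := submxP Dd.
pose a := (y^T *m N *m y) 0 0.
have da : hcomul H d = a *: (d^T *m d).
  rewrite dN Dy trmx_mul !mulmxA -(mulmxA _ y^T) -(mulmxA _ (y^T *m N)).
  by rewrite [y^T *m N *m y]mx11_scalar mul_mx_scalar -scalemxAl.
have nza : a != 0.
  apply: contraNneq nzd => a0; rewrite -[d]mulmx1 -Lhit_counit mul_Lhit da a0.
  by rewrite scale0r mulmx0.
exists (a *: d); split; first by rewrite scalemx_sub // (submx_trans dD).
split; first by rewrite scaler_eq0 negb_or nza.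
rewrite hcomulZ da [(a *: d)^T]linearZ /=.
by rewrite -[RHS]scalemxAl -scalemxAr.
Qed.

(* With [W] minimal above [Z], the subcoalgebra of matrix coefficients of [W / Z]
   is the sum of the images of the colinear maps [Lhit phi], [phi] vanishing on
   [Z]; it contains a grouplike [g], and lifting [g] through the last image
   needed to reach it produces [v]. *)
Lemma rcoideal_step_min (Z W : 'M[k]_n) : pointed H -> rcoideal Z -> rcoideal W ->
  (Z <= W)%MS -> ~~ (W <= Z)%MS ->
  (forall X, rcoideal X -> (Z <= X)%MS -> (X <= W)%MS -> (X <= Z)%MS \/ (W <= X)%MS) ->
  exists v g : 'rV[k]_n, [/\ (v <= W)%MS, ~~ (v <= Z)%MS, grouplike H g
    & forall a, (v *m Rhit a - g 0 a *: v <= Z)%MS].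
Proof.
move=> ptH cZ cW ZW nWZ minW.
(* The columns of [K] span the functionals vanishing on [Z]. *)
pose K := (kermx Z^T)^T.
have ZK : Z *m K = 0 by apply: trmx_inj; rewrite trmx_mul trmxK trmx0 mulmx_ker.
have Kfull (phi : 'cV[k]_n) : Z *m phi = 0 -> exists y, phi = K *m y.
  move=> /(congr1 trmx); rewrite trmx_mul trmx0 => /sub_kermxP /submxP [y yE].
  by exists y^T; apply: trmx_inj; rewrite yE trmx_mul trmxK /K trmxK.
pose img i := (W *m Lhit (col i K))%MS.
pose C := (\sum_(i < n) <<img i>>)%MS.
have imgR i a : (img i *m Rhit a <= img i)%MS.
  by rewrite /img -mulmxA Lhit_Rhit mulmxA submxMr // cW.
have img_phi (phi : 'cV[k]_n) : Z *m phi = 0 -> (W *m Lhit phi <= C)%MS.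
  move=> /Kfull [y ->].
  have -> : Lhit (K *m y) = \sum_i y i 0 *: Lhit (col i K).
    apply/matrixP=> i l; rewrite summxE mxE.
    under [RHS]eq_bigr => m _ do rewrite !mxE mulr_sumr.
    rewrite exchange_big; apply: eq_bigr => j _ /=.
    by rewrite !mxE mulr_suml; apply: eq_bigr => m _; rewrite !mxE; ring.
  rewrite mulmx_sumr summx_sub // => i _; rewrite -scalemxAr scalemx_sub //.
  by rewrite (sumsmx_sup i) // genmxE.
have cC : rcoideal C.
  move=> a; rewrite sumsmxMr; apply/sumsmx_subP=> i _.
  rewrite (submx_trans (_ : _ <= img i *m Rhit a)%MS) ?submxMr ?genmxE //.
  by rewrite (submx_trans (imgR i a)) // (sumsmx_sup i) // genmxE.
have sC : subcoalg H C.
  apply: subcoalg_of_hit => // a; rewrite sumsmxMr; apply/sumsmx_subP=> i _.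
  rewrite (submx_trans (_ : _ <= img i *m Lhit (delta_mx a 0))%MS) ?submxMr ?genmxE //.
  rewrite /img -mulmxA Lhit_comp img_phi // mulmxA.
  have /submxP [D ->] := cZ a.
  by rewrite -mulmxA colE (mulmxA Z) ZK mul0mx mulmx0.
(* The counit after [Lhit phi] is [phi]: if [C] were zero, every functional vanishing on [Z] would
   vanish on [W]. *)
have nzC : C != 0.
  apply: contraNneq nWZ => C0; rewrite submxE.
  apply/eqP/matrixP=> i j; rewrite [RHS]mxE.
  have ZkZ : Z *m col j (cokermx Z) = 0 by rewrite colE mulmxA mulmx_coker mul0mx.
  have := img_phi _ ZkZ; rewrite C0 submx0 => /eqP W0.
  have := congr1 (fun A => (A *m counit_col) i 0) W0.
  by rewrite -mulmxA Lhit_mul_counit mul0mx [RHS]mxE colE mulmxA -colE mxE.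
have [g [gC glg]] := grouplike_in_subcoalg ptH sC nzC.
pose U m := (\sum_(i < n | (i < m)%N) <<img i>>)%MS.
have exU : exists m, (g <= U m)%MS.
  exists n; apply: submx_trans gC _; apply/sumsmx_subP=> i _.
  by rewrite (sumsmx_sup i).
case: (ex_minnP exU) => -[|m] gU minU.
  move: gU; rewrite /U big_pred0 // submx0 => /eqP g0.
  by case: glg; rewrite g0 eqxx.
have nU : ~~ (g <= U m)%MS by apply/negP=> /minU; rewrite ltnn.
have ltmn : (m < n)%N.
  rewrite ltnNge; apply: contra nU => lenm; apply: submx_trans gU _.
  apply/sumsmx_subP=> i _; rewrite (sumsmx_sup i) //.
  exact: leq_trans (ltn_ord i) lenm.
pose im := Ordinal ltmn; pose L := Lhit (col im K).
have gUm : (g <= U m + img im)%MS.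
  apply: submx_trans gU _; apply/sumsmx_subP=> i; rewrite ltnS leq_eqVlt.
  case/orP=> [/eqP eim|lim].
    have -> : i = im by apply: val_inj.
    by rewrite genmxE addsmxSr.
  by rewrite (submx_trans _ (addsmxSl _ _)) // (sumsmx_sup i).
have cU a : (U m *m Rhit a <= U m)%MS.
  rewrite sumsmxMr; apply/sumsmx_subP=> i lim.
  rewrite (submx_trans (_ : _ <= img i *m Rhit a)%MS) ?submxMr ?genmxE //.
  by rewrite (submx_trans (imgR i a)) // (sumsmx_sup i) // genmxE.
have [[u0 w0]] := sub_addsmxP gUm; set u := _ *m U m; rewrite mulmxA => /= gE.
set w := w0 *m W in gE.
have uU : (u <= U m)%MS by apply: submxMl.
have wW : (w <= W)%MS by apply: submxMl.
(* [X] is the part of [W] that [L] maps into [U m]. It is a right coideal containing [Z] but not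
   [w], so minimality of [W] forces [X <= Z]. *)
pose X := (W :&: kermx (L *m cokermx (U m)))%MS.
have inX m' (x : 'M[k]_(m', n)) : (x <= X)%MS = (x <= W)%MS && (x *m L <= U m)%MS.
  by rewrite sub_capmx sub_kermx mulmxA [(_ *m _ <= _)%MS]submxE.
have cX : rcoideal X.
  move=> a; have := submx_refl X; rewrite !inX => /andP [XW XU].
  rewrite (submx_trans (submxMr _ XW)) ?cW //= -mulmxA -Lhit_Rhit mulmxA.
  by rewrite (submx_trans (submxMr _ XU)).
have ZX : (Z <= X)%MS.
  rewrite inX ZW /=; suff -> : Z *m L = 0 by rewrite sub0mx.
  apply/matrixP=> i l; rewrite [RHS]mxE.
  have : (Z *m Rhit l *m col im K) i 0 = 0.
    have /submxP [D ->] := cZ l.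
    by rewrite -mulmxA colE (mulmxA Z) ZK mul0mx mulmx0 mxE.
  move=> <-; rewrite -mulmxA !mxE; apply: eq_bigr => j _; congr (_ * _).
  by rewrite !mxE; apply: eq_bigr => p _; rewrite !mxE mulrC.
have nwX : ~~ (w <= X)%MS.
  rewrite inX wW /=; apply: contra nU => wU.
  by rewrite gE addmx_sub.
have XZ : (X <= Z)%MS.
  have XW : (X <= W)%MS by apply: capmxSl.
  by case: (minW X cX ZX XW) => // WX; rewrite (submx_trans wW WX) in nwX.
exists w, g; split=> //.
  by apply: contra nwX => /submx_trans; apply.
move=> a; apply: submx_trans XZ; rewrite inX; apply/andP; split.
  rewrite addmx_sub //; first by apply: submx_trans (cW a); apply: submxMr.
  by rewrite eqmx_opp scalemx_sub.
have wL : w *m L = g - u by rewrite gE addrAC subrr add0r.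
rewrite mulmxBl -mulmxA -Lhit_Rhit mulmxA -scalemxAl wL mulmxBl Rhit_grouplike //.
rewrite scalerBr opprB [_ *: u - _]addrC addrACA subrr add0r.
rewrite addmx_sub ?scalemx_sub // eqmx_opp (submx_trans _ (cU a)) //.
exact: submxMr.
Qed.

(** Modulo [Z] the coaction sends [v] to [v (x) g]. Iterated from 0 this gives a chain of right
    coideals with one-dimensional quotients, each governed by a grouplike. An intermediate coideal
    serves to shrink [W] until [rcoideal_step_min] applies. *)
Lemma rcoideal_step (Z W : 'M[k]_n) : pointed H -> rcoideal Z -> rcoideal W ->
  (Z <= W)%MS -> ~~ (W <= Z)%MS ->
  exists v g : 'rV[k]_n, [/\ (v <= W)%MS, ~~ (v <= Z)%MS, grouplike H g
    & forall a, (v *m Rhit a - g 0 a *: v <= Z)%MS].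
Proof.
move=> ptH cZ; move: {2}(\rank W).+1 (ltnSn (\rank W)) => r.
elim: r W => // r IH W ltr cW ZW nWZ.
case: (classic (exists X, [/\ rcoideal X, (Z <= X)%MS, (X <= W)%MS,
                            ~~ (X <= Z)%MS & ~~ (W <= X)%MS])) => [|no].
  case=> X [cX ZX XW nXZ nWX].
  have /IH [//|//|//|v [g [vX nvZ gl Hv]]] : (\rank X < r)%N.
    rewrite -ltnS (leq_trans _ ltr) // ltnS.
    by rewrite (ltn_leqif (mxrank_leqif_sup XW)).
  by exists v, g; split=> //; apply: submx_trans XW.
apply: rcoideal_step_min => // X cX ZX XW.
case: (boolP (X <= Z)%MS) => [|nXZ]; first by left.
case: (boolP (W <= X)%MS) => [|nWX]; first by right.
by case: no; exists X.
Qed.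

End PointedCoalgebra.

(** * The grading by [Gamma] induced by the projection [pi] *)

Section Grading.
Variables (k : fieldType) (n : nat) (H : HopfData k n).
Hypothesis hopfH : is_hopf H.
Variables (gT : finGroupType) (pib : 'I_n -> gT -> k).
Hypothesis Hab : Hab_group_algebra H pib.

Section Projections.
Variables (R : comNzRingType) (io : {rmorphism k -> R}).
Local Notation "f ** g" := (conv (cH H io) f g) (at level 40, left associativity).
Local Notation "f *** g" := (conv (cHH H io) f g) (at level 40, left associativity).
Local Notation mu := (mus H io).

Definition piR (g : gT) (i : 'I_n) : R := io (pib i g).

Lemma ev_piR g x : ev io (piR g) x = io (hpi pib x g).
Proof.
by rewrite /ev /hpi rmorph_sum; apply: eq_bigr => i _; rewrite rmorphM.
Qed.

(** [pi] is a coalgebra map and the elements of [Gamma] are grouplike, so its coefficients are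
    orthogonal idempotents for convolution. As they sum to the counit, they split any [f] into
    homogeneous parts, on the right or on the left. *)
Lemma piR_conv g h : piR g ** piR h = fun i => (g == h)%:R * piR g i.
Proof.
have [_ [_ [Hc _]]] := Hab; apply: functional_extensionality => i.
transitivity (io (\sum_j \sum_l comulc H i j l * pib j g * pib l h)).
  rewrite rmorph_sum; apply: eq_bigr => j _; rewrite rmorph_sum.
  by apply: eq_bigr => l _; rewrite !rmorphM /cH /piR; ring.
rewrite Hc; case: eqP => _; by rewrite ?mul1r ?mul0r ?rmorph0.
Qed.

Lemma sum_piR i : \sum_g piR g i = eH H io i.
Proof. by have [_ [_ [_ [Hc _]]]] := Hab; rewrite /eH Hc rmorph_sum. Qed.

Lemma conv_sum_piR f i : f i = \sum_g (f ** piR g) i.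
Proof.
rewrite -conv_sumr; transitivity ((f ** eH H io) i); first by rewrite cHf1.
by congr conv; apply: functional_extensionality => j; rewrite sum_piR.
Qed.

Lemma conv_sum_piRl f i : f i = \sum_g (piR g ** f) i.
Proof.
rewrite -conv_suml; transitivity ((eH H io ** f) i); first by rewrite cH1f.
by congr conv; apply: functional_extensionality => j; rewrite sum_piR.
Qed.

Lemma mus_piR z : mu (piR z) = fun x => \sum_h tens (piR h) (piR (h^-1 * z)%g) x.
Proof.
have [Hm _] := Hab; apply: functional_extensionality => -[i j].
rewrite -ev_mulc ev_piR Hm rmorph_sum.
by apply: eq_bigr => h _; rewrite rmorphM.
Qed.

Lemma tens_scale (a b : R) (f g : 'I_n -> R) :
  tens (fun i => a * f i) (fun i => b * g i) = fun x => a * b * tens f g x.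
Proof. by apply: functional_extensionality => x; rewrite /tens; ring. Qed.

(** [pi] is multiplicative: arguments of degrees [g] and [h] have a product of degree [g h]. Both
    this form and its mirror image are needed, since [cocyc] has the product in its right factor and
    [cocycV] in its left one. *)
Lemma tens_mus_piR g h z : tens (piR g) (piR h) *** mu (piR z) =
  fun x => (z == g * h)%g%:R * tens (piR g) (piR h) x.
Proof.
apply: functional_extensionality => x; rewrite mus_piR conv_sumr.
under eq_bigr => a _ do rewrite tens_conv !piR_conv tens_scale.
rewrite (bigD1 g) //= big1 => [|a ne]; last by rewrite eq_sym (negPf ne) !mul0r.
rewrite eqxx mul1r addr0; congr (_%:R * _).
by congr nat_of_bool; apply/eqP/eqP => [->|->]; rewrite ?mulKVg ?mulKg.
Qed.

Lemma mus_tens_piR g h z : mu (piR z) *** tens (piR g) (piR h) =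
  fun x => (z == g * h)%g%:R * tens (piR g) (piR h) x.
Proof.
apply: functional_extensionality => x; rewrite mus_piR conv_suml.
under eq_bigr => a _ do rewrite tens_conv !piR_conv tens_scale.
rewrite (bigD1 g) //= big1 => [|a ne]; last by rewrite (negPf ne) !mul0r.
rewrite eqxx mul1r addr0; have [->|ne] := eqVneq z (g * h)%g.
  by rewrite mulKg eqxx.
have /negPf -> : (g^-1 * z != h)%g by apply: contraNneq ne => <-; rewrite mulKVg.
by rewrite !mul0r.
Qed.

End Projections.

Definition pic (g : gT) : 'cV[k]_n := \col_i pib i g.

Lemma pic_hpi x g : (x *m pic g) 0 0 = hpi pib x g.
Proof. by rewrite mxE; apply: eq_bigr => i _; rewrite mxE. Qed.

Lemma Lhit_pic g h : Lhit H (pic g) *m pic h = (g == h)%:R *: pic g.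
Proof.
have [_ [_ [Hc _]]] := Hab; apply/colP=> i; rewrite !mxE.
transitivity (\sum_j \sum_l comulc H i j l * pib j g * pib l h); last first.
  by rewrite Hc; case: eqP; rewrite ?mul1r ?mul0r.
rewrite exchange_big; apply: eq_bigr => l _ /=; rewrite !mxE mulr_suml.
by apply: eq_bigr => j _; rewrite !mxE; ring.
Qed.

Lemma grouplike_counit g : grouplike H g -> hcounit H g = 1.
Proof.
case=> nzg gg; have := mul_Lhit H g (counit_col H).
rewrite Lhit_counit // mulmx1 gg mulmxA => /esym gE.
have E : hcounit H g *: g = g.
  rewrite -[RHS]gE [_ *m g^T]mx11_scalar mul_scalar_mx; congr (_ *: _).
  by rewrite mxE; apply: eq_bigr => i _; rewrite !mxE mulrC.
apply/eqP; rewrite -subr_eq0; apply: contraNT nzg => nz.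
have /eqP : (hcounit H g - 1) *: g = 0 by rewrite scalerBl E scale1r subrr.
by rewrite scaler_eq0 (negPf nz).
Qed.

Lemma hcounit_hpi x : hcounit H x = \sum_g hpi pib x g.
Proof.
have [_ [_ [_ [Hc _]]]] := Hab.
rewrite /hcounit /hpi exchange_big; apply: eq_bigr => i _ /=.
by rewrite Hc mulr_sumr.
Qed.

(** The coefficients of [pi(x)] are orthogonal idempotents of the field [k] with sum 1: exactly one
    of them is 1. *)
Lemma grouplike_degree x : grouplike H x ->
  exists g, forall h, hpi pib x h = (h == g)%:R.
Proof.
move=> glx; have s1 := grouplike_counit glx; rewrite hcounit_hpi in s1.
have idm a b : hpi pib x a * hpi pib x b = (a == b)%:R * hpi pib x a.
  pose io : {rmorphism k -> k} := @idfun k.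
  have := ev_conv_grouplike io (piR io a) (piR io b) glx.
  rewrite piR_conv !ev_piR /= => <-.
  rewrite /ev mulr_sumr; apply: eq_bigr => i _; rewrite /piR /=; ring.
have [g nzg] : exists g, hpi pib x g != 0.
  apply: NNPP => no; have := oner_neq0 k; rewrite -s1 big1 ?eqxx // => g _.
  by apply/eqP/negPn/negP => nz; apply: no; exists g.
exists g => h; have [->|ne] := eqVneq h g.
  by apply: (mulfI nzg); rewrite idm eqxx mul1r mulr1.
by apply: (mulfI nzg); rewrite idm eq_sym (negPf ne) mul0r mulr0.
Qed.

(* The image of [x |-> pi_g(x_1) x_2] is a nonzero right coideal, hence contains a
   grouplike. *)
Lemma grouplike_of_degree (g : gT) : pointed H ->
  exists x, grouplike H x /\ forall h, hpi pib x h = (h == g)%:R.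
Proof.
move=> ptH; pose W := Lhit H (pic g).
have cW : rcoideal H W by move=> a; rewrite Lhit_Rhit // submxMl.
have c0 : rcoideal H 0 by move=> a; rewrite mul0mx.
have nW0 : ~~ (W <= (0 : 'M[k]_n))%MS.
  rewrite submx0; apply/eqP => W0.
  have := Lhit_mul_counit hopfH (pic g); rewrite -/W W0 mul0mx => p0.
  have [_ [_ [_ [_ [sur _]]]]] := Hab.
  have [x /(_ g)] := sur (fun h => (h == g)%:R).
  rewrite -pic_hpi -p0 mulmx0 mxE eqxx => /eqP; by rewrite eq_sym oner_eq0.
have [v [x [vW nv0 glx Hv]]] := rcoideal_step hopfH ptH c0 cW (sub0mx _ _) nW0.
exists x; split=> //; have [d Hd] := grouplike_degree glx.
(* Relative to the zero coideal the step relation is an equality, [Delta(v) = v (x) x]. The counit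
   on the left factor then shows that [v] is a multiple of [x]. *)
have vx : hcomul H v = v^T *m x.
  apply: trmx_inj; apply/row_matrixP=> a; rewrite hcomul_Rhit.
  have := Hv a; rewrite submx0 subr_eq0 => /eqP ->.
  by rewrite trmx_mul trmxK row_mul; apply/rowP=> j; rewrite !mxE big_ord_recl big_ord0 addr0 !mxE.
have vE : v = ((counit_col H)^T *m v^T) 0 0 *: x.
  by rewrite -mul_scalar_mx -mx11_scalar -mulmxA -vx -mul_Lhit Lhit_counit ?mulmx1.
set c := (_ 0 0) in vE; have nzc : c != 0.
  by apply: contraNneq nv0 => c0'; rewrite vE c0' scale0r submx0.
(* Elements of [W] have their only coefficient under [pi] at [g], whereas the multiple [v] of [x]
   has it at [d]. *)
have [y vy] := submxP vW.
suff -> : g = d by [].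
apply/eqP; have := pic_hpi v d; rewrite {1}vy -mulmxA Lhit_pic.
case: eqP => // _; rewrite scale0r mulmx0 mxE vE /hpi.
under eq_bigr => i _ do rewrite mxE -mulrA.
rewrite -mulr_sumr -/(hpi pib x d) Hd eqxx mulr1 => c0'.
by rewrite -c0' eqxx in nzc.
Qed.

(** The projector [x |-> x_1 pi_g(x_2)] of [H] onto its elements of degree [g]. *)
Definition Qproj (g : gT) : 'M[k]_n :=
  \matrix_(i, j) \sum_l comulc H i j l * pib l g.

Lemma ev_Qproj (R : comNzRingType) (io : {rmorphism k -> R}) f y g :
  ev io f (y *m Qproj g) = ev io (conv (cH H io) f (piR io g)) y.
Proof.
rewrite /ev; under eq_bigr => i _ do rewrite mxE rmorph_sum mulr_suml.
rewrite exchange_big; apply: eq_bigr => i _ /=; rewrite mulr_sumr.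
apply: eq_bigr => j _; rewrite !mxE rmorphM rmorph_sum -mulrA mulr_suml.
congr (_ * _); apply: eq_bigr => l _.
by rewrite rmorphM /cH /piR; ring.
Qed.

Lemma ev_conv_Qproj (R : comNzRingType) (io : {rmorphism k -> R}) f y g h :
  ev io (conv (cH H io) f (piR io h)) (y *m Qproj g) =
  (h == g)%:R * ev io f (y *m Qproj g).
Proof.
rewrite !ev_Qproj -cHA // piR_conv conv_scaler /ev mulr_sumr.
case: eqP => [->|_]; first by apply: eq_bigr => i _; rewrite !mul1r.
by apply: eq_bigr => i _; rewrite !mul0r mulr0.
Qed.

Lemma ev_conv_piR_grouplike (R : comNzRingType) (io : {rmorphism k -> R}) f x d h :
  grouplike H x -> (forall h, hpi pib x h = (h == d)%:R) ->
  ev io (conv (cH H io) f (piR io h)) x = (h == d)%:R * ev io f x.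
Proof. by move=> gx dx; rewrite ev_conv_grouplike // ev_piR dx rmorph_nat mulrC. Qed.

Lemma sum_Qproj : \sum_g Qproj g = 1%:M.
Proof.
have [_ [_ [_ [He _]]]] := hopfH; have [_ [_ [_ [Hc _]]]] := Hab.
apply/matrixP=> i j; rewrite summxE mxE -(proj2 (He i j)).
under eq_bigr => g _ do rewrite mxE.
rewrite exchange_big; apply: eq_bigr => l _ /=.
by rewrite Hc mulr_sumr.
Qed.

(** * Independence of grouplikes and their completion by homogeneous elements *)

Section GrouplikeBasis.
Variables (l : nat) (gs : 'I_l -> 'rV[k]_n).
Hypotheses (gs_inj : injective gs) (gsP : forall j, grouplike H (gs j)).

Definition gsmx : 'M[k]_(l, n) := \matrix_j gs j.

(* If [x] is a combination [a *m G] of independent grouplikes, comparing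
   coproducts gives [a_i a_j = 0] for [i != j], so [x] is one of them. *)
Lemma grouplike_span_eq m (G : 'M[k]_(m, n)) (x : 'rV[k]_n) :
  (forall j, grouplike H (row j G)) -> row_free G -> grouplike H x ->
  (x <= G)%MS -> exists j, x = row j G.
Proof.
move=> glG fG glx /submxP [a xE].
have hG : hcomul H x = G^T *m diag_mx a *m G.
  have -> : hcomul H x = \sum_j a 0 j *: hcomul H (row j G).
    rewrite /hcomul xE; under [LHS]eq_bigr => i _ do rewrite mxE scaler_suml.
    rewrite exchange_big; apply: eq_bigr => j _ /=; rewrite scaler_sumr.
    by apply: eq_bigr => i _; rewrite !mxE scalerA.
  apply/matrixP=> p q; rewrite summxE mxE; apply: eq_bigr => j _.
  rewrite (glG j).2 !mxE big_ord_recl big_ord0 addr0 !mxE.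
  rewrite (bigD1 j) //= big1 => [|j' ne]; first by rewrite !mxE eqxx mulr1n addr0; ring.
  by rewrite !mxE (negPf ne) mulr0n mulr0.
have [GV GGV] := row_freeP fG.
have aE : a^T *m a = diag_mx a.
  have E : G^T *m (a^T *m a) *m G = G^T *m diag_mx a *m G.
    by rewrite -hG (glx.2) xE trmx_mul !mulmxA.
  have : GV^T *m (G^T *m (a^T *m a) *m G) *m GV = GV^T *m (G^T *m diag_mx a *m G) *m GV.
    by rewrite E.
  by rewrite !mulmxA -!trmx_mul GGV trmx1 !mul1mx -!mulmxA GGV !mulmx1.
have [j nzj] : exists j, a 0 j != 0.
  apply/existsP; apply: contraT; rewrite negb_exists => /forallP a0.
  case: glx => /eqP []; rewrite xE; suff -> : a = 0 by rewrite mul0mx.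
  by apply/rowP=> j; rewrite mxE; apply/eqP; have := a0 j; rewrite negbK.
exists j; rewrite xE.
have aj i : a 0 j * a 0 i = a 0 j *+ (j == i).
  have := congr1 (fun A : 'M[k]_m => A j i) aE.
  by rewrite !mxE big_ord_recl big_ord0 addr0 !mxE.
suff -> : a = delta_mx 0 j by rewrite -rowE.
apply/rowP=> i; apply: (mulfI nzj); rewrite aj mxE eqxx /= eq_sym mulr_natr.
by [].
Qed.

(** A grouplike in the span of an independent family of grouplikes belongs to it by
    [grouplike_span_eq]; injectivity excludes this. Arbitrary injective subfamilies are treated so
    that the induction can drop one member. *)
Lemma rank_gsmx : \rank gsmx = l.
Proof.
suff W m (f : 'I_m -> 'I_l) : injective f -> row_free (\matrix_j gs (f j)).
  by have /eqP := W l id (@inj_id _).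
elim: m f => [|m IH] f injf; first by rewrite /row_free flatmx0 mxrank0.
have fI : injective (f \o lift ord0) by move=> i j /injf /lift_inj.
have free' := IH _ fI; set G := \matrix_j _ in free'.
set G' := \matrix_j gs (f j).
have glG j : grouplike H (row j G) by rewrite rowK.
have GE : (G' :=: gs (f ord0) + G)%MS.
  apply/eqmxP/andP; split.
    apply/row_subP=> j; rewrite rowK; case: (unliftP ord0 j) => [j' ->|->].
      rewrite (submx_trans _ (addsmxSr _ _)) //.
      by have := row_sub j' G; rewrite rowK.
    exact: addsmxSl.
  rewrite addsmx_sub; apply/andP; split.
    by have := row_sub ord0 G'; rewrite rowK.
  apply/row_subP=> j; rewrite rowK /=.
  by have := row_sub (lift ord0 j) G'; rewrite rowK.
rewrite /row_free GE.
have dx : (gs (f ord0) :&: G = 0)%MS.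
  apply/eqP; apply: contraT => /rowV0Pn [y].
  rewrite sub_capmx => /andP [/sub_rVP [c ->] yG nz].
  have nzc : c != 0 by apply: contraNneq nz => ->; rewrite scale0r.
  have := scalemx_sub c^-1 yG; rewrite scalerA mulVf // scale1r => fG.
  have [j] := grouplike_span_eq glG free' (gsP (f ord0)) fG.
  by rewrite rowK => /gs_inj /injf.
rewrite mxrank_disjoint_sum // (eqP free') rank_rV (gsP _).1.
by rewrite add1n.
Qed.

Lemma leq_ln : (l <= n)%N.
Proof. by rewrite -{1}rank_gsmx rank_leq_col. Qed.

Lemma homogeneous_completion : exists (xs : 'I_n -> 'rV[k]_n) (ds : 'I_n -> gT),
  (forall i, exists y, xs i = y *m Qproj (ds i)) /\
  (forall x : 'rV[k]_n, exists (a : 'I_l -> k) (c : 'I_n -> k),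
     x = \sum_j a j *: gs j + \sum_(i < n | (l <= i)%N) c i *: xs i).
Proof.
have [s [sz homs rks]] : exists s : seq ('rV[k]_n * gT), [/\ size s = (n - l)%N,
    forall x, x \in s -> exists y, x.1 = y *m Qproj x.2
    & (\rank (gsmx + \sum_(x <- s) <<x.1>>)%MS = n)].
  have leln := leq_ln.
  suff W m : (m <= n - l)%N -> exists s : seq ('rV[k]_n * gT), [/\ size s = m,
    forall x, x \in s -> exists y, x.1 = y *m Qproj x.2
    & \rank (gsmx + \sum_(x <- s) <<x.1>>)%MS = (l + m)%N].
    have [//|s [s1 s2 s3]] := W (n - l)%N; exists s; split=> //.
    by rewrite s3 subnKC.
  elim: m => [_|m IH lem].
    exists [::]; split=> //; rewrite big_nil addsmx0 addn0; exact: rank_gsmx.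
  have [|s [s1 s2 s3]] := IH; first exact: ltnW.
  set A := (_ + _)%MS in s3.
  have nfull : ~~ (1%:M <= A)%MS.
    by rewrite sub1mx /row_full s3 neq_ltn -ltn_subRL lem.
  (* The projectors [Qproj g] sum to the identity, so their images cannot all lie in a proper
     subspace. *)
  have [i [g nsub]] : exists i g, ~~ (ebas k i *m Qproj g <= A)%MS.
    apply: NNPP => no; case/negP: nfull; rewrite -sum_Qproj.
    apply: summx_sub => g _; apply/row_subP=> i; rewrite rowE.
    by apply/negPn/negP => nsub; apply: no; exists i, g.
  exists ((ebas k i *m Qproj g, g) :: s); split=> [|x|].
  - by rewrite /= s1.
  - rewrite inE => /orP [/eqP ->|/s2 //]; by exists (ebas k i).
  rewrite big_cons /= addsmxA (addsmxC gsmx) -addsmxA -/A addnS -s3.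
  rewrite mxrank_disjoint_sum.
    rewrite genmxE rank_rV; case: eqP => [e0|_]; first by rewrite e0 sub0mx in nsub.
    by rewrite add1n.
  apply/eqP; apply: contraT => /rowV0Pn [y].
  rewrite sub_capmx genmxE => /andP [/sub_rVP [c ->] yA nz].
  have nzc : c != 0 by apply: contraNneq nz => ->; rewrite scale0r.
  have := scalemx_sub c^-1 yA; rewrite scalerA mulVf // scale1r => yA'.
  by rewrite yA' in nsub.
pose z0 : 'rV[k]_n * gT := (0, 1%g).
(* Position [i] holds entry [i - l] of [s]. The subtraction is truncated: an index [i < l] gets the
   first entry, or [z0] if [s] is empty, and is homogeneous in either case. *)
exists (fun i => (nth z0 s (i - l)).1), (fun i => (nth z0 s (i - l)).2); split.
  move=> i; have [lt|ge] := ltnP (i - l) (size s).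
    exact: homs (mem_nth _ lt).
  by exists 0; rewrite nth_default // mul0mx.
move=> x; have : (x <= gsmx + \sum_(x <- s) <<x.1>>)%MS.
  by apply: submx_full; rewrite /row_full rks.
case/sub_addsmxP => -[a c] /= ->; rewrite (big_nth z0) big_mkord.
have : (c *m (\sum_(i < size s) <<(nth z0 s i).1>>)%MS <= \sum_(i < size s) <<(nth z0 s i).1>>)%MS.
  exact: submxMl.
case/sub_sums_genmxP => e eE.
exists (fun j => a 0 j), (fun i =>
  if (insub (i - l)%N : option 'I_(size s)) is Some j then e j 0 0 else 0).
congr (_ + _).
  rewrite mulmx_sum_row; apply: eq_bigr => j _; by rewrite rowK.
rewrite eE; under [LHS]eq_bigr => i _ do rewrite [e i]mx11_scalar mul_scalar_mx.
have leln := leq_ln.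
have E (F : nat -> 'rV[k]_n) : \sum_(i < n | (l <= i)%N) F (i - l)%N = \sum_(i < size s) F i.
  rewrite -(big_mkord (fun i => l <= i)%N (fun i => F (i - l)%N)) sz.
  rewrite (big_cat_nat (leq0n l) leln) //= big_nat_cond big1 ?add0r => [|i]; last first.
    by case/andP=> /andP [_ lt] ge; rewrite leqNgt lt in ge.
  rewrite -{1}[l]add0n big_addn big_mkord.
  by apply: eq_big => [i|i _]; rewrite ?leq_addl ?addnK.
rewrite (E (fun m => (if (insub m : option 'I_(size s)) is Some j then e j 0 0 else 0)
                       *: (nth z0 s m).1)).
apply: eq_bigr => i _; case: insubP => [j _ /val_inj -> //|].
by rewrite ltn_ord.
Qed.

End GrouplikeBasis.
End Grading.

(** * Coordinates in a direct product of cyclic groups *)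

Section PrimaryDecomposition.
Variable gT : finGroupType.
Local Open Scope group_scope.

(** Exponents are functions of the generator and not of its position, which makes sense because [b]
    is duplicate free: a repeated generator would lie in two factors meeting trivially, against its
    order exceeding 1. *)
Lemma dprod_cycles (b : seq gT) (G : {group gT}) :
  \big[dprod/1]_(x <- b) <[x]> = G -> (forall x, x \in b -> 1 < #[x])%N ->
  [/\ uniq b,
      forall y, y \in G -> exists m : gT -> nat,
        (forall x, x \in b -> m x < #[x])%N /\ y = \prod_(x <- b) x ^+ m x,
      {subset b <= G},
      forall m : gT -> nat, \prod_(x <- b) x ^+ m x = 1 ->
        forall x, x \in b -> (#[x] %| m x)%N
    & {in G &, forall y z, commute y z}].
Proof.
elim: b G => [|a b IH] G; rewrite ?big_nil ?big_cons => defG ord_b.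
  have {}defG : G = 1%G by apply: val_inj; rewrite /= -defG.
  rewrite defG; split=> //.
  - by move=> y /set1P ->; exists (fun=> 0%N); split=> //; rewrite big_nil.
  - by move=> y z /set1P -> /set1P ->.
have [[K L defK defL] KL cKL tiKL] := dprodP defG.
rewrite defL defK in KL cKL tiKL.
have ordb x : x \in b -> (1 < #[x])%N by move=> xb; apply: ord_b; rewrite inE xb orbT.
have [uq gen memL ind com] := IH _ defL ordb.
have aK i : a ^+ i \in K by rewrite -defK mem_cycle.
have LI y : y \in L -> y \in K -> y = 1.
  by move=> yL yK; apply/set1P; rewrite -[[set 1]]tiKL inE yK.
have mem m : \prod_(x <- b) x ^+ m x \in L.
  by rewrite big_seq; apply: group_prod => x /memL; apply: groupX.
have nab : a \notin b.
  apply/negP => ab; have := ord_b a (mem_head _ _).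
  rewrite (LI a (memL _ ab)) ?order1 //.
  by have := aK 1%N; rewrite expg1.
split.
- by rewrite /= nab.
- move=> y; rewrite -KL => /mulsgP [c d cK dL ->].
  have [m [ltm ->]] := gen _ dL.
  rewrite -defK in cK; have /cyclePmin [i lti ->] := cK.
  exists (fun x => if x == a then i else m x); split=> [x|].
    by rewrite inE; case: eqP => [-> //|_] /=; apply: ltm.
  rewrite big_cons eqxx; congr (_ * _); apply: eq_big_seq => x xb.
  by case: eqP => // xa; rewrite -xa xb in nab.
- move=> x; rewrite inE -KL => /orP [/eqP ->|/memL xL].
    by rewrite -[a]mulg1 mem_mulg // -[a]expg1.
  by rewrite -[x]mul1g mem_mulg.
- move=> m; rewrite big_cons => /eqP; rewrite -eq_invg_mul => /eqP E.
  have E1 : a ^+ m a = 1.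
    by apply: LI => //; rewrite -groupV E mem.
  move=> x; rewrite inE => /orP [/eqP ->|]; first by rewrite order_dvdn E1.
  by apply: ind; rewrite -E E1 invg1.
- move=> y z; rewrite -KL => /mulsgP [c d cK dL ->] /mulsgP [c' d' cK' dL' ->].
  have cc : commute c c'.
    rewrite -defK in cK cK'; exact: (centsP (cycle_abelian a)).
  have cd u v : u \in L -> v \in K -> commute u v by move=> uL vK; apply: (centsP cKL).
  apply: commuteM; apply: commute_sym; apply: commuteM; try exact: commute_sym.
  + exact/commute_sym/cd.
  + exact: cd.
  exact: com.
Qed.

End PrimaryDecomposition.

(** * The group of grouplikes *)

Section GrouplikeGroup.
Variables (k : fieldType) (n : nat) (H : HopfData k n).
Hypothesis hopfH : is_hopf H.

Section Bilinear.
Variables (R : comNzRingType) (io : {rmorphism k -> R}).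

Definition ev2 (F : 'I_n * 'I_n -> R) (x y : 'rV[k]_n) : R :=
  \sum_i \sum_j io (x 0 i * y 0 j) * F (i, j).

Lemma ev2_mus f x y : ev2 (mus H io f) x y = ev io f (hmul H x y).
Proof. by rewrite ev_hmul. Qed.

Lemma ev2_tens f g x y : ev2 (tens f g) x y = ev io f x * ev io g y.
Proof.
rewrite /ev mulr_suml; apply: eq_bigr => i _; rewrite mulr_sumr.
by apply: eq_bigr => j _; rewrite /tens /= rmorphM; ring.
Qed.

(** [x (x) y] is grouplike in [H (x) H], and evaluation at a grouplike is multiplicative for
    convolution. *)
Lemma ev2_conv F G x y : grouplike H x -> grouplike H y ->
  ev2 (conv (cHH H io) F G) x y = ev2 F x y * ev2 G x y.
Proof.
case=> _ gx [_ gy].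
have E (z : 'rV[k]_n) a b : hcomul H z = z^T *m z ->
    \sum_i io (z 0 i) * cH H io i a b = io (z 0 a) * io (z 0 b).
  move=> zE; rewrite -rmorphM.
  have -> : z 0 a * z 0 b = hcomul H z a b.
    by rewrite zE mxE big_ord_recl big_ord0 addr0 mxE.
  rewrite summxE rmorph_sum; apply: eq_bigr => i _; by rewrite mxE rmorphM.
transitivity (\sum_a \sum_p \sum_b \sum_q (\sum_i io (x 0 i) * cH H io i a b)
    * (\sum_j io (y 0 j) * cH H io j p q) * (F (a, p) * G (b, q))).
  transitivity (\sum_i \sum_j \sum_a \sum_p \sum_b \sum_q
      io (x 0 i) * cH H io i a b * (io (y 0 j) * cH H io j p q)
      * (F (a, p) * G (b, q))).
    apply: eq_bigr => i _; apply: eq_bigr => j _; rewrite /conv.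
    rewrite mulr_sumr [RHS]pair_bigA /=; apply: eq_bigr => -[a p] _ /=.
    rewrite mulr_sumr [RHS]pair_bigA /=; apply: eq_bigr => -[b q] _ /=.
    by rewrite /cHH /cH !rmorphM /=; ring.
  under eq_bigr => i _ do rewrite exchange_big.
  rewrite exchange_big; apply: eq_bigr => a _ /=.
  under eq_bigr => i _ do rewrite exchange_big.
  rewrite exchange_big; apply: eq_bigr => p _ /=.
  under eq_bigr => i _ do rewrite exchange_big.
  rewrite exchange_big; apply: eq_bigr => b _ /=.
  under eq_bigr => i _ do rewrite exchange_big.
  rewrite exchange_big; apply: eq_bigr => q _ /=.
  rewrite [in RHS]mulr_suml mulr_suml; apply: eq_bigr => i _.
  by rewrite mulr_sumr mulr_suml.
rewrite /ev2 mulr_suml; apply: eq_bigr => a _.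
rewrite mulr_suml; apply: eq_bigr => p _.
rewrite mulr_sumr; apply: eq_bigr => b _.
rewrite mulr_sumr; apply: eq_bigr => q _.
by rewrite !E // !rmorphM; ring.
Qed.

End Bilinear.

Lemma grouplike_unit : grouplike H (unitc H).
Proof.
have [_ [_ [_ [_ [_ [[Hu He] _]]]]]] := hopfH; split=> //.
apply/eqP => u0; have := oner_neq0 k; rewrite -He u0 /hcounit big1 ?eqxx //.
by move=> i _; rewrite mxE mul0r.
Qed.

Lemma grouplike_mul x y : grouplike H x -> grouplike H y -> grouplike H (hmul H x y).
Proof.
move=> gx gy; pose io : {rmorphism k -> k} := @idfun k; split.
  have E : hcounit H (hmul H x y) = 1.
    transitivity (ev2 io (mus H io (eH H io)) x y); first by rewrite ev2_mus.
    rewrite mus_eH // ev2_tens -[ev io _ x]/(hcounit H x) -[ev io _ y]/(hcounit H y).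
    by rewrite !grouplike_counit // mulr1.
  apply/eqP => xy0; have := oner_neq0 k.
  rewrite -E xy0 /hcounit big1 ?eqxx // => i _.
  by rewrite mxE mul0r.
(* Entries of a coproduct are read off as values of convolutions of coordinate forms, which reduces
   the claim to [mus_conv]. *)
have delta (A : 'M[k]_n) a b : A a b =
   \sum_j \sum_q io (A j q) * ((j == a)%:R * (q == b)%:R).
  rewrite (bigD1 a) //= [X in _ + X]big1 ?addr0 => [|j /negPf ->]; last first.
    by rewrite big1 // => q _; rewrite mul0r mulr0.
  rewrite (bigD1 b) //= big1 ?addr0 ?eqxx ?mulr1 // => q /negPf ->.
  by rewrite !mulr0.
apply/matrixP=> a b; rewrite [LHS]delta [RHS]delta.
rewrite (ev_outer io (fun j => (j == a)%:R) (fun q => (q == b)%:R)).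
rewrite -(ev_conv H io (fun j => (j == a)%:R) (fun q => (q == b)%:R)).
by rewrite -!ev2_mus mus_conv // ev2_conv.
Qed.

Lemma hmulDl x x' y : hmul H (x + x') y = hmul H x y + hmul H x' y.
Proof.
rewrite /hmul -big_split; apply: eq_bigr => i _ /=; rewrite -big_split.
by apply: eq_bigr => j _ /=; rewrite mxE mulrDl scalerDl.
Qed.

Lemma hmulZl a x y : hmul H (a *: x) y = a *: hmul H x y.
Proof.
rewrite /hmul scaler_sumr; apply: eq_bigr => i _ /=; rewrite scaler_sumr.
by apply: eq_bigr => j _ /=; rewrite mxE -mulrA scalerA.
Qed.

Lemma hmul_suml (J : Type) (r : seq J) (P : pred J) (F : J -> 'rV[k]_n) y :
  hmul H (\sum_(j <- r | P j) F j) y = \sum_(j <- r | P j) hmul H (F j) y.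
Proof.
apply: (big_morph (fun x => hmul H x y)); first by move=> x x'; rewrite hmulDl.
by have := hmulZl 0 0 y; rewrite !scale0r.
Qed.

Lemma hmulZr a x y : hmul H x (a *: y) = a *: hmul H x y.
Proof.
rewrite /hmul scaler_sumr; apply: eq_bigr => i _ /=; rewrite scaler_sumr.
by apply: eq_bigr => j _ /=; rewrite mxE scalerA; congr (_ *: _); ring.
Qed.

Lemma hmulDr x y y' : hmul H x (y + y') = hmul H x y + hmul H x y'.
Proof.
rewrite /hmul -big_split; apply: eq_bigr => i _ /=; rewrite -big_split.
by apply: eq_bigr => j _ /=; rewrite mxE mulrDr scalerDl.
Qed.

Lemma hmul_sumr (J : Type) (r : seq J) (P : pred J) (F : J -> 'rV[k]_n) y :
  hmul H y (\sum_(j <- r | P j) F j) = \sum_(j <- r | P j) hmul H y (F j).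
Proof.
apply: (big_morph (fun x => hmul H y x)); first by move=> x x'; rewrite hmulDr.
by have := hmulZr 0 y 0; rewrite !scale0r.
Qed.

Lemma grouplike_linv g : grouplike H g -> exists h, hmul H h g = unitc H.
Proof.
move=> gg; have e1 := grouplike_counit hopfH gg.
have [_ [_ [_ [_ [_ [_ Hs]]]]]] := hopfH.
exists (\sum_j g 0 j *: antic H j).
transitivity (\sum_j \sum_l hcomul H g j l *: hmul H (antic H j) (ebas k l)).
  rewrite hmul_suml; apply: eq_bigr => j _; rewrite hmulZl.
  rewrite {2}[g]row_sum_delta hmul_sumr scaler_sumr.
  apply: eq_bigr => l _; rewrite hmulZr scalerA gg.2.
  by rewrite mxE big_ord_recl big_ord0 addr0 mxE.
transitivity (\sum_i g 0 i *: \sum_j \sum_l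
    comulc H i j l *: hmul H (antic H j) (ebas k l)).
  under [RHS]eq_bigr => i _ do rewrite scaler_sumr.
  rewrite [RHS]exchange_big; apply: eq_bigr => j _ /=.
  under [RHS]eq_bigr => i _ do rewrite scaler_sumr.
  rewrite [RHS]exchange_big; apply: eq_bigr => l _ /=.
  rewrite summxE scaler_suml; apply: eq_bigr => i _.
  by rewrite mxE scalerA.
under eq_bigr => i _ do rewrite (proj1 (Hs i)) scalerA.
by rewrite -scaler_suml -/(hcounit H g) e1 scale1r.
Qed.

(** The antipode provides a left inverse, so multiplication by [g] is an injective self-map of the
    finite set of grouplikes. It is therefore onto and reaches the unit, and the inverse found this
    way is grouplike by construction. *)
Lemma grouplike_rinv (l : nat) (gs : 'I_l -> 'rV[k]_n) g :
  injective gs -> (forall x, grouplike H x <-> exists j, x = gs j) ->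
  grouplike H g -> exists h, grouplike H h /\ hmul H g h = unitc H.
Proof.
move=> gs_inj gsP gg.
have gl j : grouplike H (gs j) by apply/gsP; exists j.
have ex j : exists i, hmul H g (gs j) == gs i.
  have /gsP [i E] := grouplike_mul gg (gl j); by exists i; apply/eqP.
pose f j := xchoose (ex j).
have fE j : hmul H g (gs j) = gs (f j) by apply/eqP/(xchooseP (ex j)).
have [Hass [Hun _]] := hopfH.
have finj : injective f.
  move=> i j /(congr1 gs); rewrite -!fE => E; apply: gs_inj.
  have [h hg] := grouplike_linv gg.
  by rewrite -(proj1 (Hun (gs i))) -(proj1 (Hun (gs j))) -hg !Hass E.
have /gsP [i Ei] := grouplike_unit.
have [f' _ fK] := injF_bij finj.
by exists (gs (f' i)); split=> //; rewrite fE fK.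
Qed.

End GrouplikeGroup.

(** * Subalgebras and submodules as predicates *)

Section Subalgebras.
Variables (k : fieldType) (L : comNzRingType) (io : {rmorphism k -> L}).

Definition is_subalg (A : L -> Prop) : Prop :=
  [/\ forall c, A (io c), forall z w, A z -> A w -> A (z + w)
    & forall z w, A z -> A w -> A (z * w)].

(** With [A] the image of [k], these are the linear subspaces. *)
Definition is_submod (A V : L -> Prop) : Prop :=
  [/\ V 0, forall z w, V z -> V w -> V (z + w)
    & forall z w, A z -> V w -> V (z * w)].

Lemma submod_sum A V (J : Type) (r : seq J) (P : pred J) (F : J -> L) :
  is_submod A V -> (forall j, P j -> V (F j)) -> V (\sum_(j <- r | P j) F j).
Proof. by case=> V0 VD _ VF; elim/big_rec: _ => // j x Pj Vx; apply: (VD); auto. Qed.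

Lemma conv_submod A V (I : finType) (cc : I -> I -> I -> L) f g i :
  is_submod A V -> (forall i j l, A (cc i j l)) -> (forall j l, V (f j * g l)) ->
  V (conv cc f g i).
Proof.
move=> sV Acc Vfg; apply: (submod_sum (A := A)) => // j _.
by apply: (submod_sum (A := A)) => // l _; case: sV => _ _; apply.
Qed.

Variable A : L -> Prop.
Hypothesis sA : is_subalg A.

Lemma sac c : A (io c). Proof. by case: sA. Qed.
Lemma saD z w : A z -> A w -> A (z + w). Proof. by case: sA => _ + _; apply. Qed.
Lemma saM z w : A z -> A w -> A (z * w). Proof. by case: sA => _ _; apply. Qed.
Lemma sa0 : A 0. Proof. by rewrite -(rmorph0 io); apply: sac. Qed.
Lemma sa1 : A 1. Proof. by rewrite -(rmorph1 io); apply: sac. Qed.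

Lemma saN z : A z -> A (- z).
Proof.
by move=> Az; rewrite -mulN1r -(rmorph1 io) -rmorphN; apply: saM => //; apply: sac.
Qed.

Lemma saB z w : A z -> A w -> A (z - w).
Proof. by move=> Az Aw; apply: saD => //; apply: saN. Qed.

Lemma sa_submod : is_submod A A.
Proof. by split; [apply: sa0|apply: saD|apply: saM]. Qed.

Lemma sa_sum (J : Type) (r : seq J) (P : pred J) (F : J -> L) :
  (forall j, P j -> A (F j)) -> A (\sum_(j <- r | P j) F j).
Proof. exact: submod_sum sa_submod. Qed.

Lemma sa_prod (J : Type) (r : seq J) (P : pred J) (F : J -> L) :
  (forall j, P j -> A (F j)) -> A (\prod_(j <- r | P j) F j).
Proof.
move=> AF; elim/big_rec: _ => [|j x Pj Ax]; first exact: sa1.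
by apply: saM; auto.
Qed.

Lemma saX z m : A z -> A (z ^+ m).
Proof.
by move=> Az; elim: m => [|m IH]; rewrite ?expr0 ?exprS; [apply: sa1|apply: saM].
Qed.

Lemma sa_ev n (f : 'I_n -> L) x : (forall i, A (f i)) -> A (ev io f x).
Proof. by move=> Af; apply: sa_sum => i _; apply: saM => //; apply: sac. Qed.

Lemma submod_ev V n (f : 'I_n -> L) x : is_submod A V ->
  (forall i, V (f i)) -> V (ev io f x).
Proof.
move=> sV Vf; rewrite /ev; apply: (submod_sum (A := A)) => // i _; case: sV => _ _; apply=> //.
exact: sac.
Qed.

Lemma submod_mus V n (H : HopfData k n) (f : 'I_n -> L) x : is_submod A V ->
  (forall i, V (f i)) -> V (mus H io f x).
Proof. by move=> sV Vf; apply: (submod_ev (f := f)). Qed.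

End Subalgebras.

(** * Degrees of [tinv] and of the cocycles in any graded family containing [t] *)

Section GradedFamilies.
Variables (k : fieldType) (n : nat) (H : HopfData k n).
Hypotheses (hopfH : is_hopf H) (ptH : pointed H).
Variables (gT : finGroupType) (pib : 'I_n -> gT -> k).
Hypothesis Hab : Hab_group_algebra H pib.
Hypothesis gTC : forall x y : gT, (x * y)%g = (y * x)%g.
Variables (L : fieldType) (io : {rmorphism k -> L}) (t tinv : 'I_n -> L).

Local Notation "f ** g" := (conv (cH H io) f g) (at level 40, left associativity).
Local Notation "f *** g" := (conv (cHH H io) f g) (at level 40, left associativity).
Local Notation mu := (mus H io).
Local Notation pi := (piR pib io).

Hypotheses (t_tinv : t ** tinv = eH H io) (tinv_t : tinv ** t = eH H io).

(** [cocyc] and [cocycV] are [sigma] and [sigma^-1], as bilinear maps written by convolution. *)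
Definition cocyc := tens t t *** mu tinv.
Definition cocycV := mu t *** tens tinv tinv.

(** The components may overlap. In particular a subalgebra, repeated in every degree, is a graded
    family. *)
Definition is_graded (V : gT -> L -> Prop) : Prop :=
  [/\ forall c, V 1%g (io c), forall g, V g 0,
      forall g z w, V g z -> V g w -> V g (z + w)
    & forall g h z w, V g z -> V h w -> V (g * h)%g (z * w)].

Lemma piR_idem g : pi g ** pi g = pi g.
Proof.
rewrite piR_conv //; apply: functional_extensionality => i.
by rewrite eqxx mul1r.
Qed.

Section Graded.
Variable V : gT -> L -> Prop.
Hypothesis gV : is_graded V.
Hypothesis Vt : forall g i, V g ((t ** pi g) i).
Hypothesis Vgl : forall x g, grouplike H x ->
  (forall h, hpi pib x h = (h == g)%:R) -> V g^-1%g (ev io t x)^-1 /\ ev io t x != 0.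

Lemma graded_scale g c z : V g z -> V g (io c * z).
Proof. by case: gV => Vc _ _ VM Vz; rewrite -[g]mul1g; apply: (VM). Qed.

Lemma graded_submod g : is_submod (fun z => exists c, z = io c) (V g).
Proof.
case: gV => Vc V0 VD VM; split=> //; first exact: VD.
by move=> z w [c ->]; apply: graded_scale.
Qed.

(* Climbing a maximal chain of right coideals: [rcoideal_step] makes the
   identity [(pi_e * tinv) * (t * pi_g) = delta_eg pi_e] triangular. *)
Lemma graded_tinv e i : V e^-1%g ((pi e ** tinv) i).
Proof.
case: (gV) => Vc V0 VD VM.
(* [m] counts steps up the chain; each raises the rank by at least one, so that [m = n] reaches all
   of [H]. *)
suff W m : exists Z, [/\ rcoideal H Z, (minn m n <= \rank Z)%N
    & forall x e, (x <= Z)%MS -> V e^-1%g (ev io (pi e ** tinv) x)].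
  have [Z [_ rZ VZ]] := W n; rewrite -(ev_ebas io (pi e ** tinv)); apply: VZ.
  by apply: submx_full; rewrite /row_full eqn_leq rank_leq_col -{1}(minnn n).
elim: m => [|m [Z [cZ rZ VZ]]].
  exists 0; split=> [a||x e']; rewrite ?mul0mx ?min0n //.
  by rewrite submx0 => /eqP ->; rewrite ev0.
have [fZ|nfZ] := boolP (row_full Z).
  by exists Z; split=> //; rewrite (eqP fZ) geq_minr.
have c1 : rcoideal H 1%:M by move=> a; rewrite submx1.
have n1 : ~~ (1%:M <= Z)%MS by rewrite sub1mx.
have [v [x [_ nvZ glx Hv]]] := rcoideal_step hopfH ptH cZ c1 (submx1 _) n1.
exists (Z + v)%MS; split=> [a||y e'].
- rewrite addsmxMr addsmx_sub (submx_trans (cZ a) (addsmxSl _ _)) /=.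
  rewrite -[v *m _](subrK (x 0 a *: v)) addmx_sub //.
    exact: submx_trans (Hv a) (addsmxSl _ _).
  by rewrite scalemx_sub // addsmxSr.
- have lt : (\rank Z < \rank (Z + v))%N.
    rewrite (ltn_leqif (mxrank_leqif_sup (addsmxSl _ _))) addsmx_sub submx_refl.
    by rewrite /= nvZ.
  apply: leq_trans lt; apply: leq_trans (_ : (minn m n).+1 <= _)%N; last by rewrite ltnS.
  by rewrite -minnSS leq_min geq_minl (leq_trans (geq_minr _ _)).
case/sub_addsmxP => -[y1 y2] /= ->; rewrite evD; apply: (VD).
  by apply: VZ; apply: submxMl.
rewrite [y2]mx11_scalar mul_scalar_mx evZ; apply: graded_scale.
have [g Hg] := grouplike_degree hopfH Hab glx.
have [Vi nz] := Vgl glx Hg.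
(* [h] has degree [g] everywhere and still takes the value [t_x] at [x]. Modulo [Z] the coproduct of
   [v] is [v (x) x], so [f ** h] at [v] is [f(v) t_x] plus values of [f] on [Z] times values of [h],
   of degree [e'^-1 g]. As [f ** h] is scalar, and zero unless [e' = g], solving for [f(v)] gives
   degree [e'^-1]. *)
pose f := pi e' ** tinv; pose h := t ** pi g.
have hx : ev io h x = ev io t x.
  by rewrite ev_conv_grouplike // ev_piR Hg eqxx rmorph1 mulr1.
have E : ev io (f ** h) v = \sum_l ev io f (v *m Rhit H l - x 0 l *: v) * h l
           + ev io f v * ev io t x.
  rewrite ev_conv ev_rows -hx [ev io h x]/ev mulr_sumr -big_split; apply: eq_bigr => l _ /=.
  rewrite hcomul_Rhit -{1}[v *m _](subrK (x 0 l *: v)) evD evZ; ring.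
have fh : f ** h = pi e' ** pi g.
  by rewrite /f /h -cHA // (cHA hopfH io tinv) tinv_t cH1f.
have -> : ev io (pi e' ** tinv) v = (ev io (f ** h) v
    + - \sum_l ev io f (v *m Rhit H l - x 0 l *: v) * h l) * (ev io t x)^-1.
  by rewrite E addrAC subrr add0r mulfK.
rewrite -[e'^-1%g](mulgK g); apply: (VM) => //; apply: (VD).
  rewrite fh piR_conv //; have [->|ne] := eqVneq e' g.
    rewrite mulVg (_ : (fun i => _) = pi g) ?ev_piR //.
    by apply: functional_extensionality => j; rewrite mul1r.
  rewrite /ev big1 // => j _; by rewrite mul0r mulr0.
rewrite -mulN1r -(rmorph1 io) -rmorphN; apply: graded_scale.
apply: submod_sum (graded_submod _) _ => l _; apply: (VM) => //.
exact: VZ.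
Qed.

(** After both factors [t] are split by degree, the idempotent [tens (pi g) (pi h)] can be doubled
    by [mu (pi (g h))], which cuts [tinv] down to its part of degree [(g h)^-1]. *)
Lemma graded_cocyc x : V 1%g (cocyc x).
Proof.
case: (gV) => Vc V0 VD VM.
have -> : cocyc x = \sum_g \sum_h (tens (t ** pi g) (t ** pi h) *** mu tinv) x.
  rewrite /cocyc; transitivity (((fun y => \sum_g \sum_h tens (t ** pi g) (t ** pi h) y)
                               *** mu tinv) x).
    congr (conv _ _ _ _); apply: functional_extensionality => y.
    rewrite /tens {1}(conv_sum_piR hopfH Hab io t y.1).
    rewrite {1}(conv_sum_piR hopfH Hab io t y.2) mulr_suml.
    by apply: eq_bigr => g _; rewrite mulr_sumr.
  by rewrite conv_suml; apply: eq_bigr => g _; rewrite conv_suml.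
apply: submod_sum (graded_submod _) _ => g _.
apply: submod_sum (graded_submod _) _ => h _.
have -> : tens (t ** pi g) (t ** pi h) *** mu tinv =
          tens (t ** pi g) (t ** pi h) *** mu (pi (g * h)%g ** tinv).
  rewrite mus_conv // cHHA //; congr (_ *** _); rewrite -tens_conv -cHHA //.
  congr (_ *** _); rewrite tens_mus_piR //; apply: functional_extensionality => y.
  by rewrite eqxx mul1r.
apply: conv_submod (graded_submod _) _ _ => [y z w|y z]; first by eexists.
rewrite -(mulgV (g * h)%g); apply: (VM); first exact: VM.
apply: submod_sum (graded_submod _) _ => m _; apply: graded_scale.
exact: graded_tinv.
Qed.

(** The mirror argument: here the factors [tinv] are split. Their degrees [g^-1] and [h^-1] cancel
    the degree [g h] of [t] because [Gamma] is commutative. *)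
Lemma graded_cocycV x : V 1%g (cocycV x).
Proof.
case: (gV) => Vc V0 VD VM.
have -> : cocycV x = \sum_g \sum_h (mu t *** tens (pi g ** tinv) (pi h ** tinv)) x.
  rewrite /cocycV; transitivity ((mu t *** (fun y => \sum_g \sum_h
       tens (pi g ** tinv) (pi h ** tinv) y)) x).
    congr (conv _ _ _ _); apply: functional_extensionality => y.
    rewrite /tens {1}(conv_sum_piRl hopfH Hab io tinv y.1).
    rewrite {1}(conv_sum_piRl hopfH Hab io tinv y.2) mulr_suml.
    by apply: eq_bigr => g _; rewrite mulr_sumr.
  by rewrite conv_sumr; apply: eq_bigr => g _; rewrite conv_sumr.
apply: submod_sum (graded_submod _) _ => g _.
apply: submod_sum (graded_submod _) _ => h _.
have -> : mu t *** tens (pi g ** tinv) (pi h ** tinv) =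
          mu (t ** pi (g * h)%g) *** tens (pi g ** tinv) (pi h ** tinv).
  rewrite mus_conv // -cHHA //; congr (_ *** _); rewrite -tens_conv cHHA //.
  congr (_ *** _); rewrite mus_tens_piR //; apply: functional_extensionality => y.
  by rewrite eqxx mul1r.
apply: conv_submod (graded_submod _) _ _ => [y z w|y z]; first by eexists.
have -> : (1 = (g * h) * (g^-1 * h^-1))%g by rewrite [(g * h)%g]gTC mulgA mulgK mulgV.
apply: (VM); last by apply: (VM); apply: graded_tinv.
apply: submod_sum (graded_submod _) _ => m _; exact: graded_scale.
Qed.

End Graded.
End GradedFamilies.

(** * The span of the [t_x] over an algebra [B] containing the cocycles *)

Section BaseAlgebra.
Variables (k : fieldType) (n : nat) (H : HopfData k n).
Hypotheses (hopfH : is_hopf H) (ptH : pointed H).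
Variables (gT : finGroupType) (pib : 'I_n -> gT -> k).
Hypothesis Hab : Hab_group_algebra H pib.
Variables (L : fieldType) (io : {rmorphism k -> L}) (t tinv : 'I_n -> L).

Local Notation "f ** g" := (conv (cH H io) f g) (at level 40, left associativity).
Local Notation "f *** g" := (conv (cHH H io) f g) (at level 40, left associativity).
Local Notation mu := (mus H io).
Local Notation pi := (piR pib io).
Local Notation sig := (cocyc H io t tinv).
Local Notation sigi := (cocycV H io t tinv).

Hypotheses (t_tinv : t ** tinv = eH H io) (tinv_t : tinv ** t = eH H io).
Hypothesis glinv : forall x, grouplike H x ->
  exists y, grouplike H y /\ hmul H x y = unitc H.

Lemma ev_eH x : ev io (eH H io) x = io (hcounit H x).
Proof. by rewrite /ev rmorph_sum; apply: eq_bigr => i _; rewrite rmorphM. Qed.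

Lemma ev_tinv x : grouplike H x -> ev io t x * ev io tinv x = 1.
Proof.
move=> gx; rewrite -(ev_conv_grouplike io t tinv gx) t_tinv ev_eH.
by rewrite grouplike_counit // rmorph1.
Qed.

Lemma ev_t_neq0 x : grouplike H x -> ev io t x != 0.
Proof.
by move/ev_tinv=> E; apply: contra_eq_neq E => ->; rewrite mul0r eq_sym oner_neq0.
Qed.

Lemma ev_tinvE x : grouplike H x -> ev io tinv x = (ev io t x)^-1.
Proof. by move=> gx; apply: (mulfI (ev_t_neq0 gx)); rewrite ev_tinv // divff // ev_t_neq0. Qed.

(** [mu t] and [mu tinv] are convolution inverse, so [t_x t_y = sigma(x_1, y_1) t_(x_2 y_2)]: a
    product of two [t_x] is again a [B]-combination of them. *)
Lemma tens_tt : tens t t = sig *** mu t.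
Proof. by rewrite /cocyc -cHHA // -mus_conv // tinv_t mus_eH // cHHf1. Qed.

Lemma mus_tE : mu t = sigi *** tens t t.
Proof. by rewrite /cocycV -cHHA // tens_conv // tinv_t cHHf1. Qed.

Variable B : L -> Prop.
Hypotheses (sB : is_subalg io B) (Bsig : forall x, B (sig x))
  (Bsigi : forall x, B (sigi x)).

Lemma B_ev2 (F : 'I_n * 'I_n -> L) (x y : 'rV[k]_n) : (forall z, B (F z)) -> B (ev2 io F x y).
Proof.
move=> BF; apply: (sa_sum sB) => i _; apply: (sa_sum sB) => j _.
by apply: (saM sB) => //; apply: (sac sB).
Qed.

Lemma B_tt x y : grouplike H x -> grouplike H y ->
  B (ev io t x * ev io t y / ev io t (hmul H x y)).
Proof.
move=> gx gy; have := B_ev2 x y Bsig.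
by rewrite /cocyc ev2_conv // ev2_tens ev2_mus ev_tinvE //; apply: grouplike_mul.
Qed.

Lemma B_ttV x y : grouplike H x -> grouplike H y ->
  B (ev io t (hmul H x y) / ev io t x / ev io t y).
Proof.
move=> gx gy; have := B_ev2 x y Bsigi.
by rewrite /cocycV ev2_conv // ev2_tens ev2_mus !ev_tinvE // mulrA.
Qed.

Lemma unitc2 : hmul H (unitc H) (unitc H) = unitc H.
Proof. by have [_ [Hu _]] := hopfH; case: (Hu (unitc H)). Qed.

Lemma B_t1 : B (ev io t (unitc H)).
Proof.
have g1 := grouplike_unit hopfH; have := B_tt g1 g1.
by rewrite unitc2 mulfK // ev_t_neq0.
Qed.

Lemma B_t1V : B (ev io t (unitc H))^-1.
Proof.
have g1 := grouplike_unit hopfH; have := B_ttV g1 g1.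
by rewrite unitc2 divff ?ev_t_neq0 // div1r.
Qed.

(** For [x y = 1] one has [t_x t_y = sigma(x, y) t_1] with [t_1 = sigma(1, 1)], and similarly for
    the inverses. These units of [B] provide all the denominators later. *)
Lemma B_pair x : grouplike H x -> exists y, [/\ grouplike H y,
  hmul H x y = unitc H, B (ev io t x * ev io t y) & B ((ev io t x)^-1 * (ev io t y)^-1)].
Proof.
move=> gx; have [y [gy xy]] := glinv gx; exists y; split=> //.
  have := saM sB (B_tt gx gy) B_t1; rewrite xy mulfVK // ev_t_neq0 //.
  exact: grouplike_unit.
have := saM sB B_t1V (B_ttV gx gy); rewrite xy !mulrA mulVf ?mul1r //.
by rewrite ev_t_neq0 //; apply: grouplike_unit.
Qed.

Definition Bspan (f : 'I_n -> L) (z : L) : Prop :=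
  exists b : 'I_n -> L, (forall i, B (b i)) /\ z = \sum_i b i * f i.

Lemma Bspan_submod f : is_submod B (Bspan f).
Proof.
split.
- exists (fun=> 0); split=> [i|]; first exact: (sa0 sB).
  by rewrite big1 // => i _; rewrite mul0r.
- move=> _ _ [b [Bb ->]] [c [Bc ->]]; exists (fun i => b i + c i); split=> [i|].
    exact: (saD sB).
  by rewrite -big_split; apply: eq_bigr => i _; rewrite mulrDl.
- move=> z _ Bz [b [Bb ->]]; exists (fun i => z * b i); split=> [i|].
    exact: (saM sB).
  by rewrite mulr_sumr; apply: eq_bigr => i _; rewrite mulrA.
Qed.

Lemma Bspan_gen f i : Bspan f (f i).
Proof.
exists (fun j => io (i == j)%:R); split=> [j|]; first exact: (sac sB).
rewrite (bigD1 i) //= big1 => [|j /negPf ne]; first by rewrite eqxx rmorph1 mul1r addr0.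
by rewrite eq_sym ne rmorph0 mul0r.
Qed.

Lemma Bspan_ev f x : Bspan f (ev io f x).
Proof.
by apply: (submod_ev sB x (Bspan_submod f)) => i; apply: Bspan_gen.
Qed.

Lemma Bspan_mul f g h z w : (forall i j, Bspan h (f i * g j)) ->
  Bspan f z -> Bspan g w -> Bspan h (z * w).
Proof.
move=> fgh [b [Bb ->]] [c [Bc ->]]; rewrite mulr_suml.
apply: (submod_sum (A := B)) => [|i _]; first exact: Bspan_submod.
rewrite mulr_sumr; apply: (submod_sum (A := B)) => [|j _]; first exact: Bspan_submod.
have -> : b i * f i * (c j * g j) = b i * c j * (f i * g j) by ring.
by case: (Bspan_submod h) => _ _; apply=> //; apply: (saM sB).
Qed.

Lemma B_cH i j l : B (cH H io i j l). Proof. exact: (sac sB). Qed.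
Lemma B_cHH i j l : B (cHH H io i j l). Proof. exact: (sac sB). Qed.
Lemma B_pi g i : B (pi g i). Proof. exact: (sac sB). Qed.

Lemma Bspan_tt i j : Bspan t (t i * t j).
Proof.
rewrite -/(tens t t (i, j)) tens_tt; have sM := Bspan_submod t.
apply: (conv_submod (A := B)) => // [*|x y]; first exact: B_cHH.
case: (sM) => _ _; apply=> //; exact: Bspan_ev.
Qed.

Lemma Bspan_t_subalg : is_subalg io (Bspan t).
Proof.
have [_ MD MM] := Bspan_submod t; split=> //; last first.
  by move=> z w; apply: Bspan_mul; apply: Bspan_tt.
move=> c; rewrite -[io c](mulfVK (ev_t_neq0 (grouplike_unit hopfH))).
apply: MM; last exact: Bspan_ev.
by apply: (saM sB); [apply: (sac sB)|apply: B_t1V].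
Qed.

Lemma Bspan_tpi g i : Bspan t ((t ** pi g) i).
Proof.
apply: (conv_submod (A := B)); [exact: Bspan_submod|exact: B_cH|move=> j l].
rewrite mulrC; case: (Bspan_submod t) => _ _; apply; first exact: B_pi.
exact: Bspan_gen.
Qed.

Lemma Bspan_tV x : grouplike H x -> Bspan t (ev io t x)^-1.
Proof.
move=> gx; have [y [gy _ _ Byx]] := B_pair gx.
rewrite -[_^-1](mulfVK (ev_t_neq0 gy)).
by case: (Bspan_submod t) => _ _; apply=> //; apply: Bspan_ev.
Qed.

Lemma subalg_graded A : is_subalg io A -> is_graded io (fun _ : gT => A).
Proof.
move=> sA; split=> *; [exact: (sac sA)|exact: (sa0 sA)|exact: (saD sA)|exact: (saM sA)].
Qed.

(** The chain argument applied to the constant family [Bspan t]; it makes [Bspan t] the algebra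
    generated by the [t_x] and [t^-1_x] over [B]. *)
Lemma Bspan_tinv i : Bspan t (tinv i).
Proof.
have sM := Bspan_t_subalg.
rewrite (conv_sum_piRl hopfH Hab io tinv i); apply: (sa_sum sM) => g _.
apply: (graded_tinv hopfH ptH Hab tinv_t (subalg_graded sM) Bspan_tpi) => x h gx _.
by split; [apply: Bspan_tV|apply: ev_t_neq0].
Qed.

(** The component of degree 1 is so far the span of [t ** pi 1], which contains [B]; the conductor
    argument serves to show equality. *)
Lemma B_graded : is_graded io (fun g => Bspan (t ** pi g)).
Proof.
have sM g := Bspan_submod (t ** pi g).
split=> [c|g|g|g h]; try by case: (sM g).
- have [_ [Hu _]] := Hab; have g1 := grouplike_unit hopfH.
  have e1 : ev io (t ** pi 1%g) (unitc H) = ev io t (unitc H).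
    by rewrite ev_conv_grouplike // ev_piR Hu eqxx rmorph1 mulr1.
  rewrite -[io c](mulfVK (ev_t_neq0 g1)).
  case: (sM 1%g) => _ _; apply; last by rewrite -e1; apply: Bspan_ev.
  by apply: (saM sB); [apply: (sac sB)|apply: B_t1V].
move=> z w; apply: Bspan_mul => i j.
rewrite -/(tens (t ** pi g) (t ** pi h) (i, j)) -tens_conv tens_tt -cHHA //.
have -> : mu t *** tens (pi g) (pi h) = mu (t ** pi (g * h)%g) *** tens (pi g) (pi h).
  rewrite mus_conv // -cHHA // mus_tens_piR //; congr (_ *** _).
  by apply: functional_extensionality => y; rewrite eqxx mul1r.
apply: (conv_submod (A := B)) => // [*|x y]; first exact: B_cHH.
case: (sM (g * h)%g) => _ _ sMM; apply: (sMM) => //.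
apply: (conv_submod (A := B)) => // [*|x' y']; first exact: B_cHH.
rewrite mulrC; apply: (sMM); first by apply: (saM sB); apply: B_pi.
exact: Bspan_ev.
Qed.

(** * The [B]-linear form and the conductor of the degree 1 part *)

Section Conductor.
Variables (I : {set 'I_n}) (c : L).
Hypothesis indI : forall (b0 : L) (b : 'I_n -> L), B b0 -> (forall i, B (b i)) ->
  b0 + \sum_(i in I) b i * t i = 0 -> b0 = 0.
Hypothesis Bc : B c.
(** The condition on [I] makes the constant coefficient [b0] unique; the [t i] with [i] in [I] may
    still be dependent among themselves. *)
Definition cofactor1 (f b0 : L) : Prop :=
  B b0 /\ exists b : 'I_n -> L, (forall i, B (b i)) /\
    c * f = b0 + \sum_(i in I) b i * t i.
Hypothesis cI : forall j, exists b0, cofactor1 (t j) b0.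

(* A [B]-linear map from the [B]-span of the [t_x] to [B] sending [1] to [c]:
   the constant coefficient of [c * f]. *)
Definition cform (f : L) : L := epsilon (inhabits 0) (cofactor1 f).

Lemma cofactor1_uniq f b0 b0' : cofactor1 f b0 -> cofactor1 f b0' -> b0 = b0'.
Proof.
move=> [Bb0 [b [Bb E]]] [Bb0' [b' [Bb' E']]]; apply/eqP; rewrite -subr_eq0.
apply/eqP/(indI (b := fun i => b i - b' i)).
- exact: (saB sB).
- by move=> i; apply: (saB sB).
have -> : \sum_(i in I) (b i - b' i) * t i =
          \sum_(i in I) b i * t i - \sum_(i in I) b' i * t i.
  by rewrite -sumrB; apply: eq_bigr => i _; rewrite mulrBl.
rewrite addrACA -E addrC -opprD -E'.
by rewrite addrC subrr.
Qed.

Lemma cofactor1D f f' b0 b0' : cofactor1 f b0 -> cofactor1 f' b0' ->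
  cofactor1 (f + f') (b0 + b0').
Proof.
move=> [Bb0 [b [Bb E]]] [Bb0' [b' [Bb' E']]]; split; first exact: (saD sB).
exists (fun i => b i + b' i); split=> [i|]; first exact: (saD sB).
rewrite mulrDr E E' addrACA -big_split; congr (_ + _).
by apply: eq_bigr => i _; rewrite mulrDl.
Qed.

Lemma cofactor1Z a f b0 : B a -> cofactor1 f b0 -> cofactor1 (a * f) (a * b0).
Proof.
move=> Ba [Bb0 [b [Bb E]]]; split; first exact: (saM sB).
exists (fun i => a * b i); split=> [i|]; first exact: (saM sB).
rewrite mulrCA E mulrDr mulr_sumr; congr (_ + _).
by apply: eq_bigr => i _; rewrite mulrA.
Qed.

Lemma cofactor1_0 : cofactor1 0 0.
Proof.
split; first exact: (sa0 sB); exists (fun=> 0); split=> [i|]; first exact: (sa0 sB).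
by rewrite mulr0 big1 ?addr0 // => i _; rewrite mul0r.
Qed.

Lemma cformP f : Bspan t f -> cofactor1 f (cform f).
Proof.
move=> [b [Bb ->]]; apply: epsilon_spec.
elim/big_rec: _ => [|i x _ [b0 Hx]]; first by exists 0; apply: cofactor1_0.
have [b1 H1] := cI i; exists (b i * b1 + b0); apply: cofactor1D => //.
exact: cofactor1Z.
Qed.

Lemma cform_B f : Bspan t f -> B (cform f). Proof. by move/cformP=> []. Qed.

Lemma cformE f b0 : Bspan t f -> cofactor1 f b0 -> cform f = b0.
Proof. by move=> /cformP; apply: cofactor1_uniq. Qed.

Lemma cformZ a f : B a -> Bspan t f -> cform (a * f) = a * cform f.
Proof.
move=> Ba Mf; apply: cformE; last by apply: cofactor1Z => //; apply: cformP.
by case: (Bspan_submod t) => _ _; apply.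
Qed.

Lemma cform_sum (J : Type) (r : seq J) (F : J -> L) : (forall j, Bspan t (F j)) ->
  cform (\sum_(j <- r) F j) = \sum_(j <- r) cform (F j).
Proof.
have sM := Bspan_submod t; move=> MF; elim: r => [|j r IH]; rewrite ?big_nil ?big_cons.
  by apply: cformE; [case: sM|apply: cofactor1_0].
rewrite -IH; apply: cformE; last by apply: cofactor1D; apply: cformP => //;
  apply: (submod_sum (A := B)).
by case: (sM) => _ sMD _; apply: sMD => //; apply: (submod_sum (A := B)).
Qed.

Lemma cform1 : cform 1 = c.
Proof.
apply: cformE; first exact: (sa1 Bspan_t_subalg).
split=> //; exists (fun=> 0); split=> [i|]; first exact: (sa0 sB).
by rewrite mulr1 big1 ?addr0 // => i _; rewrite mul0r.
Qed.

Lemma cform_conv2 f s x : (forall y, Bspan t (f y)) -> (forall y, B (s y)) ->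
  ((cform \o f) *** s) x = cform ((f *** s) x).
Proof.
move=> Mf Bs; have sM := Bspan_submod t; have [_ _ sMM] := sM.
have Mfs i j l : Bspan t (cHH H io i j l * (f j * s l)).
  by apply: (sMM); [apply: B_cHH|rewrite mulrC; apply: (sMM)].
rewrite /conv cform_sum => [|j]; last by apply: (submod_sum (A := B)).
apply: eq_bigr => j _; rewrite cform_sum //; apply: eq_bigr => l _ /=.
rewrite [in RHS](mulrC (f j)) [in RHS]mulrA cformZ //; first by ring.
by apply: (saM sB) => //; apply: B_cHH.
Qed.

Definition Jform (u : L) : 'I_n -> L := (fun i => cform (u * tinv i)) ** t.

Lemma M_mul z w : Bspan t z -> Bspan t w -> Bspan t (z * w).
Proof. exact: (saM Bspan_t_subalg). Qed.

(* As [cform] is [B]-linear, the cocycle moves across it: [Jform u] stands for the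
   multiplicative map [x |-> t^-1_(x_1) (x) t_(x_2)] into a tensor product over [B]. *)
Lemma mus_Jform u x : Bspan t u ->
  mu (Jform u) x = ((fun y => cform (u * tens tinv tinv y)) *** tens t t) x.
Proof.
move=> Mu; have Mut i : Bspan t (u * tinv i) by apply: M_mul => //; apply: Bspan_tinv.
rewrite /Jform mus_conv // mus_tE cHHA //; congr (conv _ _ _ _).
apply: functional_extensionality => y.
have E1 : mu (fun i => cform (u * tinv i)) = cform \o (fun z => u * mu tinv z).
  apply: functional_extensionality => z; rewrite /mus /= mulr_sumr cform_sum.
    by apply: eq_bigr => m _; rewrite mulrCA [in RHS]cformZ //; apply: (sac sB).
  by move=> m; rewrite mulrCA; case: (Bspan_submod t) => _ _; apply=> //; apply: (sac sB).
rewrite E1 cform_conv2 //; last first.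
  move=> z; apply: M_mul => //; apply: (sa_ev Bspan_t_subalg) => i.
  exact: Bspan_tinv.
by rewrite conv_scalel /cocycV cHHA // -mus_conv // tinv_t mus_eH // cHH1f.
Qed.

(** The formula of [mus_Jform] involves only products in the commutative field [L], so exchanging
    the two arguments changes nothing. *)
Lemma mus_Jform_sym u i j : Bspan t u -> mu (Jform u) (i, j) = mu (Jform u) (j, i).
Proof.
move=> Mu; rewrite !mus_Jform // /conv /cHH /tens /=.
pose sw (y : 'I_n * 'I_n) := (y.2, y.1).
have swI : injective sw by move=> [a b] [d e] [-> ->].
rewrite (reindex_inj swI); apply: eq_bigr => -[p a] _.
rewrite (reindex_inj swI); apply: eq_bigr => -[q r] _ /=.
by congr (io _ * (cform (u * _) * _)); ring.
Qed.

(** The second argument is absorbed into the parameter: [Jform u (x y)] is the sum of the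
    [Jform (u t^-1_(y_1)) (x) t_(y_2)]. *)
Lemma mus_JformE u i j : Bspan t u ->
  mu (Jform u) (i, j) = \sum_p \sum_q cH H io j p q * (Jform (u * tinv p) i * t q).
Proof.
move=> Mu; rewrite mus_Jform // /conv /cHH /tens /=.
rewrite -(pair_bigA _ (fun a p => \sum_(q : 'I_n * 'I_n)
  io (comulc H i a q.1 * comulc H j p q.2)
  * (cform (u * (tinv a * tinv p)) * (t q.1 * t q.2)))) /=.
rewrite exchange_big; apply: eq_bigr => p _ /=.
transitivity (\sum_a \sum_r \sum_q io (comulc H i a q * comulc H j p r)
                * (cform (u * (tinv a * tinv p)) * (t q * t r))).
  apply: eq_bigr => a _; rewrite exchange_big.
  by rewrite -(pair_bigA _ (fun q r => io (comulc H i a q * comulc H j p r)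
       * (cform (u * (tinv a * tinv p)) * (t q * t r)))).
rewrite exchange_big; apply: eq_bigr => r _ /=.
rewrite /Jform /conv mulr_suml mulr_sumr; apply: eq_bigr => a _.
rewrite mulr_suml mulr_sumr; apply: eq_bigr => q _.
have -> : u * (tinv a * tinv p) = u * tinv p * tinv a by ring.
by rewrite rmorphM /cH; ring.
Qed.

(** All parameters [u] at once: since a factor on the right changes [u], only the common kernel is
    an ideal at sight. *)
Definition Jker (y : 'rV[k]_n) := forall u, Bspan t u -> ev io (Jform u) y = 0.

Lemma Jker_mull y x : Jker y -> Jker (hmul H y x).
Proof.
move=> Jy u Mu; rewrite ev_hmul exchange_big big1 // => j _.
transitivity (io (x 0 j) * \sum_p \sum_q cH H io j p q
    * (ev io (Jform (u * tinv p)) y * t q)).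
  rewrite mulr_sumr.
  under [RHS]eq_bigr => p _ do rewrite mulr_sumr.
  under eq_bigr => i _ do rewrite mus_JformE // mulr_sumr.
  rewrite exchange_big; apply: eq_bigr => p _ /=.
  under eq_bigr => i _ do rewrite mulr_sumr.
  rewrite exchange_big; apply: eq_bigr => q _ /=.
  rewrite /ev mulr_suml !mulr_sumr; apply: eq_bigr => i _.
  by rewrite rmorphM; ring.
rewrite big1 ?mulr0 // => p _; rewrite big1 // => q _.
by rewrite Jy ?mul0r ?mulr0 //; apply: M_mul => //; apply: Bspan_tinv.
Qed.

Lemma Jker_mulr y x : Jker y -> Jker (hmul H x y).
Proof.
move=> Jy u Mu; rewrite -(Jker_mull x Jy Mu) !ev_hmul exchange_big.
apply: eq_bigr => i _; apply: eq_bigr => j _.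
by rewrite mus_Jform_sym // (mulrC (x 0 j)).
Qed.

(** By symmetry the commutators lie in the two-sided ideal [Jker]. Hence each [Jform u] factors
    through [pi]. *)
Lemma Jker_comm_ideal y : in_comm_ideal H y -> Jker y.
Proof.
case=> coef -> u Mu; rewrite ev_sum big1 // => a _; rewrite ev_sum big1 // => b _.
rewrite ev_sum big1 // => e _; rewrite ev_sum big1 // => d _.
rewrite evZ Jker_mull ?mulr0 //; apply: Jker_mulr => v Mv.
rewrite /hcomm -scaleN1r evD evZ !ev_mulc mus_Jform_sym //.
by rewrite rmorphN rmorph1 mulN1r subrr.
Qed.

Lemma sweedler3 (F : 'I_n -> 'I_n -> 'I_n -> L) i :
  \sum_j \sum_l cH H io i j l * (\sum_a \sum_b cH H io l a b * F j a b) =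
  \sum_m \sum_b cH H io i m b * (\sum_j \sum_a cH H io m j a * F j a b).
Proof.
transitivity (\sum_j \sum_a \sum_b (\sum_l cH H io i j l * cH H io l a b) * F j a b).
  apply: eq_bigr => j _.
  under eq_bigr => l _ do rewrite mulr_sumr.
  rewrite exchange_big; apply: eq_bigr => a _ /=.
  under eq_bigr => l _ do rewrite mulr_sumr.
  rewrite exchange_big; apply: eq_bigr => b _ /=.
  by rewrite mulr_suml; apply: eq_bigr => l _; rewrite mulrA.
under eq_bigr => j _ do under eq_bigr => a _ do under eq_bigr => b _ do
  rewrite -cH_coassoc // mulr_suml.
apply: esym.
transitivity (\sum_m \sum_b \sum_j \sum_a cH H io i m b * (cH H io m j a * F j a b)).
  apply: eq_bigr => m _; apply: eq_bigr => b _; rewrite mulr_sumr.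
  by apply: eq_bigr => j _; rewrite mulr_sumr.
under [LHS]eq_bigr => m _ do rewrite exchange_big.
rewrite [LHS]exchange_big; apply: eq_bigr => j _ /=.
under [LHS]eq_bigr => m _ do rewrite exchange_big.
rewrite [LHS]exchange_big; apply: eq_bigr => a _ /=.
rewrite [LHS]exchange_big; apply: eq_bigr => b _ /=.
by apply: eq_bigr => m _; rewrite mulrA.
Qed.

(** Formally [c t_x = p(t_(x_1) t^-1_(x_2)) t_(x_3)], the value of [Jform (t_(x_1))] at [x_2]. As
    this depends on [x_2] only through [pi], convolving with [pi 1] leaves values at the unit of
    [H], which lie in [B]. *)
Lemma conductor_mem i : B (c * (t ** pi 1%g) i).
Proof.
have [_ [Hu [_ [_ [sur ker]]]]] := Hab.
have sM := Bspan_t_subalg.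
have [y yP] : exists y : gT -> 'rV[k]_n, forall g h, hpi pib (y g) h = (h == g)%:R.
  apply: (fin_all_exists (P := fun g v => forall h, hpi pib v h = (h == g)%:R)) => g.
  exact: (sur (fun h => (h == g)%:R)).
have JE u x : Bspan t u -> ev io (Jform u) x
    = \sum_g io (hpi pib x g) * ev io (Jform u) (y g).
  move=> Mu; pose z := \sum_g hpi pib x g *: y g.
  have zE : ev io (Jform u) z = \sum_g io (hpi pib x g) * ev io (Jform u) (y g).
    by rewrite ev_sum; apply: eq_bigr => g _; rewrite evZ.
  rewrite -zE -[x](subrK z) evD (Jker_comm_ideal _ Mu) ?add0r ?subrK //.
  apply/ker => h; have hpiE v : hpi pib v h = ev idfun (fun i => pib i h) v by [].
  rewrite hpiE -scaleN1r evD evZ ev_sum (bigD1 h) //= big1 => [|g ne].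
    by rewrite evZ -!hpiE yP eqxx mulr1 addr0 mulN1r subrr.
  by rewrite evZ -hpiE yP eq_sym (negPf ne) mulr0.
have tE j : c * t j = \sum_g ((fun m => ev io (Jform (t m)) (y g)) ** pi g) j.
  transitivity (\sum_m \sum_l cH H io j m l * Jform (t m) l).
    rewrite /Jform /conv (sweedler3 (fun m a b => cform (t m * tinv a) * t b)).
    transitivity (((cform \o (t ** tinv)) ** t) j).
      rewrite t_tinv (_ : cform \o _ = fun m => c * eH H io m).
        by rewrite conv_scalel cH1f.
      apply: functional_extensionality => m /=.
      rewrite -[eH H io m]mulr1 cformZ ?cform1 ?mulr1 1?mulrC //; first exact: (sac sB).
      exact: (sa1 sM).
    apply: eq_bigr => m _; apply: eq_bigr => b _ /=.
    have Mtt a d : Bspan t (t a * tinv d).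
      by apply: M_mul; [apply: Bspan_gen|apply: Bspan_tinv].
    have Mc a d : Bspan t (cH H io m a d * (t a * tinv d)).
      by case: (Bspan_submod t) => _ _; apply=> //; apply: B_cH.
    rewrite /conv cform_sum => [|a]; last first.
      by apply: (submod_sum (A := B)) => //; apply: Bspan_submod.
    rewrite mulr_suml; congr (_ * _); apply: eq_bigr => a _.
    rewrite cform_sum // mulr_suml; apply: eq_bigr => d _.
    by rewrite [cform (_ * (_ * _))]cformZ; [rewrite mulrA|exact: B_cH|exact: Mtt].
  rewrite /conv [RHS]exchange_big; apply: eq_bigr => m _ /=.
  rewrite [RHS]exchange_big; apply: eq_bigr => l _ /=.
  rewrite -mulr_sumr; congr (_ * _).
  rewrite -(ev_ebas io (Jform (t m))) JE; last exact: Bspan_gen.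
  apply: eq_bigr => g _; rewrite mulrC; congr (_ * _).
  by rewrite -ev_piR ev_ebas.
have -> : c * (t ** pi 1%g) i
    = ((fun m => ev io (Jform (t m)) (y 1%g)) ** pi 1%g) i.
  have -> : c * (t ** pi 1%g) i = ((fun j => c * t j) ** pi 1%g) i.
    by rewrite conv_scalel.
  rewrite (functional_extensionality _ _ tE) conv_suml (bigD1 1%g) //= big1.
    by rewrite -cHA // piR_idem // addr0.
  move=> g ne; rewrite -cHA // piR_conv // (negPf ne) conv_scaler mul0r.
  by [].
apply: (conv_submod (A := B)) => [||m l]; [exact: (sa_submod sB)|exact: B_cH|].
apply: (saM sB); last exact: B_pi.
have Mt : Bspan t (t m) by apply: Bspan_gen.
(* [y 1] and the unit of [H] have the same image under [pi]; at the unit, [Jform (t m)] is a value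
   of the form times [t_1], both in [B]. *)
have -> : ev io (Jform (t m)) (y 1%g) = ev io (Jform (t m)) (unitc H).
  rewrite [RHS]JE // (bigD1 1%g) //= big1 => [|g ne].
    by rewrite Hu eqxx rmorph1 mul1r addr0.
  by rewrite Hu (negPf ne) rmorph0 mul0r.
rewrite /Jform ev_conv_grouplike; last exact: grouplike_unit.
apply: (saM sB); last exact: B_t1.
apply: (sa_ev sB) => a; apply: cform_B; apply: M_mul => //.
exact: Bspan_tinv.
Qed.

End Conductor.

(** Take [I] maximal such that no nonzero constant of [B] is a [B]-combination of the [t i], [i] in
    [I]. For [j] outside [I], a relation violating the condition on [j |: I] yields a nonzero
    multiple of [t j] in the span of 1 and these [t i]; the product of the multipliers works for all
    [j]. *)
Lemma conductor_nonzero : exists c, [/\ c != 0, B c & forall i, B (c * (t ** pi 1%g) i)].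
Proof.
pose nrel (I : {set 'I_n}) := forall (b0 : L) (b : 'I_n -> L), B b0 ->
  (forall i, B (b i)) -> b0 + \sum_(i in I) b i * t i = 0 -> b0 = 0.
have [I [nI maxI]] : exists I, nrel I /\ forall j, j \notin I -> ~ nrel (j |: I).
  suff W m (I : {set 'I_n}) : (#|~: I| < m)%N -> nrel I ->
      exists I, nrel I /\ forall j, j \notin I -> ~ nrel (j |: I).
    by apply: (W _ set0 (ltnSn _)) => b0 b _ _; rewrite big_set0 addr0.
  elim: m I => // m IH I ltm nI.
  case: (classic (exists j, j \notin I /\ nrel (j |: I))) => [[j [jI nj]]|no].
    apply: IH nj; rewrite -ltnS (leq_trans _ ltm) // ltnS.
    apply: proper_card; rewrite properE setCS subsetUr /=.
    apply/subsetPn; exists j; rewrite !inE ?jI // eqxx //.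
  by exists I; split=> // j jI nj; apply: no; exists j.
pose scales j e := [/\ e != 0, B e & exists b0, B b0 /\
  exists b : 'I_n -> L, (forall i, B (b i)) /\
    e * t j = b0 + \sum_(i in I) b i * t i].
have [e eP] : exists e : 'I_n -> L, forall j, scales j (e j).
  apply: (fin_all_exists (P := scales)) => j; have [jI|jI] := boolP (j \in I).
    exists 1; split; [exact: oner_neq0|exact: (sa1 sB)|].
    exists 0; split; first exact: (sa0 sB).
    exists (fun i => io (i == j)%:R); split=> [i|]; first exact: (sac sB).
    rewrite (bigD1 j) //= big1 => [|i /andP [_ /negPf ->]].
      by rewrite eqxx rmorph1 add0r addr0.
    by rewrite rmorph0 mul0r.
  have /not_all_ex_not [b0 /not_all_ex_not [b]] := maxI j jI.
  move=> nimp; have [Bb0 {}nimp] := imply_to_and _ _ nimp.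
  have [Bb {}nimp] := imply_to_and _ _ nimp.
  have [] := imply_to_and _ _ nimp.
  rewrite big_setU1 //= => E nz.
  exists (- b j); split.
  - rewrite oppr_eq0; apply/eqP => bj0; apply: nz; apply: (nI b0 b) => //.
    by move: E; rewrite bj0 mul0r add0r.
  - exact: (saN sB).
  - exists b0; split=> //; exists b; split=> //.
    apply/eqP; rewrite mulNr eq_sym -addr_eq0 -addrA [X in _ + X]addrC.
    exact/eqP.
exists (\prod_j e j).
have Bc : B (\prod_j e j) by apply: (sa_prod sB) => j _; case: (eP j).
split=> //.
  by apply/prodf_neq0 => j _; case: (eP j).
apply: (conductor_mem nI Bc) => j.
have [_ _ [b0 [Bb0 [b [Bb E]]]]] := eP j.
pose q := \prod_(i | i != j) e i.
have Bq : B q by apply: (sa_prod sB) => i _; case: (eP i).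
exists (q * b0); split; first exact: (saM sB).
exists (fun i => q * b i); split=> [i|]; first exact: (saM sB).
rewrite (bigD1 j) //= -/q (mulrC (e j)) -mulrA E mulrDr mulr_sumr.
by congr (_ + _); apply: eq_bigr => i _; rewrite mulrA.
Qed.

End BaseAlgebra.

(** * Determinants modulo an ideal *)

Section IdealDeterminant.
Variables (k L : fieldType) (io : {rmorphism k -> L}) (B D : L -> Prop).
Hypotheses (sB : is_subalg io B) (sD : is_submod B D) (DB : forall z, D z -> B z).

Lemma ideal_prod_one (J : eqType) (r : seq J) (F : J -> L) :
  (forall j, D (F j - 1)) -> D (\prod_(j <- r) F j - 1).
Proof.
have [D0 DD DM] := sD; move=> DF; elim: r => [|j r IH].
  by rewrite big_nil subrr.
rewrite big_cons; set p := \prod_(_ <- _) _ in IH *.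
have -> : F j * p - 1 = p * (F j - 1) + (p - 1) by ring.
apply: (DD) => //; apply: (DM) => //; rewrite -[p](subrK 1).
by apply: (saD sB); [apply: (DB)|apply: (sa1 sB)].
Qed.

(** In the Leibniz expansion the identity gives 1 modulo [D], and any other permutation picks an
    off-diagonal entry, which lies in [D]. *)
Lemma ideal_det m (A : 'M[L]_m) : (forall i j, D (A i j - (i == j)%:R)) ->
  D (\det A - 1).
Proof.
have [D0 DD DM] := sD; move=> DA.
have BA i j : B (A i j).
  rewrite -[A i j](subrK (i == j)%:R); apply: (saD sB); first exact: DB.
  by rewrite -(rmorph_nat io); apply: (sac sB).
rewrite /determinant (bigD1 1%g) //= odd_perm1 expr0 mul1r addrAC.
apply: (DD).
  apply: ideal_prod_one => i; have := DA i i; by rewrite eqxx perm1.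
apply: (submod_sum (A := B)) => // s ne1.
apply: (DM); first by rewrite -(rmorph1 io) -rmorphN -rmorphXn; apply: (sac sB).
have [i ne] : exists i, s i != i.
  apply/existsP; apply: contraR ne1; rewrite negb_exists => /forallP sE.
  by apply/eqP/permP => i; rewrite perm1; apply/eqP; have := sE i; rewrite negbK.
rewrite (bigD1 i) //= mulrC; apply: (DM); first by apply: (sa_prod sB).
by have := DA i (s i); rewrite eq_sym (negPf ne) subr0.
Qed.

End IdealDeterminant.

(** * Polynomials with coefficients in a subalgebra *)

Section PolynomialCoefficients.
Variables (k L : fieldType) (n : nat) (io : {rmorphism k -> L}).

Definition polyin (A : L -> Prop) (P : {mpoly L[n]}) : Prop := forall m, A P@_m.

Definition ioY : {rmorphism k -> {mpoly L[n]}} := @mpolyC n L \o io.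

Lemma polyinC (A : L -> Prop) c : is_subalg io A -> A c -> polyin A c%:MP.
Proof.
move=> sA Ac m; rewrite mcoeffC; apply: (saM sA) => //.
by rewrite -(rmorph_nat io); apply: (sac sA).
Qed.

Lemma polyinX (A : L -> Prop) i : is_subalg io A -> polyin A 'X_i.
Proof.
by move=> sA m; rewrite mcoeffX -(rmorph_nat io); apply: (sac sA).
Qed.

Lemma polyin_map (A : L -> Prop) q : is_subalg io A -> polyin A (map_mpoly io q).
Proof. by move=> sA m; rewrite mcoeff_map_mpoly; apply: (sac sA). Qed.

Lemma polyin_subalg (A : L -> Prop) : is_subalg io A -> is_subalg ioY (polyin A).
Proof.
move=> sA; split=> [c|P Q PA QA m|P Q PA QA m].
- by apply: polyinC => //; apply: (sac sA).
- by rewrite mcoeffD; apply: (saD sA).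
- by rewrite mcoeffM; apply: (sa_sum sA) => ? _; apply: (saM sA).
Qed.

Lemma mpoly_rmorph_eq (R : comNzRingType) (phi psi : {rmorphism {mpoly k[n]} -> R}) :
  (forall c, phi c%:MP = psi c%:MP) -> (forall i, phi 'X_i = psi 'X_i) -> phi =1 psi.
Proof.
move=> eC eX p; rewrite (mpolyE p) !rmorph_sum; apply: eq_bigr => m _.
rewrite -mul_mpolyC !rmorphM eC mpolyXE_id !rmorph_prod; congr (_ * _).
by apply: eq_bigr => i _; rewrite !rmorphXn eX.
Qed.

End PolynomialCoefficients.

(** * Generic translations; the degree 1 part lies in [B] *)

Section Translation.
Variables (k : fieldType) (n : nat) (H : HopfData k n).
Hypotheses (hopfH : is_hopf H) (ptH : pointed H).
Variables (gT : finGroupType) (pib : 'I_n -> gT -> k).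
Hypothesis Hab : Hab_group_algebra H pib.
Variables (L : fieldType) (toL : {rmorphism {mpoly k[n]} -> L}).
Hypothesis toL_inj : injective toL.
Variables (io : {rmorphism k -> L}) (t tinv : 'I_n -> L).
Hypotheses (toLC : forall c, toL c%:MP = io c) (toLX : forall i, toL 'X_i = t i).

Local Notation "f ** g" := (conv (cH H io) f g) (at level 40, left associativity).
Local Notation pi := (piR pib io).

Hypotheses (t_tinv : t ** tinv = eH H io) (tinv_t : tinv ** t = eH H io).
Hypothesis glinv : forall x, grouplike H x ->
  exists y, grouplike H y /\ hmul H x y = unitc H.

Variable B : L -> Prop.
Hypotheses (sB : is_subalg io B) (Bsig : forall x, B (cocyc H io t tinv x))
  (Bsigi : forall x, B (cocycV H io t tinv x)).
Hypothesis Bmin : forall P : L -> Prop, is_subalg io P ->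
  (forall x, P (cocyc H io t tinv x)) -> (forall x, P (cocycV H io t tinv x)) ->
  forall z, B z -> P z.

Local Notation LY := {mpoly L[n]}.
Local Notation ioY := (@ioY k L n io).
Definition ioS : {rmorphism k -> {mpoly k[n]}} := @mpolyC n k.
Local Notation "f *Y g" := (conv (cH H ioY) f g) (at level 40, left associativity).
Local Notation "f *YY g" := (conv (cHH H ioY) f g) (at level 40, left associativity).

Definition cst (f : 'I_n -> L) (i : 'I_n) : LY := (f i)%:MP.
Definition Yv (i : 'I_n) : LY := 'X_i.
Definition Xv (i : 'I_n) : {mpoly k[n]} := 'X_i.

(* The generic translation [t_x |-> Y_(x_1) t_(x_2)]; the substitution
   [Y_x |-> Y_(x_1) t^-1_(x_2)] undoes it, see [untransl_transl]. *)
Definition transl : {rmorphism {mpoly k[n]} -> LY} := mmap ioY (Yv *Y cst t).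
Definition untransl : {rmorphism LY -> LY} := mmap (@mpolyC n L) (Yv *Y cst tinv).

Lemma toL_ioS a : toL (ioS a) = io a. Proof. exact: toLC. Qed.

Lemma transl_ioS a : transl (ioS a) = ioY a. Proof. exact: mmapC. Qed.
Lemma translC c : transl c%:MP = ioY c. Proof. exact: mmapC. Qed.
Lemma translX i : transl 'X_i = (Yv *Y cst t) i.
Proof. by rewrite /transl /= mmapX mmap1U. Qed.

Definition mpC : {rmorphism L -> LY} := @mpolyC n L.
Lemma mpC_ioY a : mpC (io a) = ioY a. Proof. by []. Qed.

Lemma cst_conv f g : cst (f ** g) = cst f *Y cst g.
Proof.
apply: functional_extensionality => i.
rewrite -[RHS]/(conv (cH H ioY) (mpC \o f) (mpC \o g) i).
by rewrite -(conv_rmorph H mpC_ioY).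
Qed.

Lemma cst_eH : cst (eH H io) = eH H ioY. Proof. by []. Qed.

Lemma untransl_transl q : untransl (transl q) = map_mpoly io q.
Proof.
pose phi : {rmorphism {mpoly k[n]} -> LY} := untransl \o transl.
pose psi : {rmorphism {mpoly k[n]} -> LY} := map_mpoly io.
apply: (mpoly_rmorph_eq (phi := phi) (psi := psi)) => [c|i] /=.
  by rewrite translC /= mmapC map_mpolyC.
rewrite translX (conv_rmorph H (phi := untransl) (io' := ioY)) => [|a]; last first.
  by rewrite /untransl /= mmapC.
rewrite (_ : untransl \o Yv = Yv *Y cst tinv); last first.
  by apply: functional_extensionality => j; rewrite /untransl /= mmapX mmap1U.
rewrite (_ : untransl \o cst t = cst t); last first.
  by apply: functional_extensionality => j; rewrite /untransl /= mmapC.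
rewrite -cHA // -cst_conv tinv_t cst_eH cHf1 //.
by rewrite /psi /= /map_mpoly mmapX mmap1U.
Qed.

Variables (s : {mpoly k[n]}) (q : 'I_n -> {mpoly k[n]}).
Hypotheses (s_neq0 : s != 0) (Bs : B (toL s)) (BsV : B (toL s)^-1).
Hypothesis qE : forall i, toL (q i) = toL s * tinv i.
Hypothesis Ts : transl s = (toL s)%:MP * map_mpoly io s.

Local Notation sY := (map_mpoly io s : LY).
(** [s] is a common denominator of the [tinv i] and [q i] are the numerators. [qc] holds these in
    the old variables, as constants, and [qY] in the new ones. *)
Definition qc : 'I_n -> LY := cst (toL \o q).
Definition qY (i : 'I_n) : LY := map_mpoly io (q i).

Lemma ts_neq0 : toL s != 0.
Proof. by rewrite -(rmorph0 toL) (inj_eq toL_inj). Qed.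

Lemma map_mpoly_eq0 p : (map_mpoly io p == 0 :> LY) = (p == 0).
Proof.
apply/eqP/eqP => [E|->]; last by rewrite raddf0.
apply/mpolyP => m; have := mcoeff_map_mpoly io m p.
rewrite E !mcoeff0 => /esym/eqP; rewrite fmorph_eq0 => /eqP ->.
by [].
Qed.

Lemma conv_qX : conv (cH H ioS) q Xv = fun i => s * eH H ioS i.
Proof.
apply: functional_extensionality => i; apply: toL_inj.
rewrite (conv_rmorph H toL_ioS) rmorphM /= toLC.
rewrite (_ : toL \o q = fun i => toL s * tinv i).
  rewrite (_ : toL \o Xv = t); last by apply: functional_extensionality => j; apply: toLX.
  by rewrite conv_scalel tinv_t.
by apply: functional_extensionality => j; apply: qE.
Qed.

Lemma conv_Xq : conv (cH H ioS) Xv q = fun i => s * eH H ioS i.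
Proof.
apply: functional_extensionality => i; apply: toL_inj.
rewrite (conv_rmorph H toL_ioS) rmorphM /= toLC.
rewrite (_ : toL \o q = fun i => toL s * tinv i).
  rewrite (_ : toL \o Xv = t); last by apply: functional_extensionality => j; apply: toLX.
  by rewrite conv_scaler t_tinv.
by apply: functional_extensionality => j; apply: qE.
Qed.

Lemma map_Xv : (map_mpoly io \o Xv : 'I_n -> LY) = Yv.
Proof.
by apply: functional_extensionality => j; rewrite /= /map_mpoly mmapX mmap1U.
Qed.

Lemma conv_qY : qY *Y Yv = fun i => sY * eH H ioY i.
Proof.
pose psi : {rmorphism {mpoly k[n]} -> LY} := map_mpoly io.
have psiC a : psi (ioS a) = ioY a by rewrite /psi /= map_mpolyC.
apply: functional_extensionality => i; have := congr1 (fun f => psi (f i)) conv_qX.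
by rewrite /= (conv_rmorph H psiC) rmorphM /= -map_Xv psiC.
Qed.

Lemma conv_Yq : Yv *Y qY = fun i => sY * eH H ioY i.
Proof.
pose psi : {rmorphism {mpoly k[n]} -> LY} := map_mpoly io.
have psiC a : psi (ioS a) = ioY a by rewrite /psi /= map_mpolyC.
apply: functional_extensionality => i; have := congr1 (fun f => psi (f i)) conv_Xq.
by rewrite /= (conv_rmorph H psiC) rmorphM /= -map_Xv psiC.
Qed.

Lemma conv_tq : cst t *Y qc = fun i => (toL s)%:MP * eH H ioY i.
Proof.
rewrite /qc -cst_conv (_ : toL \o q = fun i => toL s * tinv i).
  by rewrite conv_scaler t_tinv; apply: functional_extensionality => j; rewrite /cst mpolyCM.
by apply: functional_extensionality => j; apply: qE.
Qed.

(** Inversion reverses the order: the inverse of [Y ** t] is [tinv ** Y^-1]. Up to the factor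
    [transl s], both sides are convolution inverses of [transl \o Xv], one on each side; they agree
    after cancelling it. *)
Lemma transl_q : transl \o q = qc *Y qY.
Proof.
have trX : transl \o Xv = Yv *Y cst t.
  by apply: functional_extensionality => j; apply: translX.
have E1 : (transl \o q) *Y (Yv *Y cst t) = fun i => transl s * eH H ioY i.
  apply: functional_extensionality => i; rewrite -trX.
  rewrite -(conv_rmorph H transl_ioS) conv_qX rmorphM.
  by rewrite /eH transl_ioS.
have E2 : (Yv *Y cst t) *Y (qc *Y qY) = fun i => transl s * eH H ioY i.
  rewrite -!cHA // (cHA hopfH ioY (cst t)) conv_tq conv_scalel cH1f //.
  rewrite conv_scaler conv_Yq Ts; apply: functional_extensionality => i.
  by rewrite mulrA.
have nz : transl s != 0.
  by rewrite Ts mulf_neq0 ?map_mpoly_eq0 // mpolyC_eq0 ts_neq0.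
have E : (fun i => transl s * (transl \o q) i) = (fun i => transl s * (qc *Y qY) i).
  have := cHA hopfH ioY (transl \o q) (Yv *Y cst t) (qc *Y qY).
  by rewrite E1 E2 conv_scaler conv_scalel cHf1 // cH1f.
apply: functional_extensionality => i; apply: (mulfI nz).
exact: (congr1 (fun f => f i) E).
Qed.

(** The fractions with denominator a power of [s] whose translate has coefficients in [B], expressed
    on a numerator because [transl] is defined on polynomials only. *)
Definition extends (z : L) : Prop :=
  exists m p, z * toL s ^+ m = toL p /\ polyin B (transl p).

Let sBY := polyin_subalg n sB.

Lemma polyin_sY : polyin B sY. Proof. exact: polyin_map sB. Qed.

Lemma polyin_transl_s : polyin B (transl s).
Proof. by rewrite Ts; apply: (saM sBY); [apply: polyinC sB _|apply: polyin_sY]. Qed.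

Lemma extends_subalg : is_subalg io extends.
Proof.
split=> [c|z w [m [p [E Hp]]] [m' [p' [E' Hp']]]|z w [m [p [E Hp]]] [m' [p' [E' Hp']]]].
- exists 0%N, c%:MP; split; first by rewrite expr0 mulr1 toLC.
  by rewrite translC; apply: (sac sBY).
- exists (m + m')%N, (p * s ^+ m' + p' * s ^+ m); split.
    by rewrite !(rmorphD, rmorphM, rmorphXn) -E -E' exprD; ring.
  rewrite !(rmorphD, rmorphM, rmorphXn); apply: (saD sBY); apply: (saM sBY) => //;
    by apply: (saX sBY); apply: polyin_transl_s.
- exists (m + m')%N, (p * p'); split.
    by rewrite rmorphM -E -E' exprD; ring.
  by rewrite rmorphM; apply: (saM sBY).
Qed.

Lemma polyin_conv2 f g x : (forall y, polyin B (f y)) -> (forall y, polyin B (g y)) ->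
  polyin B ((f *YY g) x).
Proof.
move=> Bf Bg; apply: (conv_submod (A := polyin B)); first exact: (sa_submod sBY).
  by move=> *; apply: (sac sBY).
by move=> *; apply: (saM sBY).
Qed.

Lemma polyin_qY i : polyin B (qY i). Proof. exact: polyin_map sB. Qed.
Lemma polyin_Yv i : polyin B (Yv i). Proof. exact: polyinX sB. Qed.

Lemma polyin_tens (f g : 'I_n -> LY) x : (forall y, polyin B (f y)) -> (forall y, polyin B (g y)) ->
  polyin B (tens f g x).
Proof. by move=> Bf Bg; apply: (saM sBY). Qed.

Lemma polyin_mus f x : (forall y, polyin B (f y)) -> polyin B (mus H ioY f x).
Proof.
by move=> Bf; exact: (submod_mus sBY _ _ (sa_submod sBY) Bf).
Qed.

(** The translate of [sigma] is [Y_(x_1) Y_(y_1) sigma(x_2, y_2) Y^-1_(x_3 y_3)]: bracketed in this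
    way, the constants from [L] assemble into values of [sigma] itself. *)
Lemma extends_cocyc x : extends (cocyc H io t tinv x).
Proof.
have trX : transl \o Xv = Yv *Y cst t.
  by apply: functional_extensionality => j; apply: translX.
have qf : toL \o q = fun i => toL s * tinv i.
  by apply: functional_extensionality => j; apply: qE.
have Xf : toL \o Xv = t by apply: functional_extensionality => j; apply: toLX.
have E : toL \o conv (cHH H ioS) (tens Xv Xv) (mus H ioS q)
       = fun y => toL s * cocyc H io t tinv y.
  apply: functional_extensionality => y /=.
  rewrite (conv2_rmorph H toL_ioS).
  rewrite (_ : toL \o tens Xv Xv = tens t t); last first.
    by apply: functional_extensionality => z; rewrite /= (tens_rmorph toL) Xf.
  rewrite (_ : toL \o mus H ioS q = fun z => toL s * mus H io tinv z).
    by rewrite conv_scaler.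
  apply: functional_extensionality => z; rewrite /= (mus_rmorph H toL_ioS) qf.
  by rewrite /mus mulr_sumr; apply: eq_bigr => m _; ring.
exists 1%N, (conv (cHH H ioS) (tens Xv Xv) (mus H ioS q) x); split.
  by rewrite expr1 mulrC -[RHS]/((toL \o _) x) E.
rewrite (conv2_rmorph H transl_ioS).
rewrite (_ : transl \o tens Xv Xv = tens Yv Yv *YY tens (cst t) (cst t)); last first.
  by rewrite tens_conv -trX; apply: functional_extensionality => z; rewrite /= (tens_rmorph transl).
rewrite (_ : transl \o mus H ioS q = mus H ioY qc *YY mus H ioY qY); last first.
  rewrite -mus_conv // -transl_q; apply: functional_extensionality => z.
  exact: (mus_rmorph H transl_ioS).
rewrite -cHHA // (cHHA hopfH ioY (tens (cst t) (cst t))).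
apply: polyin_conv2 => y; first by apply: polyin_tens; apply: polyin_Yv.
apply: polyin_conv2 => {}y; last by apply: polyin_mus; apply: polyin_qY.
rewrite (_ : (tens (cst t) (cst t) *YY mus H ioY qc) y = (toL s * cocyc H io t tinv y)%:MP).
  by apply: polyinC sB _; apply: (saM sB).
transitivity ((conv (cHH H io) (tens t t) (mus H io (toL \o q)) y)%:MP : LY).
  rewrite (conv2_rmorph H mpC_ioY).
  congr (conv _ _ _ _); apply: functional_extensionality => z.
    by rewrite /tens /= mpolyCM.
  exact: esym (mus_rmorph H mpC_ioY _ _).
congr (_%:MP); rewrite qf (_ : mus H io _ = fun z => toL s * mus H io tinv z).
  by rewrite conv_scaler.
apply: functional_extensionality => z.
by rewrite /mus mulr_sumr; apply: eq_bigr => m _; ring.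
Qed.

Lemma extends_cocycV x : extends (cocycV H io t tinv x).
Proof.
have trX : transl \o Xv = Yv *Y cst t.
  by apply: functional_extensionality => j; apply: translX.
have qf : toL \o q = fun i => toL s * tinv i.
  by apply: functional_extensionality => j; apply: qE.
have Xf : toL \o Xv = t by apply: functional_extensionality => j; apply: toLX.
have E0 : conv (cHH H io) (mus H io t) (tens (toL \o q) (toL \o q))
       = fun y => toL s ^+ 2 * cocycV H io t tinv y.
  rewrite qf tens_scale conv_scaler; apply: functional_extensionality => y.
  by rewrite expr2.
have E : toL \o conv (cHH H ioS) (mus H ioS Xv) (tens q q)
       = fun y => toL s ^+ 2 * cocycV H io t tinv y.
  rewrite -E0; apply: functional_extensionality => y /=.
  rewrite (conv2_rmorph H toL_ioS).
  congr (conv _ _ _ _); apply: functional_extensionality => z.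
    by rewrite /= (mus_rmorph H toL_ioS) Xf.
  exact: (tens_rmorph toL).
(* Two factors [tinv] occur, each cleared by one [s]. *)
exists 2%N, (conv (cHH H ioS) (mus H ioS Xv) (tens q q) x); split.
  by rewrite mulrC -[RHS]/((toL \o _) x) E.
rewrite (conv2_rmorph H transl_ioS).
rewrite (_ : transl \o tens q q = tens qc qc *YY tens qY qY); last first.
  rewrite tens_conv -transl_q; apply: functional_extensionality => z.
  by rewrite /= (tens_rmorph transl).
rewrite (_ : transl \o mus H ioS Xv = mus H ioY Yv *YY mus H ioY (cst t)); last first.
  rewrite -mus_conv // -trX; apply: functional_extensionality => z.
  exact: (mus_rmorph H transl_ioS).
rewrite -cHHA // (cHHA hopfH ioY (mus H ioY (cst t))).
apply: polyin_conv2 => y; first by apply: polyin_mus; apply: polyin_Yv.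
apply: polyin_conv2 => {}y; last by apply: polyin_tens; apply: polyin_qY.
rewrite (_ : (mus H ioY (cst t) *YY tens qc qc) y
           = (toL s ^+ 2 * cocycV H io t tinv y)%:MP).
  by apply: polyinC sB _; apply: (saM sB) => //; apply: (saX sB).
transitivity ((conv (cHH H io) (mus H io t) (tens (toL \o q) (toL \o q)) y)%:MP : LY).
  rewrite (conv2_rmorph H mpC_ioY).
  congr (conv _ _ _ _); apply: functional_extensionality => z.
    exact: esym (mus_rmorph H mpC_ioY _ _).
  by rewrite /tens /= mpolyCM.
by rewrite E0.
Qed.

(** By minimality [B] lies in [extends]. In the power of [transl s] thus introduced, [s] is a unit
    of [B] and cancels, while [sY] has to stay. *)
Lemma transl_B p : B (toL p) -> exists m, polyin B (transl p * sY ^+ m).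
Proof.
move=> Bp; have [m [p' [E Hp']]] := Bmin extends_subalg extends_cocyc extends_cocycV Bp.
have {}E : p' = p * s ^+ m by apply: toL_inj; rewrite -E rmorphM rmorphXn.
exists m; have -> : transl p * sY ^+ m = ((toL s)^-1 ^+ m)%:MP * transl p'.
  have -> : transl p' = transl p * transl s ^+ m by rewrite E rmorphM rmorphXn.
  have e : ((toL s)^-1 ^+ m)%:MP * ((toL s)%:MP ^+ m) = 1 :> LY.
    rewrite -(rmorphXn mpC) /= -mpolyCM -exprMn mulVf ?ts_neq0 // expr1n.
    exact: mpolyC1.
  by rewrite Ts exprMn [RHS]mulrCA (mulrA _ _ (sY ^+ m)) e mul1r.
apply: (saM sBY) => //; apply: polyinC sB _; exact: (saX sB).
Qed.

Definition Dcond (z : L) : Prop := B z /\ forall i, B (z * (t ** pi 1%g) i).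

Lemma Dcond_submod : is_submod B Dcond.
Proof.
split.
- by split=> [|i]; rewrite ?mul0r; apply: (sa0 sB).
- move=> z w [Bz Dz] [Bw Dw]; split=> [|i]; first exact: (saD sB).
  by rewrite mulrDl; apply: (saD sB).
- move=> z w Bz [Bw Dw]; split=> [|i]; first exact: (saM sB).
  by rewrite -mulrA; apply: (saM sB).
Qed.

(* The translation invariance of [B] makes its conductor invariant; translating a
   nonzero polynomial of the conductor back to the origin gives [1]. *)
Lemma coinvariants_in_B i : B ((t ** pi 1%g) i).
Proof.
have sD := Dcond_submod; have [D0 DD DM] := sD.
have sM := Bspan_t_subalg hopfH t_tinv tinv_t sB Bsig Bsigi.
have [c [nzc Bc Dc]] := conductor_nonzero hopfH ptH Hab t_tinv tinv_t glinv sB Bsig Bsigi.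
(* A power of the unit [s] turns the conductor element [c] into a polynomial [f]. *)
have [m0 [f [fE _]]] := Bmin extends_subalg extends_cocyc extends_cocycV Bc.
have nzf : f != 0.
  rewrite -(inj_eq toL_inj) rmorph0 -fE mulf_neq0 // expf_neq0 //; exact: ts_neq0.
have Df : Dcond (toL f).
  by rewrite -fE mulrC; apply: (DM); [apply: (saX sB)|split].
pose rpi := conv (cH H ioS) Xv (piR pib ioS 1%g).
have rpiE j : toL (rpi j) = (t ** pi 1%g) j.
  rewrite /rpi (conv_rmorph H toL_ioS).
  congr (conv _ _ _ _); apply: functional_extensionality => l; first exact: toLX.
  exact: toLC.
have trpi j : transl (rpi j) = (Yv *Y cst (t ** pi 1%g)) j.
  rewrite cst_conv cHA // /rpi (conv_rmorph H transl_ioS).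
  congr (conv _ _ _ _); apply: functional_extensionality => l; first exact: translX.
  exact: translC.
have [M0 HM0] := transl_B Df.1.
have [Mi HMi] : exists Mi : 'I_n -> nat, forall j,
    polyin B (transl (f * rpi j) * sY ^+ Mi j).
  apply: (fin_all_exists (P := fun j m => polyin B (transl (f * rpi j) * sY ^+ m))) => j.
  by apply: transl_B; rewrite rmorphM rpiE; apply: Df.2.
pose M := (M0 + \sum_j Mi j)%N.
have up p m m' : (m <= m')%N -> polyin B (p * sY ^+ m) -> polyin B (p * sY ^+ m').
  move=> le Hp; rewrite -(subnK le) addnC exprD mulrA; apply: (saM sBY) => //.
  by apply: (saX sBY); apply: polyin_sY.
(* [M] factors [sY] clear the translates of [f] and of all [f * rpi j]. The extra one serves to
   recover the constants [t ** pi 1] from the translates [Y ** (t ** pi 1)] of [rpi], by convolving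
   with [qY]. *)
pose P := transl f * sY ^+ M.+1.
have DP : polyin Dcond P.
  move=> m; split.
    by apply: (up _ M0) => //; rewrite ltnW // ltnS leq_addr.
  move=> j; rewrite mulrC -mcoeffCM.
  have -> : ((t ** pi 1%g) j)%:MP * P = (qY *Y (fun l => transl (f * rpi l) * sY ^+ M)) j.
    transitivity (transl f * sY ^+ M * (sY * cst (t ** pi 1%g) j)).
      by rewrite /P exprSr /cst; ring.
    have -> : sY * cst (t ** pi 1%g) j = (qY *Y (Yv *Y cst (t ** pi 1%g))) j.
      by rewrite cHA // conv_qY conv_scalel cH1f.
    rewrite -[LHS]/((fun l => _ * (qY *Y _) l) j) -conv_scaler.
    congr (conv _ _ _ _).
    by apply: functional_extensionality => l; rewrite rmorphM trpi; ring.
  have HP : polyin B ((qY *Y (fun l => transl (f * rpi l) * sY ^+ M)) j);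
    last exact: HP.
  apply: (conv_submod (A := polyin B)); first exact: (sa_submod sBY).
    by move=> *; apply: (sac sBY).
  move=> a b; apply: (saM sBY); first exact: polyin_qY.
  apply: (up _ (Mi b)) => //; apply: leq_trans (leq_addl _ _).
  by rewrite (bigD1 b) //= leq_addr.
pose DF := Bspan Dcond t.
have sDF : is_submod B DF.
  split.
  - exists (fun=> 0); split=> //; by rewrite big1 // => j _; rewrite mul0r.
  - move=> _ _ [b [Bb ->]] [d [Bd ->]]; exists (fun j => b j + d j); split=> [j|].
      exact: DD.
    by rewrite -big_split; apply: eq_bigr => j _; rewrite mulrDl.
  - move=> z _ Bz [b [Bb ->]]; exists (fun j => z * b j); split=> [j|].
      exact: DM.
    by rewrite mulr_sumr; apply: eq_bigr => j _; rewrite mulrA.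
have DBF z w : Dcond z -> Bspan B t w -> DF (z * w).
  move=> Dz [b [Bb ->]]; exists (fun j => b j * z); split=> [j|].
    by apply: (DM).
  by rewrite mulr_sumr; apply: eq_bigr => j _; rewrite mulrA (mulrC z).
have DFF z w : DF z -> Bspan B t w -> DF (z * w).
  move=> [d [Dd ->]] Mw; rewrite mulr_suml; apply: (submod_sum (A := B)) => // j _.
  rewrite -mulrA; apply: (DBF) => //; apply: (saM sM) => //; exact: (Bspan_gen sB).
have sMY := polyin_subalg n sM.
(* [untransl] substitutes polynomials with coefficients in [Bspan B t], so coefficients in the
   conductor become coefficients in the ideal [DF] it generates there. *)
have DFP : polyin DF (untransl P).
  rewrite /untransl /= /mmap => m.
  rewrite (raddf_sum (mcoeff m)); apply: (submod_sum (A := B)) => // m' _ /=.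
  rewrite mcoeffCM; apply: (DBF) => //.
  have : polyin (Bspan B t) (mmap1 (Yv *Y cst tinv) m'); last exact.
  apply: (sa_prod sMY) => j _; apply: (saX sMY).
  apply: (conv_submod (A := polyin (Bspan B t))); first exact: (sa_submod sMY).
    by move=> *; apply: (sac sMY).
  move=> a b; apply: (saM sMY); first exact: polyinX sM.
  apply: polyinC sM _; exact: (Bspan_tinv hopfH ptH Hab t_tinv tinv_t glinv sB Bsig Bsigi).
(* Undoing the translation returns a nonzero polynomial in [Y] with coefficients in [k], up to
   powers of the unit [s]; any nonzero coefficient then puts 1 into [DF]. *)
have UP : untransl P = ((toL s)^-1 ^+ M.+1)%:MP * map_mpoly io (f * s ^+ M.+1).
  have us : untransl sY = ((toL s)^-1)%:MP * sY.
    have := untransl_transl s; rewrite Ts rmorphM [untransl _%:MP]mmapC => E.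
    rewrite -[X in _ = _ * X]E.
    by rewrite mulrA -mpolyCM mulVf ?ts_neq0 // mpolyC1 mul1r.
  by rewrite /P rmorphM rmorphXn us untransl_transl exprMn !rmorphM !rmorphXn /=; ring.
have [m nzm] : exists m, (f * s ^+ M.+1)@_m != 0.
  apply: NNPP => no; have : f * s ^+ M.+1 != 0 by rewrite mulf_neq0 // expf_neq0.
  move/eqP; apply; apply/mpolyP => m; rewrite mcoeff0; apply/eqP/negPn/negP => nz.
  by apply: no; exists m.
set a := _@_m in nzm.
have DF1 : DF 1.
  have := DFP m; rewrite UP mcoeffCM mcoeff_map_mpoly -/a => DFa.
  have -> : 1 = (toL s ^+ M.+1 * io a^-1) * ((toL s)^-1 ^+ M.+1 * io a).
    rewrite mulrACA -exprMn divff ?ts_neq0 // expr1n mul1r -rmorphM mulVf //.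
    by rewrite rmorph1.
  case: (sDF) => _ _; apply=> //; apply: (saM sB); first exact: (saX sB).
  exact: (sac sB).
have tD j : exists d : 'I_n -> L, (forall l, Dcond (d l)) /\ t j = \sum_l d l * t l.
  by have := DFF _ (t j) DF1 (Bspan_gen sB t j); rewrite mul1r.
have [d dP] : exists d : 'I_n -> 'I_n -> L, forall j,
    (forall l, Dcond (d j l)) /\ t j = \sum_l d j l * t l.
  exact: (fin_all_exists (P := fun j d => (forall l, Dcond (d l)) /\ t j = \sum_l d l * t l)).
(* [t = d t] with [d] over the conductor: [1 - d] annihilates the nonzero column [t], so its
   determinant is 0, yet it is 1 modulo the conductor. Hence 1 is in the conductor. *)
pose A : 'M[L]_n := \matrix_(j, l) ((j == l)%:R - d j l).
have A0 : A *m (\col_l t l) = 0.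
  apply/colP => j; rewrite !mxE.
  under eq_bigr => l _ do rewrite !mxE mulrBl.
  rewrite sumrB -(dP j).2 (bigD1 j) //= big1 => [|l ne].
    by rewrite eqxx mul1r addr0 subrr.
  by rewrite eq_sym (negPf ne) mul0r.
have detA : \det A = 0.
  apply/eqP; apply: contraT; rewrite -unitfE -unitmxE => uA.
  have t0 : \col_l t l = 0 by rewrite -(mulKmx uA (\col_l t l)) A0 mulmx0.
  have := ev_t_neq0 hopfH t_tinv (grouplike_unit hopfH).
  rewrite /ev big1 ?eqxx // => j _.
  by have := congr1 (fun C : 'cV[L]_n => C j 0) t0; rewrite !mxE => ->; rewrite mulr0.
have : Dcond (\det A - 1).
  apply: (ideal_det sB sD); first by move=> z [].
  move=> j l; rewrite mxE addrAC subrr add0r -mulN1r -(rmorph1 io) -rmorphN.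
  by apply: (DM); [apply: (sac sB)|case: (dP j)].
rewrite detA sub0r => -[_ /(_ i)]; rewrite mulN1r => /(saN sB).
by rewrite opprK.
Qed.

End Translation.

(** * The common denominator and the explicit generators *)

Section Generators.
Variables (k : fieldType) (n : nat) (H : HopfData k n).
Hypotheses (hopfH : is_hopf H) (ptH : pointed H).
Variables (gT : finGroupType) (pib : 'I_n -> gT -> k).
Hypothesis Hab : Hab_group_algebra H pib.
Variables (l : nat) (gs : 'I_l -> 'rV[k]_n).
Hypotheses (gs_inj : injective gs)
  (gsP : forall x, grouplike H x <-> exists j, x = gs j).
Variable b : seq gT.
Hypotheses (defG : (\big[dprod/1]_(x <- b) <[x]>)%g = [set: gT])
  (ord_b : forall x, x \in b -> (1 < #[x]%g)%N).
Variables (L : fieldType) (toL : {rmorphism {mpoly k[n]} -> L}).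
Hypothesis toL_inj : injective toL.
Variables (io : {rmorphism k -> L}) (t tinv : 'I_n -> L).
Hypotheses (toLC : forall c, toL c%:MP = io c) (toLX : forall i, toL 'X_i = t i).

Local Notation "f ** g" := (conv (cH H io) f g) (at level 40, left associativity).
Local Notation pi := (piR pib io).

Hypotheses (t_tinv : t ** tinv = eH H io) (tinv_t : tinv ** t = eH H io).

Variable B : L -> Prop.
Hypotheses (sB : is_subalg io B) (Bsig : forall x, B (cocyc H io t tinv x))
  (Bsigi : forall x, B (cocycV H io t tinv x)).
Hypothesis Bmin : forall P : L -> Prop, is_subalg io P ->
  (forall x, P (cocyc H io t tinv x)) -> (forall x, P (cocycV H io t tinv x)) ->
  forall z, B z -> P z.

Let glgs j : grouplike H (gs j). Proof. by apply/gsP; exists j. Qed.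

Let glinv x : grouplike H x -> exists y, grouplike H y /\ hmul H x y = unitc H.
Proof. exact: grouplike_rinv gs_inj gsP. Qed.

Definition tp (x : 'rV[k]_n) : {mpoly k[n]} := ev (ioS k n) (@Xv k n) x.

Lemma toL_tp x : toL (tp x) = ev io t x.
Proof.
rewrite /tp (ev_rmorph (toL_ioS toLC)); apply: eq_bigr => i _.
by rewrite /= /Xv toLX.
Qed.

(** Constructs the denominator [s] and numerators [q] that [coinvariants_in_B] asks for. *)
Lemma coinvariants_mem_B i : B ((t ** pi 1%g) i).
Proof.
have [y yP] : exists y : 'I_l -> 'rV[k]_n, forall j, [/\ grouplike H (y j),
    B (ev io t (gs j) * ev io t (y j))
    & B ((ev io t (gs j))^-1 * (ev io t (y j))^-1)].
  apply: (fin_all_exists (P := fun j y => [/\ grouplike H y,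
    B (ev io t (gs j) * ev io t y) & B ((ev io t (gs j))^-1 * (ev io t y)^-1)])) => j.
  have [y [gy _ B1 B2]] := B_pair hopfH t_tinv glinv sB Bsig Bsigi (glgs j).
  by exists y.
(* Pairing each [t_g] with the variable of the inverse of [g] makes [s0] a unit of [B] that is
   divisible by every [t_g]; so [A], the localization at [s0], contains the inverses needed in the
   chain argument. *)
pose s0 := \prod_j (tp (gs j) * tp (y j)).
have nz0 : s0 != 0.
  apply/prodf_neq0 => j _; have [gy _ _] := yP j.
  rewrite -(inj_eq toL_inj) rmorph0 rmorphM !toL_tp mulf_neq0 //;
    exact: (ev_t_neq0 hopfH t_tinv).
have B0 : B (toL s0).
  rewrite rmorph_prod; apply: (sa_prod sB) => j _; rewrite rmorphM !toL_tp.
  by case: (yP j).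
have B0V : B (toL s0)^-1.
  rewrite rmorph_prod -prodfV; apply: (sa_prod sB) => j _; rewrite rmorphM !toL_tp invfM.
  by case: (yP j).
pose A z := exists m p, z * toL s0 ^+ m = toL p.
have sA : is_subalg io A.
  split=> [c|z w [m [p E]] [m' [p' E']]|z w [m [p E]] [m' [p' E']]].
  - by exists 0%N, c%:MP; rewrite expr0 mulr1 toLC.
  - exists (m + m')%N, (p * s0 ^+ m' + p' * s0 ^+ m).
    by rewrite !(rmorphD, rmorphM, rmorphXn) -E -E' exprD; ring.
  - exists (m + m')%N, (p * p').
    by rewrite rmorphM -E -E' exprD; ring.
have At j : A (t j) by exists 0%N, 'X_j; rewrite expr0 mulr1 toLX.
have Atinv j : A (tinv j).
  rewrite (conv_sum_piRl hopfH Hab io tinv j); apply: (sa_sum sA) => g _.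
  apply: (graded_tinv hopfH ptH Hab tinv_t (subalg_graded gT sA)) => [h j'|x h gx _].
    apply: (conv_submod (A := A)); first exact: (sa_submod sA).
      by move=> *; apply: (sac sA).
    by move=> *; apply: (saM sA) => //; apply: (sac sA).
  split; last exact: (ev_t_neq0 hopfH t_tinv).
  have /gsP [j' xE] := gx; have nz := ev_t_neq0 hopfH t_tinv gx.
  exists 1%N, (tp (y j') * \prod_(j0 | j0 != j') (tp (gs j0) * tp (y j0))).
  rewrite expr1 /s0 (bigD1 j') //= !rmorphM !toL_tp -xE !mulrA mulVf //.
  by rewrite mul1r.
have [Mi MiP] : exists Mi : 'I_n -> nat, forall j, exists p,
    tinv j * toL s0 ^+ Mi j = toL p.
  by apply: (fin_all_exists (P := fun j m => exists p, tinv j * toL s0 ^+ m = toL p)).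
(* The sum of the exponents dominates each of them, so one power serves all [tinv j]. *)
pose s := s0 ^+ (\sum_j Mi j).
have [q qP] : exists q : 'I_n -> {mpoly k[n]}, forall j, toL (q j) = toL s * tinv j.
  apply: (fin_all_exists (P := fun j p => toL p = toL s * tinv j)) => j.
  have [p pE] := MiP j; exists (p * s0 ^+ \sum_(j0 | j0 != j) Mi j0).
  rewrite rmorphM -pE /s [in RHS](bigD1 j) //= exprD !rmorphM !rmorphXn; ring.
apply: (coinvariants_in_B hopfH ptH Hab toL_inj toLC toLX t_tinv tinv_t glinv sB
  Bsig Bsigi Bmin (s := s) _ _ _ qP).
- by rewrite expf_neq0.
- by rewrite rmorphXn; apply: (saX sB).
- by rewrite rmorphXn -exprVn; apply: (saX sB).
(* A multiplicative property of polynomials, true of [t_g] because [g] is grouplike. *)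
pose Q p := transl H io t p = (toL p)%:MP * map_mpoly io p.
have Q1 : Q 1 by rewrite /Q !rmorph1 mulr1.
have QM p p' : Q p -> Q p' -> Q (p * p').
  by rewrite /Q => E E'; rewrite !rmorphM E E' /=; ring.
have Qg x : grouplike H x -> Q (tp x).
  move=> gx; rewrite /Q {1}/tp (ev_rmorph (transl_ioS H io t)).
  rewrite (_ : _ \o _ = conv (cH H (ioY n io)) (@Yv n L) (cst t)); last first.
    by apply: functional_extensionality => j; apply: translX.
  rewrite ev_conv_grouplike // mulrC; congr (_ * _).
    by rewrite toL_tp -[RHS]/(mpC n L _) (ev_rmorph (mpC_ioY n io)).
  pose psi : {rmorphism {mpoly k[n]} -> {mpoly L[n]}} := map_mpoly io.
  have psiC a : psi (ioS k n a) = ioY n io a by rewrite /psi /= map_mpolyC.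
  rewrite -[RHS]/(psi _) /tp (ev_rmorph psiC); apply: eq_bigr => j _.
  by rewrite /psi /= /map_mpoly /Xv mmapX mmap1U.
rewrite -/(Q s) /s; elim: (\sum_j _)%N => [|m IH]; rewrite ?expr0 ?exprS //.
apply: (QM) => //; rewrite /s0; elim/big_rec: _ => // j x _ Qx.
by apply: (QM) => //; apply: (QM); apply: Qg => //; case: (yP j).
Qed.

Let gTC : forall x y : gT, (x * y)%g = (y * x)%g.
Proof.
have [_ _ _ _ com] := dprod_cycles (G := [set: gT]%G) defG ord_b.
by move=> x y; apply: com; rewrite inE.
Qed.

Let uqb : uniq b.
Proof. by have [] := dprod_cycles (G := [set: gT]%G) defG ord_b. Qed.

Lemma prodg_add (s : seq gT) (m m' : gT -> nat) :
  (\prod_(x <- s) x ^+ (m x + m' x) =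
   (\prod_(x <- s) x ^+ m x) * (\prod_(x <- s) x ^+ m' x))%g.
Proof.
elim: s => [|x s IH]; first by rewrite !big_nil mulg1.
rewrite !big_cons IH expgD !mulgA; congr (_ * _)%g.
by rewrite -!mulgA; congr (_ * _)%g; rewrite gTC.
Qed.

Lemma prodg_delta (s : seq gT) x : uniq s -> x \in s ->
  (\prod_(y <- s) y ^+ (y == x) = x)%g.
Proof.
elim: s => //= y s IH /andP [ys us]; rewrite inE big_cons.
have [-> _|ne /= xs] := eqVneq x y; last by rewrite IH // mul1g.
rewrite expg1 big_seq big1 ?mulg1 // => z zs.
by case: eqP => // zy; rewrite -zy zs in ys.
Qed.

Lemma degree_inv x y d d' : grouplike H x -> grouplike H y ->
  hmul H x y = unitc H -> (forall h, hpi pib x h = (h == d)%:R) ->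
  (forall h, hpi pib y h = (h == d')%:R) -> d' = d^-1%g.
Proof.
move=> gx gy xy dx dy; have [_ [Hu _]] := Hab.
have E : ev io (pi 1%g) (hmul H x y) = 1 by rewrite xy ev_piR Hu eqxx rmorph1.
have E' : \sum_h ev2 io (tens (pi h) (pi (h^-1 * 1)%g)) x y = 1.
  rewrite -E -ev2_mus mus_piR // /ev2 exchange_big; apply: eq_bigr => i _ /=.
  by rewrite exchange_big; apply: eq_bigr => j _ /=; rewrite mulr_sumr.
apply/eqP; move: E'; rewrite (bigD1 d) //= big1 => [|h ne]; last first.
  by rewrite ev2_tens !ev_piR dx (negPf ne) rmorph0 mul0r.
rewrite addr0 ev2_tens !ev_piR dx dy eqxx mulg1 rmorph1 mul1r eq_sym.
by case: eqP => // _ /eqP; rewrite rmorph0 eq_sym oner_eq0.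
Qed.

Lemma generators : exists u : 'I_n -> L,
  [/\ forall i : 'I_n, (i < l)%N -> exists s : seq 'I_l,
        (size s <= sumn [seq #[x]%g | x <- b] - size b + 1)%N /\
        u i = \prod_(j <- s) ev io t (gs j),
      forall i : 'I_n, (l <= i)%N -> exists s : seq 'rV[k]_n,
        (size s <= 2)%N /\ u i = \prod_(x <- s) ev io t x,
      forall i : 'I_n, (i < l)%N -> u i != 0,
      forall i : 'I_n, B (u i) /\ ((i < l)%N -> B (u i)^-1)
    & forall U : L -> Prop, is_subalg io U -> (forall i, U (u i)) ->
        (forall i : 'I_n, (i < l)%N -> U (u i)^-1) -> forall z, B z -> U z].
Proof.
have [_ gen _ ind _] := dprod_cycles (G := [set: gT]%G) defG ord_b.
have [deg degP] : exists deg : 'I_l -> gT, forall j h,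
    hpi pib (gs j) h = (h == deg j)%:R.
  apply: (fin_all_exists (P := fun j g => forall h, hpi pib (gs j) h = (h == g)%:R)) => j.
  exact: (grouplike_degree hopfH Hab (glgs j)).
have [ghat ghatP] : exists ghat : gT -> 'I_l, forall g, deg (ghat g) = g.
  apply: (fin_all_exists (P := fun g j => deg j = g)) => g.
  have [x [/gsP [j ->] dx]] := grouplike_of_degree hopfH Hab g ptH.
  exists j; have := dx (deg j); rewrite degP eqxx.
  by case: eqP => // _ /eqP; rewrite oner_eq0.
have [a aP] : exists a : gT -> gT -> nat, forall g,
    (forall x, x \in b -> (a g x < #[x]%g)%N) /\ g = (\prod_(x <- b) x ^+ a g x)%g.
  apply: (fin_all_exists (P := fun g m => (forall x, x \in b -> (m x < #[x]%g)%N) /\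
    g = (\prod_(x <- b) x ^+ m x)%g)) => g.
  by apply: gen; rewrite inE.
have [xs [ds [xsP spanP]]] := homogeneous_completion hopfH Hab gs_inj glgs.
have leln := leq_ln gs_inj glgs.
pose tg j := ev io t (gs j).
have tg_neq0 j : tg j != 0 by apply: (ev_t_neq0 hopfH t_tinv (glgs j)).
(* [tau g] is a monomial of degree [g] in the variables of the chosen lifts of the cyclic
   generators. *)
pose Tm (m : gT -> nat) := \prod_(x <- b) tg (ghat x) ^+ m x.
pose tau g := Tm (a g).
have Tm_neq0 m : Tm m != 0.
  by rewrite /Tm prodf_seq_neq0; apply/allP => x _; rewrite expf_neq0.
have TmD m m' : Tm (fun x => m x + m' x)%N = Tm m * Tm m'.
  by rewrite /Tm -big_split; apply: eq_bigr => x _; rewrite exprD.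
pose mono j := j :: flatten [seq nseq (a (deg j)^-1%g x) (ghat x) | x <- b].
have monoE j : \prod_(i <- mono j) tg i = tg j * tau (deg j)^-1%g.
  rewrite big_cons big_flatten big_map; congr (_ * _); apply: eq_bigr => x _.
  by rewrite big_nseq -Monoid.iteropE.
have degE j : (\prod_(i <- mono j) deg i = 1)%g.
  rewrite big_cons big_flatten big_map -[RHS](mulgV (deg j)); congr (_ * _)%g.
  rewrite [RHS](aP _).2; apply: eq_bigr => x _; rewrite big_nseq ghatP.
  by rewrite -Monoid.iteropE.
(* The exponent at [x] is below [#[x]], so the factor [tau] has degree at most [d - r]; the
   additional 1 is for [gs j]. *)
have size_mono j : (size (mono j) <= sumn [seq #[x]%g | x <- b] - size b + 1)%N.
  rewrite /= addn1 ltnS size_flatten /shape -map_comp.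
  suff W (m : gT -> nat) (c : seq gT) : (forall x, x \in c -> (m x < #[x]%g)%N) ->
      (sumn (map (size \o (fun x => nseq (m x) (ghat x))) c) + size c
        <= sumn [seq #[x]%g | x <- c])%N.
    have Wb := W _ _ (aP (deg j)^-1%g).1.
    by rewrite leq_subRL ?(leq_trans (leq_addl _ _) Wb) // addnC.
  elim: c => //= x c IH Hm; rewrite size_nseq.
  have lt := Hm x (mem_head _ _).
  have {}IH := IH (fun y yc => Hm y (mem_behead (s := x :: c) yc)).
  by rewrite addnS -addnA -addSn leq_add.
pose u (i : 'I_n) := if insub (val i) is Some j then \prod_(i <- mono j) tg i
  else ev io t (xs i) * tg (ghat (ds i)^-1%g).
have uE j : u (widen_ord leln j) = \prod_(i <- mono j) tg i.
  by rewrite /u /= insubT ?ltn_ord //= => lt; congr (\prod_(i <- mono _) _); apply: val_inj.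
have u_lt (i : 'I_n) : (i < l)%N -> exists j, i = widen_ord leln j.
  by move=> lt; exists (Ordinal lt); apply: val_inj.
have u_ge (i : 'I_n) : (l <= i)%N -> u i = ev io t (xs i) * tg (ghat (ds i)^-1%g).
  by move=> ge; rewrite /u insubF // ltnNge ge.
(* Membership in [B] is now a matter of degrees: [Bg 1] is contained in [B] by
   [coinvariants_mem_B]. *)
pose Bg g := Bspan B (t ** pi g).
have gBg : is_graded io Bg := B_graded hopfH Hab t_tinv tinv_t sB Bsig Bsigi.
have Bg1 z : Bg 1%g z -> B z.
  case=> c [Bc ->]; apply: (sa_sum sB) => i _; apply: (saM sB) => //.
  exact: coinvariants_mem_B.
have tgBg j : Bg (deg j) (tg j).
  have <- : ev io (t ** pi (deg j)) (gs j) = tg j.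
    by rewrite (ev_conv_piR_grouplike io t (deg j) (glgs j) (degP j)) eqxx mul1r.
  exact: Bspan_ev.
have tgVBg j : Bg (deg j)^-1%g (tg j)^-1.
  have [y [gy xy _ ByV]] := B_pair hopfH t_tinv glinv sB Bsig Bsigi (glgs j).
  have /gsP [j' yE] := gy; rewrite yE -/(tg j) -/(tg j') in xy ByV gy.
  rewrite -(degree_inv (glgs j) gy xy (degP j) (degP j')).
  rewrite -[(tg j)^-1](mulfVK (tg_neq0 j')).
  case: (Bspan_submod sB (t ** pi (deg j'))) => _ _ sMM; apply: sMM => //.
  exact: tgBg.
case: (gBg) => Bg_c Bg_0 Bg_D Bg_M.
have prodBg s : Bg (\prod_(j <- s) deg j)%g (\prod_(j <- s) tg j) /\
                Bg (\prod_(j <- s) deg j)^-1%g (\prod_(j <- s) tg j)^-1.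
  elim: s => [|j s [IH1 IH2]].
    by rewrite !big_nil invr1 invg1 -(rmorph1 io).
  rewrite !big_cons; split; first exact: Bg_M.
  by rewrite invfM mulrC invMg; apply: (Bg_M).
exists u; split.
- move=> i /u_lt [j ->]; exists (mono j); split; first exact: size_mono.
  by rewrite uE.
- move=> i /u_ge ->; exists [:: xs i; gs (ghat (ds i)^-1%g)]; split=> //.
  by rewrite !big_cons big_nil mulr1.
- move=> i /u_lt [j ->]; rewrite uE monoE mulf_neq0 //; exact: Tm_neq0.
- move=> i; have [lt|ge] := ltnP i l.
    have [j ->] := u_lt i lt; rewrite uE; have := prodBg (mono j).
    by rewrite degE invg1 => -[/Bg1 B1 /Bg1 B2].
  split=> //; rewrite u_ge //; apply: Bg1.
  have [y yE] := xsP i.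
  rewrite -(mulgV (ds i)); apply: (Bg_M); last first.
    by have := tgBg (ghat (ds i)^-1%g); rewrite ghatP.
  have <- : ev io (t ** pi (ds i)) (xs i) = ev io t (xs i).
    by rewrite yE (ev_conv_Qproj hopfH Hab) eqxx mul1r.
  exact: Bspan_ev.
(* It remains to put the cocycles into [U]. For this [U] is enlarged to a graded family that
   contains the [t_x] and has [U] as its degree 1 part. *)
move=> U sU Uu UuV.
pose un z := U z /\ U z^-1.
have unM z w : un z -> un w -> un (z * w).
  by move=> [Uz UzV] [Uw UwV]; split; rewrite ?invfM; apply: (saM sU).
have unV z : un z -> un z^-1 by move=> [Uz UzV]; split; rewrite ?invrK.
have unX z m : un z -> un (z ^+ m).
  by move=> [Uz UzV]; split; rewrite -?exprVn; apply: (saX sU).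
have un1 j : un (tg j * tau (deg j)^-1%g).
  rewrite -monoE -uE; split; first exact: Uu.
  by apply: UuV; exact: (ltn_ord j).
(* The generator attached to the lift of [x] is exactly this power: [m] has trivial product, so
   [#[y]] divides [m y], and the bounds on the exponents of [x^-1] leave only [#[x]] at [x] and 0
   elsewhere. *)
have un2 x : x \in b -> un (tg (ghat x) ^+ #[x]%g).
  move=> xb; pose m y := ((y == x) + a x^-1%g y)%N.
  have m1 : (\prod_(y <- b) y ^+ m y = 1)%g.
    by rewrite prodg_add prodg_delta // -(aP _).2 mulgV.
  have mE y : y \in b -> m y = if y == x then #[x]%g else 0%N.
    move=> yb; have := ind m m1 y yb; have := (aP x^-1%g).1 y yb; rewrite /m.
    have [->|ne] := eqVneq y x => lt; rewrite ?add1n ?add0n => dv.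
      by apply/eqP; rewrite eqn_leq lt dvdn_leq.
    apply/eqP; rewrite -leqn0 leqNgt; apply/negP => pos.
    by move: (dvdn_leq pos dv); rewrite leqNgt lt.
  have := un1 (ghat x); rewrite ghatP; suff -> : tg (ghat x) ^+ #[x]%g =
      tg (ghat x) * tau x^-1%g by [].
  have -> : tg (ghat x) * tau x^-1%g = Tm m.
    rewrite TmD; congr (_ * _); rewrite /Tm (bigD1_seq x) //= eqxx expr1 big1 ?mulr1 //.
    by move=> y /negPf ->; rewrite expr0.
  rewrite /Tm (bigD1_seq x) //= mE // eqxx [X in _ * X]big_seq_cond big1 ?mulr1 //.
  by move=> y /andP [yb /negPf ne]; rewrite mE // ne expr0.
have unT m : (\prod_(y <- b) y ^+ m y = 1)%g -> un (Tm m).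
  move=> m1; rewrite /Tm big_seq; elim/big_rec: _ => [|x z xb uz].
    by split; rewrite ?invr1; apply: (sa1 sU).
  apply: (unM) => //; have /dvdnP [c ->] := ind m m1 x xb.
  by rewrite mulnC exprM; apply: (unX); apply: un2.
have un_tau g : un (tau g * tau g^-1%g).
  by rewrite -TmD; apply: (unT); rewrite prodg_add -!(aP _).2 mulgV.
have un_tau1 : un (tau 1%g) by apply: (unT); rewrite -(aP _).2.
have nzt g : tau g != 0 by apply: Tm_neq0.
(* [tau] is a section of the degree, multiplicative up to units of [U]. *)
have un_tauM g h : un (tau (g * h)%g * (tau g * tau h)^-1).
  have e : un (tau g * tau h * tau (g * h)^-1%g).
    by rewrite -!TmD; apply: (unT); rewrite !prodg_add -!(aP _).2 mulgV.
  have -> : tau (g * h)%g * (tau g * tau h)^-1 = (tau (g * h)%g * tau (g * h)^-1%g)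
      * (tau g * tau h * tau (g * h)^-1%g)^-1.
    by field; rewrite !nzt.
  by apply: (unM) => //; apply: unV.
(* The component of degree [g] consists of what [tau g^-1] brings into [U]. The previous units make
   the family multiplicative. *)
pose V g z := U (z * tau g^-1%g).
have gV : is_graded io V.
  split.
  - move=> c; rewrite /V invg1; apply: (saM sU); first exact: (sac sU).
    by case: un_tau1.
  - by move=> g; rewrite /V mul0r; apply: (sa0 sU).
  - by move=> g z w Vz Vw; rewrite /V mulrDl; apply: (saD sU).
  move=> g h z w Vz Vw; rewrite /V.
  have -> : z * w * tau (g * h)^-1%g = (z * tau g^-1%g) * (w * tau h^-1%g)
      * (tau (g^-1 * h^-1)%g * (tau g^-1%g * tau h^-1%g)^-1).
    rewrite invMg [(h^-1 * _)%g]gTC.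
    by field; rewrite !nzt.
  apply: (saM sU); first exact: (saM sU).
  by case: (un_tauM g^-1%g h^-1%g).
have VU z : V 1%g z -> U z.
  rewrite /V invg1 => Uz; rewrite -(mulfK (Tm_neq0 (a 1%g)) z).
  by apply: (saM sU) => //; case: un_tau1.
have UV z : U z -> V 1%g z.
  by move=> Uz; rewrite /V invg1; apply: (saM sU) => //; case: un_tau1.
have Vtg j : V (deg j) (tg j) by case: (un1 j).
have VtgV j : V (deg j)^-1%g (tg j)^-1.
  rewrite /V invgK.
  have -> : (tg j)^-1 * tau (deg j) = (tau (deg j) * tau (deg j)^-1%g)
      * (tg j * tau (deg j)^-1%g)^-1.
    by field; rewrite nzt tg_neq0.
  by have [Uu1 _] := unM _ _ (un_tau (deg j)) (unV _ (un1 j)).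
case: (gV) => Vc V0 VD VM.
have Vxs (i : 'I_n) : (l <= i)%N -> V (ds i) (ev io t (xs i)).
  move=> ge; rewrite -(mulfK (tg_neq0 (ghat (ds i)^-1%g)) (ev io t (xs i))) -u_ge //.
  rewrite -[ds i]mul1g; apply: (VM); first exact: UV.
  by have := VtgV (ghat (ds i)^-1%g); rewrite ghatP invgK mul1g.
(* On the spanning set of [spanP], [t ** pi g] takes the value [t_x] or 0 according to whether [x]
   has degree [g]. *)
have Vt g i : V g ((t ** pi g) i).
  rewrite -(ev_ebas io (t ** pi g)); have [c [d ->]] := spanP (ebas k i).
  have sVg : is_submod (fun z => exists c, z = io c) (V g) := graded_submod gV g.
  have [_ VDg VZg] := sVg.
  rewrite evD !ev_sum; apply: VDg;
    apply: (submod_sum (A := fun z => exists c, z = io c)) => // j Hj.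
    rewrite evZ; apply: (VZg); first by eexists.
    rewrite (ev_conv_piR_grouplike io t g (glgs j) (degP j)).
    by case: eqP => [->|_]; rewrite ?mul1r ?mul0r //; apply: V0.
  rewrite evZ; apply: (VZg); first by eexists.
  have [y yE] := xsP j; rewrite yE (ev_conv_Qproj hopfH Hab) -yE.
  by case: eqP => [->|_]; rewrite ?mul1r ?mul0r; [exact: Vxs|exact: V0].
have Vgl x g : grouplike H x -> (forall h, hpi pib x h = (h == g)%:R) ->
    V g^-1%g (ev io t x)^-1 /\ ev io t x != 0.
  move=> /gsP [j ->] dg; split; last exact: tg_neq0.
  suff -> : g = deg j by apply: VtgV.
  by have := dg (deg j); rewrite degP eqxx; case: eqP => // _ /eqP; rewrite oner_eq0.
apply: Bmin => // x; apply: VU.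
  exact: (graded_cocyc hopfH ptH Hab tinv_t gV Vt Vgl).
exact: (graded_cocycV hopfH ptH Hab gTC tinv_t gV Vt Vgl).
Qed.

End Generators.

(** * Specialisation to the fraction field of [S(t_H)] *)

Section FractionField.
Variables (k : fieldType) (n : nat) (H : HopfData k n) (tinv : 'I_n -> FracS k n).

Definition LF : fieldType := {fraction {mpoly k[n]}}.
Definition toLF : {rmorphism {mpoly k[n]} -> LF} := @FracField.tofrac {mpoly k[n]}.
Definition ioF : {rmorphism k -> LF} := toLF \o @mpolyC n k.
Definition tF (i : 'I_n) : LF := toLF 'X_i.

Lemma tvarE (x : 'rV[k]_n) : tvar x = ev ioF tF x.
Proof.
rewrite /tvar /toF -[LHS]/(toLF _) rmorph_sum; apply: eq_bigr => i _.
by rewrite -mul_mpolyC rmorphM.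
Qed.

Lemma tvar_ebas i : tvar (ebas k i) = tF i.
Proof. by rewrite tvarE ev_ebas. Qed.

Lemma is_tinv_conv : is_tinv H tinv ->
  conv (cH H ioF) tF tinv = eH H ioF /\ conv (cH H ioF) tinv tF = eH H ioF.
Proof.
move=> Ht; split; apply: functional_extensionality => i; have [E1 E2] := Ht i.
  rewrite -[RHS]E1; apply: eq_bigr => j _; apply: eq_bigr => l _.
  by rewrite tvar_ebas.
rewrite -[RHS]E2; apply: eq_bigr => j _; apply: eq_bigr => l _.
by rewrite tvar_ebas.
Qed.

Lemma sigmaE i j : sigma H tinv i j = cocyc H ioF tF tinv (i, j).
Proof.
rewrite /cocyc /conv [RHS](eq_bigr (fun y => \sum_z cHH H ioF (i, j) (y.1, y.2) z
    * (tF y.1 * tF y.2 * mus H ioF tinv z))) => [|[] //].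
rewrite -(pair_bigA _ (fun a p => \sum_z cHH H ioF (i, j) (a, p) z
    * (tF a * tF p * mus H ioF tinv z))) /=.
apply: eq_bigr => a _; rewrite exchange_big; apply: eq_bigr => p _ /=.
rewrite [RHS](eq_bigr (fun z => cHH H ioF (i, j) (a, p) (z.1, z.2)
    * (tF a * tF p * mus H ioF tinv (z.1, z.2)))) => [|[] //].
rewrite -(pair_bigA _ (fun b q => cHH H ioF (i, j) (a, p) (b, q)
    * (tF a * tF p * mus H ioF tinv (b, q)))) /=.
by apply: eq_bigr => b _; apply: eq_bigr => q _; rewrite !tvar_ebas.
Qed.

Lemma sigmainvE i j : sigmainv H tinv i j = cocycV H ioF tF tinv (i, j).
Proof.
rewrite /cocycV /conv [RHS](eq_bigr (fun y => \sum_z cHH H ioF (i, j) (y.1, y.2) z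
    * (mus H ioF tF (y.1, y.2) * tens tinv tinv z))) => [|[] //].
rewrite -(pair_bigA _ (fun a p => \sum_z cHH H ioF (i, j) (a, p) z
    * (mus H ioF tF (a, p) * tens tinv tinv z))) /=.
apply: eq_bigr => a _; rewrite exchange_big; apply: eq_bigr => p _ /=.
rewrite [RHS](eq_bigr (fun z => cHH H ioF (i, j) (a, p) (z.1, z.2)
    * (mus H ioF tF (a, p) * (tinv z.1 * tinv z.2)))) => [|[] //].
rewrite -(pair_bigA _ (fun b q => cHH H ioF (i, j) (a, p) (b, q)
    * (mus H ioF tF (a, p) * (tinv b * tinv q)))) /=.
by apply: eq_bigr => b _; apply: eq_bigr => q _; rewrite tvarE ev_mulc -mulrA.
Qed.

Lemma gen_alg_subalg S : is_subalg ioF (gen_alg (k := k) (n := n) S).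
Proof. by split; [exact: gen_const|exact: gen_add|exact: gen_mul]. Qed.

Lemma gen_alg_min (S P : FracS k n -> Prop) : is_subalg ioF P ->
  (forall z, S z -> P z) -> forall z, gen_alg S z -> P z.
Proof.
move=> sP SP z; elim=> {z} [z Sz|c|z w _ Pz _ Pw|z w _ Pz _ Pw].
- exact: SP.
- exact: (sac sP).
- exact: (saD sP).
- exact: (saM sP).
Qed.

End FractionField.

Theorem theorem4p6 (k : fieldType) (n : nat) (H : HopfData k n)
  (gT : finGroupType) (pib : 'I_n -> gT -> k)
  (l : nat) (gs : 'I_l -> 'rV[k]_n) (b : seq gT) (tinv : 'I_n -> FracS k n) :
  is_hopf H -> pointed H ->
  (* H_ab = k[Gamma], Gamma = [set: gT] (so Gbar = G(H_ab) ~ Gamma) *)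
  Hab_group_algebra H pib ->
  (* l = card G(H), gs an enumeration of G(H) *)
  injective gs -> (forall x, grouplike H x <-> exists j, x = gs j) ->
  (* primary decomposition of Gbar *)
  (\big[dprod/1]_(x <- b) <[x]>)%g = [set: gT] ->
  (forall x, x \in b -> prime_power #[x]%g) ->
  is_tinv H tinv ->
  let d := sumn [seq #[x]%g | x <- b] in
  let r := size b in
  exists u : 'I_n -> FracS k n,
    (forall i : 'I_n, (i < l)%N ->
       exists s : seq 'I_l, (size s <= d - r + 1)%N /\
                            u i = \prod_(j <- s) tvar (gs j)) /\
    (forall i : 'I_n, (l <= i)%N ->
       exists s : seq 'rV[k]_n, (size s <= 2)%N /\ u i = \prod_(x <- s) tvar x) /\
    (forall i : 'I_n, (i < l)%N -> u i != 0) /\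
    (forall z, base_alg H tinv z <->
       gen_alg (fun w => exists i : 'I_n,
                  w = u i \/ ((i < l)%N /\ w = (u i)^-1)) z).
Proof.
move=> hopfH ptH Hab gs_inj gsP defG pp_b tinvP d r.
have ord_b x : x \in b -> (1 < #[x]%g)%N.
  by move=> /pp_b [p [e [pr [e0 ->]]]]; rewrite -(expn0 p) ltn_exp2l ?prime_gt1.
have [t_tinv tinv_t] := is_tinv_conv tinvP.
have toLC c : toLF k n c%:MP = ioF k n c by [].
have toLX i : toLF k n 'X_i = tF k i by [].
have toL_inj : injective (toLF k n).
  by move=> p q /eqP; rewrite /toLF /= tofrac_eq => /eqP.
have sB : is_subalg (ioF k n) (base_alg H tinv) by apply: gen_alg_subalg.
have Bsig x : base_alg H tinv (cocyc H (ioF k n) (@tF k n) tinv x).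
  by case: x => i j; rewrite -sigmaE; apply: gen_base; exists i, j; left.
have Bsigi x : base_alg H tinv (cocycV H (ioF k n) (@tF k n) tinv x).
  by case: x => i j; rewrite -sigmainvE; apply: gen_base; exists i, j; right.
have Bmin P : is_subalg (ioF k n) P ->
    (forall x, P (cocyc H (ioF k n) (@tF k n) tinv x)) ->
    (forall x, P (cocycV H (ioF k n) (@tF k n) tinv x)) ->
    forall z, base_alg H tinv z -> P z.
  move=> sP P1 P2; apply: gen_alg_min => // z [i [j [->|->]]].
    by rewrite sigmaE.
  by rewrite sigmainvE.
have [u [u1 u2 u3 u4 u5]] := generators hopfH ptH Hab gs_inj gsP defG ord_b
  toL_inj toLC toLX t_tinv tinv_t sB Bsig Bsigi Bmin.
exists u; split; [|split; [|split]] => //.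
- move=> i /u1 [s [sz ->]]; exists s; split=> //.
  by apply: eq_bigr => j _; rewrite tvarE.
- move=> i /u2 [s [sz ->]]; exists s; split=> //.
  by apply: eq_bigr => j _; rewrite tvarE.
move=> z; split.
  apply: u5; first exact: gen_alg_subalg.
    by move=> i; apply: gen_base; exists i; left.
  by move=> i lt; apply: gen_base; exists i; right.
apply: gen_alg_min => // {}z [i [->|[lt ->]]]; have [B1 B2] := u4 i => //.
exact: B2.
Qed.
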